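(* Let $G$ be a connected, locally finite, unimodular, quasi-transitive graph. If $G$ is non-amenable then its Bernoulli graphing $\mathcal{G}$ has positive spectral gap, in the following sense. Let $\mathcal{M}$ be the Markov operator of $\mathcal{G}$ on $L^2(\Omega,\nu_{\mathrm{st}})$ and let $M_T$ be the finite Markov chain on the orbits of $G$. (a) If $M_T$ is not bipartite, then the spectral radius of $\mathcal{M}$ restricted to $L^2_0(\Omega,\nu_{\mathrm{st}})$, the orthogonal complement of the constant functions, is strictly less than $1$. (b) If $M_T$ is bipartite, then $\mathcal{G}$ is measurably bipartite, with bipartition $X_1\cup X_2$ of its vertex set, and the spectral radius of $\mathcal{M}$ restricted to $L^2_{00}(\Omega,\nu_{\mathrm{st}})$, the orthogonal complement of the subspace generated by the functions $\mathbf{1}$ and $\mathbf{1}_{X_1}-\mathbf{1}_{X_2}$, is strictly less than $1$.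
   Context: Non-amenable: let $p_n(x,y)$ be the probability that the simple random walk on $G$ started at $x$ is at $y$ after $n$ steps, and $\rho=\limsup_{n\to\infty}p_n(x,y)^{1/n}$ (independent of $x,y$); $G$ is non-amenable if $\rho<1$. Let $\Gamma=\mathrm{Aut}(G)$. Quasi-transitive: $\Gamma$ has finitely many orbits on $V(G)$. There is a function $\mu:V(G)\to(0,\infty)$, unique up to a multiplicative constant, with $\mu(x)/\mu(y)=|\mathrm{Stab}_\Gamma(x).y|/|\mathrm{Stab}_\Gamma(y).x|$ for all $x,y$; $G$ is unimodular if $\mu$ is constant on $\Gamma$-orbits. Let $T=\{o_1,\dots,o_t\}$ be a set of representatives of the $\Gamma$-orbits on $V(G)$, and let $p$ be the probability distribution on $T$ proportional to $\mu(o_i)^{-1}$. The Markov chain $M_T$ has state space $T$ and transition probabilities $p_{M_T}(o_i,o_j)=|\{v\in\Gamma.o_j : o_iv\in E(G)\}|/\deg(o_i)$. It is reversible, so its transition matrix has real eigenvalues $1=\lambda_1\ge\lambda_2\ge\dots\ge\lambda_t$. $M_T$ is bipartite if $\lambda_t=-1$; equivalently, $T$ can be partitioned into $T_1\cup T_2$ with $p_{M_T}(o_i,o_j)=0$ whenever $o_i,o_j$ are both in $T_1$ or both in $T_2$. Bernoulli graphing: let $D$ be a bound on the degrees of $G$, and let $\Omega$ be the space of triples $(H,u,\omega)$, up to rooted label-preserving isomorphism, where $(H,u)$ is a connected rooted graph with degrees at most $D$ and $\omega:V(H)\to[0,1]$. Connect $(H,u,\omega)$ and $(H',u',\omega')$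 if the second can be obtained from the first by moving the root $u$ to one of its neighbours. Let $\nu$ be the law of $(G,o,\omega)$, where $o$ has law $p$ and, independently, $\omega$ has law $\mathtt{u}^{V(G)}$ with $\mathtt{u}$ the Lebesgue measure on $[0,1]$. The resulting graph on $\Omega$ with the measure $\nu$ is the Bernoulli graphing $\mathcal{G}$ of $G$. The degree-biased measure is $\nu_{\mathrm{st}}(A)=\int_A\deg\,d\nu/\int_\Omega\deg\,d\nu$. The Markov operator $(\mathcal{M}f)(G,o,\omega)=\frac{1}{\deg_G(o)}\sum_{ov\in E(G)}f(G,v,\omega)$ is self-adjoint on $L^2(\Omega,\nu_{\mathrm{st}})$. Measurably bipartite with bipartition $X_1\cup X_2$ means that, up to null sets, the vertex set is a disjoint union of measurable sets $X_1,X_2$ with every edge joining $X_1$ to $X_2$. Here $X_j$ is the set of (classes of) $(G,o,\omega)$ with $o$ in the $\Gamma$-orbit of an element of $T_j$. *)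

(* Defs.v *)
From HB Require Import structures.
From mathcomp Require Import all_boot all_order all_algebra finmap.
From mathcomp Require Import interval_inference.
From mathcomp Require Import all_classical all_reals all_analysis.
From mathcomp Require Import measurable_realfun.
From mathcomp Require Import complex.

Set Implicit Arguments.
Unset Strict Implicit.
Unset Printing Implicit Defensive.

Import Order.TTheory GRing.Theory Num.Theory.
Import numFieldNormedType.Exports.

Local Open Scope classical_set_scope.
Local Open Scope card_scope.
Local Open Scope quotient_scope.
Local Open Scope ring_scope.

Record sgraph (V : Type) := SGraph {
  adj :> V -> V -> bool;
  adj_sym : symmetric adj;
  adj_irr : irreflexive adj }.

Definition nbrs (V : Type) (G : sgraph V) (x : V) : set V := [set y | G x y].

(* Number of elements of a finite set; 0 on infinite sets, to which it is never
   applied below, the graphs being locally finite. *)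
Definition set_size (V : choiceType) (A : set V) : nat := #|` fset_set A|.

Definition deg (V : choiceType) (G : sgraph V) (x : V) : nat :=
  set_size (nbrs G x).

Definition connected_graph (V : Type) (G : sgraph V) : Prop :=
  forall x y, exists2 p, path G x p & last x p = y.

Definition locally_finite (V : Type) (G : sgraph V) : Prop :=
  forall x, finite_set (nbrs G x).

Definition degrees_le (V : Type) (G : sgraph V) (D : nat) : Prop :=
  forall x, nbrs G x #<= `I_D.

Definition graph_aut (V : Type) (G : sgraph V) : set (V -> V) :=
  [set g : V -> V | bijective g /\ forall x y, G (g x) (g y) = G x y].

Definition aut_orbit (V : Type) (G : sgraph V) (x : V) : set V :=
  [set g x | g in graph_aut G].

Definition stab (V : Type) (G : sgraph V) (x : V) : set (V -> V) :=
  graph_aut G `&` [set g : V -> V | g x = x].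

Definition quasi_transitive (V : Type) (G : sgraph V) : Prop :=
  finite_set (range (aut_orbit G)).

Definition modular_function (R : realType) (V : choiceType) (G : sgraph V)
    (mu : V -> {posnum R}) : Prop :=
  forall x y, (mu x)%:num / (mu y)%:num =
    (set_size [set g y | g in stab G x])%:R /
    (set_size [set g x | g in stab G y])%:R :> R.

Definition unimodular (R : realType) (V : choiceType) (G : sgraph V) : Prop :=
  exists2 mu : V -> {posnum R}, modular_function G mu &
    forall x y, aut_orbit G x y -> mu x = mu y.

(* On an isolated vertex the walk stays put; in a connected graph this only
   concerns the one-vertex graph, which is thereby amenable like every other
   finite graph. *)
Definition walk_step (R : realType) (V : choiceType) (G : sgraph V)
    (h : V -> R) (x : V) : R :=
  if deg G x == 0%N then h x
  else (\sum_(z <- fset_set (nbrs G x)) h z) / (deg G x)%:R.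

Definition walk_prob (R : realType) (V : choiceType) (G : sgraph V)
    (n : nat) (x y : V) : R :=
  iter n (walk_step G) (fun z => (z == y)%:R) x.

Definition rho (R : realType) (V : choiceType) (G : sgraph V) (x y : V)
    : \bar R :=
  limn_esup (fun n => (walk_prob R G n x y `^ n%:R^-1)%:E).

(* In a connected graph rho does not depend on the two vertices. *)
Definition non_amenable (R : realType) (V : choiceType) (G : sgraph V) : Prop :=
  exists x y, (rho R G x y < 1)%E.

Definition orbit_representatives (V : Type) (G : sgraph V) (t : nat)
    (o : 'I_t -> V) : Prop :=
  forall v, exists! i, aut_orbit G (o i) v.

Definition orbit_chain (R : realType) (V : choiceType) (G : sgraph V) (t : nat)
    (o : 'I_t -> V) : 'M[R]_t :=
  \matrix_(i, j) ((set_size (aut_orbit G (o j) `&` nbrs G (o i)))%:R /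
                  (deg G (o i))%:R).

(* The smallest eigenvalue is -1; the chain being reversible, all its
   eigenvalues are real. *)
Definition bipartite_chain (R : realType) (t : nat) (P : 'M[R]_t) : Prop :=
  eigenvalue P (-1) /\ forall a, eigenvalue P a -> -1 <= a.

Definition chain_bipartition (R : realType) (t : nat) (P : 'M[R]_t)
    (T1 T2 : {set 'I_t}) : Prop :=
  [/\ T1 :|: T2 = [set: 'I_t]%SET, T1 :&: T2 = finset.set0,
      forall i j, i \in T1 -> j \in T1 -> P i j = 0 &
      forall i j, i \in T2 -> j \in T2 -> P i j = 0].

(* The distribution on the orbit representatives proportional to mu^-1. *)
Definition orbit_weight (R : realType) (V : Type) (t : nat) (o : 'I_t -> V)
    (mu : V -> {posnum R}) (i : 'I_t) : R :=
  (mu (o i))%:num^-1 / \sum_(j < t) (mu (o j))%:num^-1.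

Lemma orbit_weight_ge0 (R : realType) (V : Type) (t : nat) (o : 'I_t -> V)
  (mu : V -> {posnum R}) (i : 'I_t) : 0 <= orbit_weight o mu i.
Proof. by rewrite divr_ge0 ?sumr_ge0. Qed.

HB.instance Definition _ (R : realType) :=
  isPointed.Build {i01 R} (0%:i01 : {i01 R}).

Definition coordinate_sets (R : realType) (V : Type)
    : set (set (V -> {i01 R})) :=
  [set A | exists v (B : set R),
     measurable B /\ A = [set w : V -> {i01 R} | B (w v)%:num]].

Definition labeling (R : realType) (V : Type) : Type :=
  g_sigma_algebraType (@coordinate_sets R V).

HB.instance Definition _ (R : realType) (V : Type) :=
  Measurable.on (@labeling R V).

(* L is the product over V of the Lebesgue measure on [0, 1], given by its
   values on the cylinder sets; these determine it. *)
Definition iid_uniform (R : realType) (V : choiceType)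
    (L : set (labeling R V) -> \bar R) : Prop :=
  forall (F : {fset V}) (B : V -> set R), (forall v, measurable (B v)) ->
    L [set w | forall v, v \in F -> B v (w v)%:num] =
    (\prod_(v <- F) lebesgue_measure (B v `&` `[0%R, 1%R]))%E.

(* Connected locally finite graphs are countable, so up to isomorphism the
   vertex set can be taken to be a set of natural numbers. *)
Record rlgraph (R : realType) (D : nat) := RLGraph {
  rl_dom : nat -> bool;
  rl_graph : sgraph {n | rl_dom n};
  rl_root : {n | rl_dom n};
  rl_label : {n | rl_dom n} -> {i01 R};
  rl_connected : connected_graph rl_graph;
  rl_degrees : degrees_le rl_graph D }.

HB.instance Definition _ (R : realType) (D : nat) :=
  gen_eqMixin (rlgraph R D).
HB.instance Definition _ (R : realType) (D : nat) :=
  gen_choiceMixin (rlgraph R D).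

Definition rl_iso (R : realType) (V V' : Type)
    (G : sgraph V) (u : V) (w : V -> {i01 R})
    (G' : sgraph V') (u' : V') (w' : V' -> {i01 R}) : Prop :=
  exists f : V -> V', [/\ bijective f,
    forall x y, G' (f x) (f y) = G x y, f u = u' & forall x, w' (f x) = w x].

Definition rl_equiv (R : realType) (D : nat) (x y : rlgraph R D) : bool :=
  `[< rl_iso (rl_graph x) (rl_root x) (@rl_label _ _ x)
             (rl_graph y) (rl_root y) (@rl_label _ _ y) >].

Lemma rl_iso_refl (R : realType) (V : Type) (G : sgraph V) (u : V)
  (w : V -> {i01 R}) : rl_iso G u w G u w.
Proof. by exists id; split => //; exists id. Qed.

Lemma rl_iso_sym (R : realType) (V V' : Type) (G : sgraph V) (u : V)
    (w : V -> {i01 R}) (G' : sgraph V') (u' : V') (w' : V' -> {i01 R}) :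
  rl_iso G u w G' u' w' -> rl_iso G' u' w' G u w.
Proof.
move=> [f [[g fK gK] fG <- fw]]; exists g; split.
- by exists f.
- by move=> x y; rewrite -fG !gK.
- exact: fK.
- by move=> x; rewrite -fw gK.
Qed.

Lemma rl_iso_trans (R : realType) (V1 V2 V3 : Type)
    (G1 : sgraph V1) (u1 : V1) (w1 : V1 -> {i01 R})
    (G2 : sgraph V2) (u2 : V2) (w2 : V2 -> {i01 R})
    (G3 : sgraph V3) (u3 : V3) (w3 : V3 -> {i01 R}) :
  rl_iso G1 u1 w1 G2 u2 w2 -> rl_iso G2 u2 w2 G3 u3 w3 ->
  rl_iso G1 u1 w1 G3 u3 w3.
Proof.
move=> [f [fb fG <- fw]] [g [gb gG <- gw]]; exists (g \o f); split => //.
- exact: bij_comp.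
- by move=> x y /=; rewrite gG fG.
- by move=> x /=; rewrite gw fw.
Qed.

Section rl_equiv_rel.
Variables (R : realType) (D : nat).

Let equiv_refl : reflexive (@rl_equiv R D).
Proof. by move=> x; apply/asboolP; exact: rl_iso_refl. Qed.

Let equiv_sym : symmetric (@rl_equiv R D).
Proof. by move=> x y; apply/asboolP/asboolP; exact: rl_iso_sym. Qed.

Let equiv_trans : transitive (@rl_equiv R D).
Proof.
move=> y x z /asboolP xy /asboolP yz; apply/asboolP.
exact: rl_iso_trans xy yz.
Qed.

Canonical rl_equiv_rel :=
  EquivRel (@rl_equiv R D) equiv_refl equiv_sym equiv_trans.

End rl_equiv_rel.

Definition rl_class (R : realType) (D : nat) : Type :=
  {eq_quot (@rl_equiv R D)}.
HB.instance Definition _ (R : realType) (D : nat) := Choice.on (rl_class R D).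
HB.instance Definition _ (R : realType) (D : nat) :=
  EqQuotient.on (rl_class R D).

Definition empty_graph (V : Type) : sgraph V :=
  @SGraph V (fun _ _ => false) (fun _ _ => erefl) (fun _ => erefl).

Lemma one_vertex_connected :
  connected_graph (empty_graph {n : nat | pred1 0%N n}).
Proof.
move=> x y; exists [::] => //=; apply: val_inj.
by move: (valP x) (valP y) => /eqP -> /eqP ->.
Qed.

Lemma one_vertex_degrees D :
  degrees_le (empty_graph {n : nat | pred1 0%N n}) D.
Proof.
move=> x; rewrite (_ : nbrs _ _ = set0) ?card_le0x//.
by rewrite -subset0 => y.
Qed.

HB.instance Definition _ (R : realType) (D : nat) :=
  isPointed.Build (rl_class R D)
  (\pi_(rl_class R D) (@RLGraph R D (pred1 0%N) (empty_graph _)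
     (exist _ 0%N (eqxx 0%N)) (fun=> point) one_vertex_connected
     (one_vertex_degrees D))).

Fixpoint gball (V : Type) (G : sgraph V) (u : V) (r : nat) : set V :=
  if r is r'.+1 then gball G u r' `|` \bigcup_(x in gball G u r') nbrs G x
  else [set u].

(* The r-balls around the two roots are isomorphic as rooted graphs, with
   corresponding labels less than e apart. *)
Definition near_iso (R : realType) (r : nat) (e : R) (V V' : Type)
    (G : sgraph V) (u : V) (w : V -> {i01 R})
    (G' : sgraph V') (u' : V') (w' : V' -> {i01 R}) : Prop :=
  exists f : V -> V', [/\ set_bij (gball G u r) (gball G' u' r) f, f u = u',
    forall x y, gball G u r x -> gball G u r y -> G' (f x) (f y) = G x y &
    forall x, gball G u r x -> `|(w' (f x))%:num - (w x)%:num| < e].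

Definition local_ball (R : realType) (D : nat) (x : rlgraph R D) (r : nat)
    (e : R) : set (rl_class R D) :=
  \pi @` [set y | near_iso r e
    (rl_graph x) (rl_root x) (@rl_label _ _ x)
    (rl_graph y) (rl_root y) (@rl_label _ _ y)].

(* The sets local_ball x r e, for r and e varying, form a basis of
   neighbourhoods of the class of x in the topology of local convergence. That
   topology is separable and metrizable, so they generate its Borel
   sigma-algebra. *)
Definition local_balls (R : realType) (D : nat) : set (set (rl_class R D)) :=
  [set A | exists x r e, 0 < e /\ A = local_ball x r e].

Definition Omega (R : realType) (D : nat) : Type :=
  g_sigma_algebraType (@local_balls R D).
HB.instance Definition _ (R : realType) (D : nat) :=
  Measurable.on (Omega R D).

(* rooted_class o w is the class of (G, o, w), where G is carried over to
   natural numbers by the enumeration of the countable type V. *)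
Section rooted_class.
Context (R : realType) (V : countType) (G : sgraph V) (D : nat).
Hypotheses (G_conn : connected_graph G) (G_deg : degrees_le G D).

Let dom : nat -> bool := fun n => isSome (choice.pickle_inv n : option V).

Let dec (n : {n | dom n}) : V :=
  match pickle_inv (sval n) as v return isSome v -> V with
  | Some v => fun=> v
  | None => fun nov => False_rect V (notF nov)
  end (svalP n).

Let enc_subproof (v : V) : dom (choice.pickle v).
Proof. by rewrite /dom pickleK_inv. Qed.

Let enc (v : V) : {n | dom n} := exist _ (choice.pickle v) (enc_subproof v).

Let decE n : pickle_inv (sval n) = Some (dec n).
Proof.
rewrite /dec; move: (svalP n); rewrite /dom /=.
by case: (choice.pickle_inv (sval n)).
Qed.

Let encK : cancel enc dec.
Proof. by move=> v; apply: Some_inj; rewrite -decE pickleK_inv. Qed.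

Let decK : cancel dec enc.
Proof.
move=> n; apply: val_inj => /=.
by have := @pickle_invK V (sval n); rewrite decE.
Qed.

Let code_graph : sgraph {n | dom n} :=
  @SGraph _ (fun a b => G (dec a) (dec b))
    (fun a b => adj_sym G (dec a) (dec b)) (fun a => adj_irr G (dec a)).

Let code_connected : connected_graph code_graph.
Proof.
move=> a b; have [p pP pl] := G_conn (dec a) (dec b).
exists (map enc p); last by rewrite -(decK a) last_map pl decK.
rewrite -(decK a) path_map; apply: sub_path pP => x y /=.
by rewrite !encK.
Qed.

Let code_degrees : degrees_le code_graph D.
Proof.
move=> a; have dec_inj : {in nbrs code_graph a &, injective dec}.
  by move=> x y _ _; exact: (can_inj decK).
have /card_eqPle[_ card_dec] := inj_card_eq dec_inj.
apply: card_le_trans card_dec (card_le_trans _ (G_deg (dec a))).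
by apply: subset_card_le => _ [x ? <-].
Qed.

Definition rooted_rlgraph (o : V) (w : labeling R V) : rlgraph R D :=
  @RLGraph R D dom code_graph (enc o) (w \o dec) code_connected code_degrees.

Definition rooted_class (o : V) (w : labeling R V) : Omega R D :=
  \pi_(rl_class R D) (rooted_rlgraph o w).

Lemma rooted_rlgraph_iso (o : V) (w : labeling R V) :
  rl_iso G o w (rl_graph (rooted_rlgraph o w)) (rl_root (rooted_rlgraph o w))
    (@rl_label _ _ (rooted_rlgraph o w)).
Proof.
exists enc; split => //=; first by exists dec; [exact: encK|exact: decK].
- by move=> x y; rewrite !encK.
- by move=> x; rewrite encK.
Qed.

End rooted_class.

Lemma rl_iso_gball (V V' : Type) (G : sgraph V) (G' : sgraph V') (u : V)
    (f : V -> V') (r : nat) : bijective f ->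
  (forall x y, G' (f x) (f y) = G x y) ->
  gball G' (f u) r = f @` gball G u r.
Proof.
move=> [g fK gK] fG; elim: r => [|r IHr] /=; first by rewrite image_set1.
rewrite image_setU IHr; congr (_ `|` _); apply/seteqP; split => y.
- case=> _ [x xr <-] fxy; exists (g y); last exact: gK.
  by exists x => //; rewrite /nbrs /= -fG gK.
- case=> z [x xr xz] <-; exists (f x); first by exists x.
  by rewrite /nbrs /= fG.
Qed.

Lemma near_iso_rl_iso (R : realType) (r : nat) (e : R) (V1 V2 V3 : Type)
    (G1 : sgraph V1) (u1 : V1) (w1 : V1 -> {i01 R})
    (G2 : sgraph V2) (u2 : V2) (w2 : V2 -> {i01 R})
    (G3 : sgraph V3) (u3 : V3) (w3 : V3 -> {i01 R}) :
  near_iso r e G1 u1 w1 G2 u2 w2 -> rl_iso G2 u2 w2 G3 u3 w3 ->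
  near_iso r e G1 u1 w1 G3 u3 w3.
Proof.
move=> [f [[ff fi fs] fu fG fw]] [h [hb hG <- hw]].
exists (h \o f); split => /=.
- rewrite (rl_iso_gball u2 r hb hG); split.
  + by move=> x /ff xr; exists (f x).
  + by move=> x y xr yr /= /(bij_inj hb); exact: fi.
  + by move=> _ [y /fs [x xr <-] <-]; exists x.
- by rewrite fu.
- by move=> x y xr yr; rewrite hG fG.
- by move=> x xr; rewrite hw; exact: fw.
Qed.

Lemma gball_finite (V : Type) (G : sgraph V) (D : nat) (u : V) (r : nat) :
  degrees_le G D -> finite_set (gball G u r).
Proof.
move=> dG; elim: r => [|r IHr] /=; first exact: finite_set1.
rewrite finite_setU; split => //; apply: bigcup_finite => // x _.
exact: card_le_finite (dG x) (finite_II D).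
Qed.

Lemma local_ballP (R : realType) (D : nat) (x y : rlgraph R D) r e :
  local_ball x r e (\pi_(rl_class R D) y) <->
  near_iso r e (rl_graph x) (rl_root x) (@rl_label _ _ x)
    (rl_graph y) (rl_root y) (@rl_label _ _ y).
Proof.
split=> [[z xz zy]|xy]; last by exists y.
apply: (near_iso_rl_iso xz).
by move/eqmodP: zy => /asboolP.
Qed.

Lemma measurable_rooted_class (R : realType) (V : countType) (G : sgraph V)
    (D : nat) (G_conn : connected_graph G) (G_deg : degrees_le G D) (o : V) :
  measurable_fun [set: labeling R V] (rooted_class G_conn G_deg o).
Proof.
apply: (@measurability _ _ (labeling R V) (Omega R D) setT
  (rooted_class G_conn G_deg o) (@local_balls R D)) => //.
move=> _ [_ [x [r [e [e0 ->]]]] <-]; rewrite setTI.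
have /finite_seqP[s sE] := gball_finite (rl_root x) r (@rl_degrees _ _ x).
pose W (f : {n | rl_dom x n} -> V) : set (labeling R V) :=
  [set w | [/\ set_bij (gball (rl_graph x) (rl_root x) r) (gball G o r) f,
    f (rl_root x) = o,
    forall a b, gball (rl_graph x) (rl_root x) r a ->
      gball (rl_graph x) (rl_root x) r b -> G (f a) (f b) = rl_graph x a b &
    forall a, gball (rl_graph x) (rl_root x) r a ->
      `|(w (f a))%:num - (rl_label a)%:num| < e]].
have mW f : measurable (W f).
  have [fP|fP] := pselect [/\
      set_bij (gball (rl_graph x) (rl_root x) r) (gball G o r) f,
      f (rl_root x) = o &
      forall a b, gball (rl_graph x) (rl_root x) r a ->
      gball (rl_graph x) (rl_root x) r b -> G (f a) (f b) = rl_graph x a b];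
    last first.
    rewrite (_ : W f = set0) ?measurable0// -subset0 => w [? ? ? _].
    by apply: fP.
  rewrite (_ : W f = \bigcap_(a in gball (rl_graph x) (rl_root x) r)
      [set w : labeling R V | `|(w (f a))%:num - (rl_label a)%:num| < e]).
    apply: fin_bigcap_measurable.
      exact: gball_finite (@rl_degrees _ _ x).
    move=> a _; apply: sub_sigma_algebra.
    exists (f a), (ball ((rl_label a)%:num : R) e); split.
      exact: measurable_ball.
    by apply/seteqP; split=> w; rewrite /ball /= distrC.
  by apply/seteqP; split => w; [case=> _ _ _ + a ar; apply|split; case: fP].
pose F (l : seq V) (a : {n | rl_dom x n}) := nth o l (index a s).
rewrite (_ : _ @^-1` _ = \bigcup_(l in [set: seq V]) W (F l)).
  by apply: countable_bigcupT_measurable => //; exact: countableP.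
apply/seteqP; split => w.
- move=> /local_ballP xw.
  have := rl_iso_sym (rooted_rlgraph_iso G_conn G_deg o w).
  move=> /(near_iso_rl_iso xw).
  move=> [f [[ff fi fs] fu fG fw]]; exists (map f s) => //.
  have fE a : gball (rl_graph x) (rl_root x) r a -> F (map f s) a = f a.
    by rewrite sE /= => as_; rewrite /F (nth_map a) ?index_mem// nth_index.
  have xr : gball (rl_graph x) (rl_root x) r (rl_root x).
    by elim: (r) => //= r' ?; left.
  split; last 3 first.
  + by rewrite fE.
  + by move=> a b ar br; rewrite !fE// fG.
  + by move=> a ar; rewrite fE//; exact: fw.
  split.
  + by move=> a ar; rewrite fE//; exact: ff.
  + move=> a b /set_mem ar /set_mem br; rewrite !fE//.
    by apply: fi; exact: mem_set.
  + by move=> b /fs[a ar <-]; exists a => //; rewrite fE.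
- move=> [l _ Wl]; apply/local_ballP.
  apply: near_iso_rl_iso (rooted_rlgraph_iso G_conn G_deg o w).
  by exists (F l).
Qed.

Definition root_deg (R : realType) (D : nat) (x : Omega R D) : nat :=
  deg (rl_graph (repr (x : rl_class R D))) (rl_root (repr (x : rl_class R D))).

Section root_deg_measurable.
Context (R : realType) (D : nat).
Implicit Types x y : rlgraph R D.

Let rdeg x := deg (rl_graph x) (rl_root x).

Let nbrs_finite x a : finite_set (nbrs (rl_graph x) a).
Proof. exact: card_le_finite (@rl_degrees _ _ x a) (finite_II D). Qed.

Let gball1 x :
  gball (rl_graph x) (rl_root x) 1 = rl_root x |` nbrs (rl_graph x) (rl_root x).
Proof. by rewrite /= bigcup_set1. Qed.

Let near_iso_deg x y (e : R) :
  near_iso 1 e (rl_graph x) (rl_root x) (@rl_label _ _ x)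
    (rl_graph y) (rl_root y) (@rl_label _ _ y) -> rdeg x = rdeg y.
Proof.
move=> [f [[ff fi fs] fu fG _]].
rewrite /rdeg /deg /set_size (_ : nbrs (rl_graph y) _ =
    f @` nbrs (rl_graph x) (rl_root x)); last first.
  apply/seteqP; split=> [b rb|_ [a ra <-]].
    have [|a] := fs b; first by rewrite gball1; right.
    rewrite gball1 => -[->|ra] fab; last by exists a.
    by move: rb; rewrite /nbrs /= -fab fu adj_irr.
  by rewrite /nbrs /= -fu fG// gball1; [left|right].
rewrite (fset_set_image _ (@nbrs_finite x _)) card_in_imfset//= => a b.
rewrite !(in_fset_set (@nbrs_finite x _)) => ra rb.
by apply: fi; apply/mem_set; rewrite gball1; right; exact: set_mem.
Qed.

Lemma root_degE x : root_deg (\pi_(rl_class R D) x) = rdeg x.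
Proof.
have /asboolP xx : rl_equiv (repr (\pi_(rl_class R D) x)) x.
  by apply/eqmodP; exact: reprK.
apply: (@near_iso_deg _ _ 1); apply: near_iso_rl_iso xx.
exists id; split => // [|a _]; last by rewrite subrr normr0.
by split => // a; exists a.
Qed.

Let ballseq x : seq {n | rl_dom x n} :=
  rl_root x :: fset_set (nbrs (rl_graph x) (rl_root x)).

Let ballseq_uniq x : uniq (ballseq x).
Proof.
rewrite /= fset_uniq andbT (in_fset_set (@nbrs_finite x _)).
by apply/negP => /set_mem; rewrite /nbrs /= adj_irr.
Qed.

Let mem_ballseq x a :
  (a \in ballseq x) <-> gball (rl_graph x) (rl_root x) 1 a.
Proof.
rewrite gball1 in_cons (in_fset_set (@nbrs_finite x _)); split.
  by move=> /orP[/eqP ->|/set_mem ?]; [left|right].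
by move=> [->|ra]; rewrite ?eqxx//; apply/orP; right; exact: mem_set.
Qed.

Let code x : seq (seq bool) :=
  [seq [seq rl_graph x a b | b <- ballseq x] | a <- ballseq x].

Let code_near x y : code x = code y ->
  near_iso 1 (2 : R) (rl_graph x) (rl_root x) (@rl_label _ _ x)
    (rl_graph y) (rl_root y) (@rl_label _ _ y).
Proof.
move=> xy; have sz : size (ballseq x) = size (ballseq y).
  by have := congr1 size xy; rewrite !size_map.
pose f a := nth (rl_root y) (ballseq y) (index a (ballseq x)).
exists f; split.
- split.
  + move=> a /mem_ballseq ax; apply/mem_ballseq/mem_nth.
    by rewrite -sz index_mem.
  + move=> a b /set_mem/mem_ballseq ax /set_mem/mem_ballseq bx /eqP.
    rewrite /f nth_uniq// -?sz ?index_mem// => /eqP ab.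
    by rewrite -(nth_index (rl_root x) ax) ab nth_index.
  + move=> b /mem_ballseq yb.
    have bx : (index b (ballseq y) < size (ballseq x))%N.
      by rewrite sz index_mem.
    exists (nth (rl_root x) (ballseq x) (index b (ballseq y))).
      exact/mem_ballseq/mem_nth.
    by rewrite /f index_uniq// nth_index.
- by rewrite /f index_head.
- move=> a b /mem_ballseq ax /mem_ballseq bx.
  have := congr1 (fun c => nth false (nth [::] c (index a (ballseq x)))
    (index b (ballseq x))) xy.
  rewrite /code !(nth_map (rl_root x)) ?index_mem// !nth_index// => ->.
  by rewrite !(nth_map (rl_root y)) -?sz ?index_mem.
- move=> a _; rewrite (@le_lt_trans _ _ 1) ?ltr1n//.
  have : 0 <= ((rl_label a)%:num : R) <= 1 by apply/andP; split.
  have : 0 <= ((rl_label (f a))%:num : R) <= 1 by apply/andP; split.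
  move=> /andP[p0 p1] /andP[q0 q1].
  rewrite ler_norml; apply/andP; split.
    by rewrite lerBrDr (le_trans _ p0)// addrC subr_le0.
  by rewrite lerBlDr (le_trans p1)// lerDl.
Qed.

Let measurable_root_deg_eq k :
  measurable [set x : Omega R D | root_deg x = k].
Proof.
pose A (c : seq (seq bool)) : set (Omega R D) :=
  if pselect (exists x, code x = c /\ rdeg x = k) is left h
  then local_ball (projT1 (cid h)) 1 2 else set0.
rewrite (_ : [set _ | _] = \bigcup_(c in setT) A c).
  apply: countable_bigcupT_measurable => [|c]; first exact: countableP.
  rewrite /A; case: pselect => [h|_]; last exact: measurable0.
  by apply: sub_sigma_algebra; exists (projT1 (cid h)), 1%N, 2; split.
apply/seteqP; split => [x xk|x [c _]].
- exists (code (repr (x : rl_class R D))) => //; rewrite /A.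
  case: pselect => [h|]; last by case; exists (repr (x : rl_class R D)).
  case: cid => y [/= yx yk]; rewrite -[x](@reprK _ (rl_class R D)).
  exact/local_ballP/code_near.
- rewrite /A; case: pselect => // h; case: cid => y [_ yk] /= [z yz <-].
  by rewrite root_degE -(near_iso_deg yz).
Qed.

Lemma measurable_root_deg :
  measurable_fun [set: Omega R D] (fun c : Omega R D => (root_deg c)%:R : R).
Proof.
move=> _ B mB; rewrite setTI.
rewrite (_ : _ @^-1` _ =
    \bigcup_(k in [set k | B k%:R]) [set x : Omega R D | root_deg x = k]).
  by apply: bigcup_measurable => k _; exact: measurable_root_deg_eq.
apply/seteqP; split => [x Bx|x [k Bk] /= ->//].
by exists (root_deg x).
Qed.

End root_deg_measurable.

(* The law of (G, o_i, w), where i has law orbit_weight and, independently,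
   w has law L. *)
Section bernoulli_measure.
Context (R : realType) (V : countType) (G : sgraph V) (D : nat).
Hypotheses (G_conn : connected_graph G) (G_deg : degrees_le G D).
Context (t : nat) (o : 'I_t -> V) (mu : V -> {posnum R}).
Variable L : {measure set (labeling R V) -> \bar R}.
Local Open Scope ereal_scope.

Definition bernoulli_measure (A : set (Omega R D)) : \bar R :=
  \sum_(i < t) (orbit_weight o mu i)%:E *
    L (rooted_class G_conn G_deg (o i) @^-1` A).

Let bernoulli_measure0 : bernoulli_measure set0 = 0.
Proof.
rewrite /bernoulli_measure big1// => i _.
by rewrite preimage_set0 measure0 mule0.
Qed.

Let bernoulli_measure_ge0 A : 0 <= bernoulli_measure A.
Proof.
by apply: sume_ge0 => i _; rewrite mule_ge0 ?lee_fin ?orbit_weight_ge0.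
Qed.

Let bernoulli_measure_sigma_additive : semi_sigma_additive bernoulli_measure.
Proof.
move=> F mF tF mUF; rewrite [X in X @ _ --> _](_ : _ = (fun n =>
    \sum_(i < t) (orbit_weight o mu i)%:E *
    \sum_(0 <= k < n) L (rooted_class G_conn G_deg (o i) @^-1` F k)));
  last first.
  apply/funext => n; rewrite /bernoulli_measure exchange_big /=.
  by apply: eq_bigr => i _; rewrite ge0_sume_distrr.
have mpre i A : measurable A ->
    measurable (rooted_class G_conn G_deg (o i) @^-1` A).
  move=> mA; rewrite -[X in measurable X]setTI.
  exact: measurable_rooted_class.
apply: cvg_nnesum => [i _|i _].
  near=> n; apply: mule_ge0; rewrite ?lee_fin ?orbit_weight_ge0//.
  exact: sume_ge0.
apply: cvgeZl => //; rewrite preimage_bigcup.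
apply: measure_semi_sigma_additive => //.
- by move=> k; exact: mpre.
- apply/trivIsetP => j k _ _ jk; rewrite -preimage_setI.
  by move/trivIsetP : tF => /(_ _ _ I I jk) ->; rewrite preimage_set0.
- by rewrite -preimage_bigcup; exact: mpre.
Unshelve. all: by end_near. Qed.

HB.instance Definition _ := isMeasure.Build _ _ _ bernoulli_measure
  bernoulli_measure0 bernoulli_measure_ge0 bernoulli_measure_sigma_additive.

End bernoulli_measure.

Section degree_biased.
Context (R : realType) (D : nat) (nu : {measure set (Omega R D) -> \bar R}).
Local Open Scope ereal_scope.

Definition degree_biased (A : set (Omega R D)) : \bar R :=
  (\int[nu]_(x in A) (root_deg x)%:R%:E) *
  (fine (\int[nu]_x (root_deg x)%:R%:E))^-1%:E.

Let degree_biased0 : degree_biased set0 = 0.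
Proof. by rewrite /degree_biased integral_set0 mul0e. Qed.

Let degree_biased_ge0 A : 0 <= degree_biased A.
Proof.
rewrite mule_ge0 ?integral_ge0// lee_fin invr_ge0 fine_ge0//.
exact: integral_ge0.
Qed.

Let degree_biased_sigma_additive : semi_sigma_additive degree_biased.
Proof.
move=> F mF tF mUF; rewrite [X in X @ _ --> _](_ : _ = (fun n =>
    (\sum_(0 <= k < n) \int[nu]_(x in F k) (root_deg x)%:R%:E) *
    (fine (\int[nu]_x (root_deg x)%:R%:E))^-1%:E)); last first.
  apply/funext => n; rewrite ge0_sume_distrl// => k _; exact: integral_ge0.
apply: cvgeZr => //; apply: semi_sigma_additive_nng_induced => //.
by apply/measurable_EFinP; exact: measurable_root_deg.
Qed.

HB.instance Definition _ := isMeasure.Build _ _ _ degree_biased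
  degree_biased0 degree_biased_ge0 degree_biased_sigma_additive.

End degree_biased.

Definition reroot (R : realType) (D : nat) (x : rlgraph R D)
    (v : {n | rl_dom x n}) : rlgraph R D :=
  RLGraph v (@rl_label _ _ x) (@rl_connected _ _ x) (@rl_degrees _ _ x).

Definition root_nbrs (R : realType) (D : nat) (x : Omega R D) :=
  nbrs (rl_graph (repr (x : rl_class R D))) (rl_root (repr (x : rl_class R D))).

Arguments root_nbrs {R D} x.

Definition move_root (R : realType) (D : nat) (x : Omega R D)
    (v : {n | rl_dom (repr (x : rl_class R D)) n}) : Omega R D :=
  \pi_(rl_class R D) (reroot v).
Arguments move_root {R D} x v.

Definition graphing_adj (R : realType) (D : nat) (x y : Omega R D) : Prop :=
  exists2 v, root_nbrs x v & y = move_root x v.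

Definition measurably_bipartite (R : realType) (D : nat)
    (nu : {measure set (Omega R D) -> \bar R}) (X1 X2 : set (Omega R D))
    : Prop :=
  [/\ measurable X1, measurable X2 &
    exists2 N, nu.-negligible N &
      (forall x, ~ N x -> (X1 x /\ ~ X2 x) \/ (X2 x /\ ~ X1 x)) /\
      (forall x y, ~ N x -> ~ N y -> graphing_adj x y ->
        (X1 x /\ X2 y) \/ (X2 x /\ X1 y))].

(* The classes of the (G, v, w) with v in the orbit of o_i for some i in T. *)
Definition orbit_classes (R : realType) (V : countType) (G : sgraph V) (D : nat)
    (G_conn : connected_graph G) (G_deg : degrees_le G D) (t : nat)
    (o : 'I_t -> V) (T : {set 'I_t}) : set (Omega R D) :=
  [set x | exists i v (w : labeling R V),
    [/\ i \in T, aut_orbit G (o i) v & x = rooted_class G_conn G_deg v w]].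

Local Open Scope complex_scope.

Definition markov_operator (R : realType) (D : nat) (f : Omega R D -> R[i])
    (x : Omega R D) : R[i] :=
  (\sum_(v <- fset_set (root_nbrs x)) f (move_root x v)) / (root_deg x)%:R.

Definition constant_functions (R : realType) (T : Type) : set (T -> R[i]) :=
  range (fun a => cst a).

Definition span_one_diff (R : realType) (T : Type) (X1 X2 : set T)
    : set (T -> R[i]) :=
  [set h | exists a b : R[i],
     h = (fun x => a + b * (\1_X1 x - \1_X2 x : R)%:C)].

Arguments constant_functions R T : clear implicits.
Arguments span_one_diff R {T} X1 X2.

Section complex_L2.
Context d (T : measurableType d) (R : realType).
Variable m : {measure set T -> \bar R}.
Implicit Types f g h : T -> R[i].

(* Elements of the complex Hilbert space L^2 are handled through representing
   functions; equality in it is equality almost everywhere. *)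
Definition L2 : set (T -> R[i]) := [set f |
  (fun x => complex.Re (f x)) \in Lfun m 2%:E /\
  (fun x => complex.Im (f x)) \in Lfun m 2%:E].

Definition L2inner f g : R[i] :=
  Complex (\int[m]_x complex.Re (f x * (g x)^*))
          (\int[m]_x complex.Im (f x * (g x)^*)).

Definition L2norm f : \bar R :=
  Lnorm m 2%:E (fun x => (Normc.normc (f x))%:E).

Definition L2perp (S : set (T -> R[i])) : set (T -> R[i]) :=
  L2 `&` [set f | forall h, S h -> L2inner f h = 0].

(* l is in the resolvent set of the restriction of M to H when l - M is a
   bijection of H, modulo almost everywhere equality, with bounded inverse;
   injectivity follows from the second condition. *)
Definition resolvent_set (H : set (T -> R[i])) (M : (T -> R[i]) -> T -> R[i])
    : set R[i] :=
  [set l | (forall g, H g -> exists2 f, H f &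
              {ae m, forall x, l * f x - M f x = g x}) /\
           exists K : R, forall f, H f ->
             (L2norm f <= K%:E * L2norm (fun x => l * f x - M f x)%R)%E].

Definition spectral_radius (H : set (T -> R[i])) (M : (T -> R[i]) -> T -> R[i])
    : \bar R :=
  ereal_sup [set (Normc.normc l)%:E | l in ~` resolvent_set H M].

End complex_L2.

(* Main.v *)
Require Import Defs.
From mathcomp Require Import all_boot all_order all_algebra finmap.
From mathcomp Require Import all_classical all_reals all_analysis.
From mathcomp Require Import measurable_realfun.
From mathcomp Require Import complex.
From mathcomp Require Import ring lra.

(** A function f on Omega lifts to the functions w |-> f (G, v, w) of the labels,
one for each vertex v of G, and the Markov operator M acts on these lifts as
the random walk of G acts on v ([real_markov_rc]). The classes of the
(G, v, w) carry the whole measure, so f can be studied through its lifts.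
Split f = f0 + f1, where f1 is the conditional mean of f given the orbit of
the root. The two parts are orthogonal and M respects the splitting
([nrm2_orbit_decomposition], [nrm2_markov_decomposition]), so it is enough
to contract each of them.

The part f1 is a function on the orbits, on which M acts as the chain M_T,
irreducible and reversible. If averaging by the chain preserves the norm of
such a function, then the function is, at the end of each edge, equal to its
own average at the start ([chain_variance]); when it is moreover orthogonal
to the constants, it changes sign along every edge. Hence it vanishes if M_T
is not bipartite ([nonbipartite_definite]), and it is a multiple of the sign
of the two parts if M_T is bipartite, so that it vanishes when it is
orthogonal to that sign ([bipartite_definite]). Compactness of the unit
sphere turns this into a strict contraction ([chain_gap]).

The part f0 is centered: its lift at each vertex has mean zero. Suppose first
that f0 is bounded and local, that is, determined by the labels within a
fixed distance r of the root. The lifts at u and v are then independent as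
soon as u and v are more than 2r apart, so the square norm of the n-th iterate
of M at f0 is at most a constant times the probability that two independent
n-step walks end within distance 2r of each other. Reversing one of the walks
turns this into return probabilities at times between 2n and 2n + 2r
([walk_prob_pair_sum]), which decay like s^2n for some s < 1 since G is
non-amenable ([local_decay]). By unimodularity, in the form of mass transport,
M is self-adjoint ([real_markov_self_adjoint]); the square norms of the
iterates are therefore log-convex in n, and a log-convex sequence that decays
at the rate s^2 decays by that factor already in its first step
([log_convex_decay]). So the norm of M f0 is at most s times the norm of f0,
with the same s for all centered local functions, and these are dense among
the centered functions ([centered_contraction]).

Together, M contracts the norm by a factor r < 1 on the real functions
orthogonal to 1 and, in the bipartite case, to the sign of the parts. For a
complex number l of modulus greater than r, the equation l f - M f = g is then
solved by iterating f |-> (g + M f) / l in the complete space L2, with a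
bounded inverse ([spectral_radius_le]).

As for measurability, the set of classes whose root lies in a given orbit is
closed for local convergence, by a compactness argument for isomorphisms of
balls ([ball_iso_limit]), and M preserves measurability because sums over
neighbours of indicators of open sets are lower semicontinuous
([nbr_sum_open_lsc]). Finally, edges of the graphing between classes of G come
from edges of G, whose ends lie in orbits joined by M_T; so a bipartition of
M_T is one of the graphing ([orbit_classes_bipartite]). *)

Set Implicit Arguments.
Unset Strict Implicit.
Unset Printing Implicit Defensive.

Import Order.TTheory GRing.Theory Num.Theory.
Import numFieldNormedType.Exports.

Local Open Scope classical_set_scope.
Local Open Scope card_scope.
Local Open Scope quotient_scope.
Local Open Scope ring_scope.

(** * Real square-integrable functions *)

(** Both the Cauchy-Schwarz inequality and the triangle inequality for complex
functions are obtained from this sign of a discriminant. *)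
Lemma nonneg_quadratic_disc (R : rcfType) (a b c : R) :
  (forall t, 0 <= a + t * b *+ 2 + t ^+ 2 * c) -> b ^+ 2 <= a * c.
Proof.
move=> h; pose p := Poly [:: a; b *+ 2; c].
have : p`_1 ^+ 2 - 4 * p`_2 * p`_0 <= 0.
  apply: deg_le2_poly_ge0 => [|t]; first exact: size_Poly.
  by have := h t; rewrite horner_Poly /=; lra.
by rewrite !coefE /=; lra.
Qed.

Section square_integrable.
Context d (T : measurableType d) (R : realType).
Variable m : {measure set T -> \bar R}.
Implicit Types f g h : T -> R.

(** Square integrability is a predicate on functions, not on their classes modulo
null sets, so that identities for the Markov operator can be used pointwise. *)
Definition sqint f := measurable_fun setT f /\
  (\int[m]_x (f x ^+ 2)%:E < +oo)%E.

Definition dot f g : R := \int[m]_x (f x * g x).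

Definition nrm2 f : R := dot f f.

Lemma sqint_integrable f : sqint f -> m.-integrable setT (EFin \o (fun x => f x ^+ 2)).
Proof.
move=> [mf fi]; apply/integrableP; split.
  by apply/measurable_EFinP; exact: measurable_funX.
by under eq_integral => x _ do rewrite /= ger0_norm ?sqr_ge0//.
Qed.

Lemma sqintM_integrable f g : sqint f -> sqint g ->
  m.-integrable setT (EFin \o (fun x => f x * g x)).
Proof.
move=> sf sg; apply: (@le_integrable _ _ _ _ _ measurableT _
   (EFin \o (fun x => f x ^+ 2 + g x ^+ 2))).
- by apply/measurable_EFinP; apply: measurable_funM; [case: sf|case: sg].
- move=> x _ /=; rewrite lee_fin normrM (ger0_norm (addr_ge0 _ _)) ?sqr_ge0//.
  rewrite -(real_normK (num_real (f x))) -(real_normK (num_real (g x))).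
  have := sqr_ge0 (`|f x| - `|g x|); have := normr_ge0 (f x); have := normr_ge0 (g x).
  nra.
- by apply: (integrableD _ (sqint_integrable sf) (sqint_integrable sg)).
Qed.

Lemma sqint_lin a f g : sqint f -> sqint g -> sqint (fun x => a * f x + g x).
Proof.
move=> sf sg; have [mf _] := sf; have [mg _] := sg; split.
  by apply: measurable_funD => //; apply: measurable_funM.
suff : m.-integrable setT (EFin \o (fun x => (a * f x + g x) ^+ 2)).
  by move/integrableP => [_]; under eq_integral => x _ do rewrite /= ger0_norm ?sqr_ge0//.
have -> : (fun x => (a * f x + g x) ^+ 2) =
   (fun x => a ^+ 2 * f x ^+ 2 + (2 * a * (f x * g x) + g x ^+ 2)).
  by apply/funext => x; ring.
apply: (integrableD _ (f := EFin \o (fun x => a ^+ 2 * f x ^+ 2))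
  (g := EFin \o (fun x => (2 * a * (f x * g x) + g x ^+ 2)))) => //.
  by apply: (integrableZl _ (a ^+ 2) (sqint_integrable sf)).
apply: (integrableD _ (f := EFin \o (fun x => 2 * a * (f x * g x))) _
  (sqint_integrable sg)) => //.
by apply: (integrableZl _ (2 * a) (sqintM_integrable sf sg)).
Qed.

Lemma sqint_dominated f g : measurable_fun setT f -> sqint g ->
  (forall x, `|f x| <= `|g x|) -> sqint f.
Proof.
move=> mf [mg gi] fg; split => //; apply: le_lt_trans gi; apply: ge0_le_integral => //.
- by move=> x _; rewrite lee_fin sqr_ge0.
- by apply/measurable_EFinP; exact: measurable_funX.
- by apply/measurable_EFinP; exact: measurable_funX.
- by move=> x _; rewrite lee_fin -[leLHS]real_normK ?num_real// -[leRHS]real_normK ?num_real// ler_pXn2r// nnegrE.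
Qed.

Lemma sqint0 : sqint (fun=> 0).
Proof.
by split; [exact: measurable_cst|under eq_integral do rewrite expr0n; rewrite integral0].
Qed.

Lemma sqintD f g : sqint f -> sqint g -> sqint (fun x => f x + g x).
Proof.
move=> sf sg; rewrite (_ : (fun x => _) = (fun x => 1 * f x + g x)); first exact: sqint_lin.
by apply/funext => x; rewrite mul1r.
Qed.

Lemma sqintZ a f : sqint f -> sqint (fun x => a * f x).
Proof.
move=> sf; rewrite (_ : (fun x => _) = (fun x => a * f x + 0)).
  by apply: sqint_lin => //; exact: sqint0.
by apply/funext => x; rewrite addr0.
Qed.

Lemma sqintB f g : sqint f -> sqint g -> sqint (fun x => f x - g x).
Proof.
move=> sf sg; rewrite (_ : (fun x => _) = (fun x => -1 * g x + f x)); first exact: sqint_lin.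
by apply/funext => x; ring.
Qed.

Lemma dotC f g : dot f g = dot g f.
Proof. by rewrite /dot; under eq_Rintegral do rewrite mulrC. Qed.

Lemma dot_linl a f g h : sqint f -> sqint g -> sqint h ->
  dot (fun x => a * f x + g x) h = a * dot f h + dot g h.
Proof.
move=> sf sg sh; rewrite /dot.
transitivity (\int[m]_x (a * (f x * h x) + g x * h x)).
  by apply: eq_Rintegral => x _; ring.
rewrite RintegralD//; last 2 first.
- exact: (integrableZl _ (a) (sqintM_integrable sf sh)).
- exact: sqintM_integrable.
by rewrite RintegralZl//; exact: sqintM_integrable.
Qed.

Lemma dot_linr a f g h : sqint f -> sqint g -> sqint h ->
  dot h (fun x => a * f x + g x) = a * dot h f + dot h g.
Proof. by move=> sf sg sh; rewrite dotC dot_linl// !(dotC h). Qed.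

Lemma nrm2_ge0 f : 0 <= nrm2 f.
Proof. by apply: Rintegral_ge0 => x _; rewrite -expr2 sqr_ge0. Qed.

Lemma nrm2_lin a f g : sqint f -> sqint g ->
  nrm2 (fun x => a * f x + g x) = a ^+ 2 * nrm2 f + a * dot f g *+ 2 + nrm2 g.
Proof.
move=> sf sg; have sa := sqint_lin a sf sg.
by rewrite /nrm2 dot_linl// !dot_linr// (dotC g f); ring.
Qed.

Lemma nrm2E f : sqint f -> (nrm2 f)%:E = (\int[m]_x (f x ^+ 2)%:E)%E.
Proof.
move=> [mf fi]; rewrite /nrm2 /dot /Rintegral fineK//.
by rewrite ge0_fin_numE// integral_ge0// => x _; rewrite lee_fin -expr2 sqr_ge0.
Qed.

Lemma dot_cauchy_schwarz f g : sqint f -> sqint g -> dot f g ^+ 2 <= nrm2 f * nrm2 g.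
Proof.
move=> sf sg; rewrite mulrC; apply: nonneg_quadratic_disc => t.
by have := nrm2_ge0 (fun x => t * f x + g x); rewrite nrm2_lin//; nra.
Qed.

End square_integrable.

Section completeness.
Context d (T : measurableType d) (R : realType).
Variable m : {measure set T -> \bar R}.
Implicit Types f g h : T -> R.

Definition nrm f : R := Num.sqrt (nrm2 m f).

Lemma nrm_ge0 f : 0 <= nrm f. Proof. exact: sqrtr_ge0. Qed.

Lemma nrm_sqr f : nrm f ^+ 2 = nrm2 m f.
Proof. by rewrite /nrm sqr_sqrtr// nrm2_ge0. Qed.

Lemma nrm_le f c : 0 <= c -> nrm2 m f <= c ^+ 2 -> nrm f <= c.
Proof.
by move=> c0 h; rewrite -(ger0_norm c0) -sqrtr_sqr /nrm ler_sqrt// sqr_ge0.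
Qed.

Lemma nrm2_le f c : nrm f <= c -> nrm2 m f <= c ^+ 2.
Proof. by move=> h; rewrite -nrm_sqr ler_pXn2r// ?nnegrE ?nrm_ge0// (le_trans (nrm_ge0 f)). Qed.

Lemma dot_nrm f g : sqint m f -> sqint m g -> `|dot m f g| <= nrm f * nrm g.
Proof.
move=> sf sg; rewrite -sqrtr_sqr /nrm -sqrtrM ?nrm2_ge0// ler_wsqrtr//.
exact: dot_cauchy_schwarz.
Qed.

Lemma nrmD f g : sqint m f -> sqint m g -> nrm (fun x => f x + g x) <= nrm f + nrm g.
Proof.
move=> sf sg; apply: nrm_le; first by rewrite addr_ge0 ?nrm_ge0.
have -> : (fun x => f x + g x) = (fun x => 1 * f x + g x).
  by apply/funext => x; rewrite mul1r.
rewrite nrm2_lin// -!nrm_sqr; have := le_trans (ler_norm _) (dot_nrm sf sg); have := nrm_ge0 f; have := nrm_ge0 g.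
nra.
Qed.

Lemma nrmZ a f : sqint m f -> nrm (fun x => a * f x) = `|a| * nrm f.
Proof.
move=> sf; rewrite /nrm -(sqrtr_sqr a) -sqrtrM ?sqr_ge0//; congr Num.sqrt.
rewrite /nrm2 /dot -RintegralZl//; last exact: sqintM_integrable.
by apply: eq_Rintegral => x _; rewrite mulrACA.
Qed.

Lemma sqint_sum (h : nat -> T -> R) n : (forall k, sqint m (h k)) ->
  sqint m (fun x => \sum_(k < n) h k x).
Proof.
move=> sh; elim: n => [|n IH].
  by under eq_fun do rewrite big_ord0; exact: sqint0.
by under eq_fun do rewrite big_ord_recr; exact: sqintD.
Qed.

Lemma nrm0 : nrm (fun=> 0) = 0.
Proof.
rewrite /nrm /nrm2 /dot; under eq_Rintegral do rewrite mulr0.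
by rewrite /Rintegral integral0 sqrtr0.
Qed.

Lemma nrm_sum (h : nat -> T -> R) n : (forall k, sqint m (h k)) ->
  nrm (fun x => \sum_(k < n) h k x) <= \sum_(k < n) nrm (h k).
Proof.
move=> sh; elim: n => [|n IH].
  by under eq_fun do rewrite big_ord0; rewrite big_ord0 nrm0.
under eq_fun do rewrite big_ord_recr /=; rewrite big_ord_recr/=.
apply: le_trans (nrmD _ _) _ => //; first exact: sqint_sum.
by rewrite lerD2r.
Qed.

Lemma fatou_bound (f : nat -> T -> \bar R) (c : \bar R) :
  (forall n, measurable_fun setT (f n)) -> (forall n x, (0 <= f n x)%E) ->
  (forall n, (\int[m]_x f n x <= c)%E) -> (\int[m]_x limn_einf (f ^~ x) <= c)%E.
Proof.
move=> mf f0 fc; apply: (le_trans (fatou m measurableT mf _)) => //.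
rewrite limn_einf_lim; apply: lime_le; first exact: is_cvg_einfs.
near=> n; apply: le_trans (fc n); apply: ereal_inf_lbound.
by exists n => /=.
Unshelve. all: by end_near. Qed.

Lemma sum_geometric_le (C q : R) n : 0 <= C -> 0 <= q < 1 ->
  \sum_(k < n) C * q ^+ k <= C / (1 - q).
Proof.
move=> C0 /andP[q0 q1]; rewrite -mulr_sumr ler_wpM2l//.
have q1' : 0 < 1 - q by rewrite subr_gt0.
rewrite -[leRHS]mul1r ler_pdivlMr//.
have : (1 - q ^+ n) = (1 - q) * \sum_(k < n) q ^+ k.
  rewrite -{1}(expr1n R n) subrXX; congr (_ * _).
  by apply: eq_bigr => i _; rewrite expr1n mul1r.
by rewrite mulrC => <-; rewrite lerBlDr lerDl exprn_ge0.
Qed.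

(** The norms of the increments are summable, so by Fatou's lemma the sum of their
absolute values is square integrable, hence finite almost everywhere, and the
sequence converges there. The limit is set to 0 elsewhere; Fatou's lemma again
bounds its distance to each term. Geometric sequences suffice for the
fixed-point iterations below. *)
Lemma L2_geometric_cvg (h : nat -> T -> R) (C q : R) :
  0 <= C -> 0 <= q < 1 -> (forall n, sqint m (h n)) ->
  (forall n, nrm (fun x => h n.+1 x - h n x) <= C * q ^+ n) ->
  exists2 hoo, sqint m hoo &
    forall n, nrm (fun x => hoo x - h n x) <= C * q ^+ n / (1 - q).
Proof.
move=> C0 /andP[q0 q1] sh hC.
have q01 : 0 <= q < 1 by rewrite q0.
pose dlt k x := h k.+1 x - h k x.
have sdlt k : sqint m (dlt k) by apply: sqintB.
have abs_sqint f : sqint m f -> sqint m (fun x => `|f x|).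
  move=> sf; apply: (sqint_dominated _ sf) => [|x]; last by rewrite normr_id.
  by apply: measurableT_comp => //; case: sf.
have nrm_abs f : nrm (fun x => `|f x|) = nrm f.
  congr Num.sqrt; apply: eq_Rintegral => x _.
  by rewrite -!expr2 real_normK// num_real.
pose g n x := \sum_(k < n) `|dlt k x|.
have sg n : sqint m (g n) by apply: (sqint_sum (h := fun k x => `|dlt k x|)) => k; exact: abs_sqint.
pose K := C / (1 - q).
have K0 : 0 <= K by rewrite /K divr_ge0// subr_ge0 ltW.
have gK n : nrm (g n) <= K.
  apply: (le_trans (nrm_sum (h := fun k x => `|dlt k x|) _ _)).
    by move=> k; exact: abs_sqint.
  apply: le_trans (sum_geometric_le n C0 q01).
  by apply: ler_sum => k _; rewrite nrm_abs; exact: hC.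
pose G x := limn_einf (fun n => (g n x ^+ 2)%:E).
have mg2 n : measurable_fun setT (fun x => (g n x ^+ 2)%:E).
  by apply/measurable_EFinP; apply: measurable_funX; case: (sg n).
have GK : (\int[m]_x G x <= (K ^+ 2)%:E)%E.
  apply: fatou_bound => // [n x|n]; first by rewrite lee_fin sqr_ge0.
  by rewrite -nrm2E// lee_fin nrm2_le.
have g_nd x : {homo (fun n => (g n x ^+ 2)%:E) : a b / (a <= b)%N >-> (a <= b)%E}.
  apply: homo_leq => [//|? ? ?|n]; first exact: le_trans.
  rewrite lee_fin ler_pXn2r// ?nnegrE ?sumr_ge0// /g.
  by rewrite big_ord_recr/= lerDl.
have GE x : G x = limn (fun n => (g n x ^+ 2)%:E).
  by rewrite /G is_cvg_limn_einfE//; exact: ereal_nondecreasing_is_cvgn.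
have gG x n : ((g n x ^+ 2)%:E <= G x)%E.
  by rewrite GE; apply: lime_ge; [exact: ereal_nondecreasing_is_cvgn|near=> k; apply: g_nd; near: k; exact: nbhs_infty_ge].
have G0 x : (0 <= G x)%E by apply: le_trans (gG x 0%N); rewrite lee_fin sqr_ge0.
have mG : measurable_fun setT G.
  apply: (emeasurable_fun_cvg (fun n x => (g n x ^+ 2)%:E)) => // x _.
  by rewrite GE; exact: ereal_nondecreasing_is_cvgn.
pose A := [set x | (G x < +oo)%E].
have mA : measurable A.
  by rewrite -[A]setTI; exact: emeasurable_fun_infty_o.
have Aae : {ae m, forall x, A x}.
  have := @integrable_ae _ _ _ m setT measurableT G.
  have iG : m.-integrable setT G.
    apply/integrableP; split => //.
    under eq_integral do rewrite gee0_abs//.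
    by apply: le_lt_trans GK _; rewrite ltry.
  move=> /(_ iG); apply: filterS => x /(_ I).
  by rewrite /A /= ge0_fin_numE.
have Acvg x : A x -> cvgn (h ^~ x).
  move=> Ax; have Gfin : G x \is a fin_num by rewrite ge0_fin_numE.
  have -> : h ^~ x = (fun n => h 0%N x + series (dlt ^~ x) n).
    apply/funext => n; rewrite seriesEord /= -(big_mkord xpredT (dlt ^~ x)).
    by rewrite telescope_sumr// addrC subrK.
  apply: is_cvgD; first exact: is_cvg_cst.
  apply: normed_cvg; apply: nondecreasing_is_cvgn.
    by apply/nondecreasing_seqP => n; rewrite [leRHS]seriesSr lerDl /= normr_ge0.
  exists (fine (G x) + 1) => _ [n _ <-].
  have := gG x n; rewrite -[G x]fineK// lee_fin.
  move=> h1.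
  have -> : [normed series (dlt ^~ x)] n = g n x by rewrite /normed_series_of /series /= big_mkord.
  have := sqr_ge0 (g n x - 1); nra.
(* On the null set where the increments are not summable, the limit is 0. *)
pose hoo x := limn (fun n => (h n \_ A) x).
have hooE x : (fun n => (h n \_ A) x) @ \oo --> hoo x.
  rewrite /hoo; have [xA|xA] := boolP (x \in A).
    under eq_fun do rewrite /patch xA.
    by apply: Acvg; exact: set_mem.
  by under eq_fun do rewrite /patch (negbTE xA); exact: is_cvg_cst.
have mhA n : measurable_fun setT (h n \_ A).
  apply/(measurable_restrictT (h n) mA).
  by apply: (measurable_funS measurableT) => //; case: (sh n).
have mhoo : measurable_fun setT hoo.
  by apply: (measurable_fun_cvg (h := fun n => h n \_ A)).
have hdist n j : nrm (fun x => h (n + j)%N x - h n x) <= C * q ^+ n / (1 - q).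
  rewrite (_ : (fun x => _) = (fun x => \sum_(k < j) dlt (n + k)%N x)); last first.
    apply/funext => x; rewrite -(big_mkord xpredT (fun k => dlt (n + k)%N x)).
    by rewrite /dlt; under eq_bigr do rewrite -addnS; rewrite (telescope_sumr (fun k => h (n + k)%N x))// addn0.
  apply: (le_trans (nrm_sum (h := fun k => dlt (n + k)%N) _ _)) => //.
  apply: le_trans (sum_geometric_le j _ q01); last by rewrite mulr_ge0// exprn_ge0.
  by apply: ler_sum => k _; rewrite -mulrA -exprD; exact: hC.
have main n : (\int[m]_x ((hoo x - h n x) ^+ 2)%:E <= ((C * q ^+ n / (1 - q)) ^+ 2)%:E)%E.
  have lim2 x : limn_einf (fun j => (((h (n + j)%N \_ A) x - h n x) ^+ 2)%:E) = ((hoo x - h n x) ^+ 2)%:E.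
    have c2 : (fun j => (((h (n + j)%N \_ A) x - h n x) ^+ 2)%:E) @ \oo --> ((hoo x - h n x) ^+ 2)%:E.
      apply: cvg_EFin; first by near=> j.
      have c3 : (fun j => (h (n + j)%N \_ A) x - h n x) @ \oo --> hoo x - h n x.
        apply: cvgB; last exact: cvg_cst.
        exact: (cvg_comp _ _ (cvg_addnl n) (hooE x)).
      by under eq_fun do rewrite /= expr2; rewrite expr2; exact: cvgM.
    by rewrite is_cvg_limn_einfE; [exact: cvg_lim c2|apply/cvg_ex; eexists; exact: c2].
  under eq_integral do rewrite -lim2.
  apply: fatou_bound => [j|j x|j].
  - apply/measurable_EFinP; apply: measurable_funX; apply: measurable_funB => //.
    by case: (sh n).
  - by rewrite lee_fin sqr_ge0.
  rewrite (@ge0_ae_eq_integral _ _ _ m setT _ (fun x => ((h (n + j)%N x - h n x) ^+ 2)%:E))//.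
  + have sD : sqint m (fun x => h (n + j)%N x - h n x) by apply: sqintB.
    by rewrite -nrm2E// lee_fin; apply: nrm2_le.
  + apply/measurable_EFinP; apply: measurable_funX; apply: measurable_funB => //.
    by case: (sh n).
  + apply/measurable_EFinP; apply: measurable_funX; apply: measurable_funB => //.
      by case: (sh (n + j)%N).
    by case: (sh n).
  + by move=> x _; rewrite lee_fin sqr_ge0.
  + by move=> x _; rewrite lee_fin sqr_ge0.
  + by apply: filterS Aae => x Ax _; rewrite /patch mem_set.
have sD n : sqint m (fun x => hoo x - h n x).
  split; first by apply: measurable_funB => //; case: (sh n).
  by apply: le_lt_trans (main n) _; rewrite ltry.
exists hoo.
  rewrite (_ : hoo = (fun x => (hoo x - h 0%N x) + h 0%N x)); first exact: sqintD.
  by apply/funext => x; rewrite subrK.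
move=> n; apply: nrm_le.
  by rewrite !mulr_ge0// ?exprn_ge0// invr_ge0 subr_ge0 ltW.
by rewrite -lee_fin nrm2E.
Unshelve. all: by end_near. Qed.

End completeness.

(** * A bound for the spectral radius *)

Lemma geometric_eventually_lt (R : realType) (C q e : R) : 0 <= q < 1 -> 0 < e ->
  exists n, C * q ^+ n < e.
Proof.
move=> /andP[q0 q1] e0.
have : (C * q ^+ n @[n --> \oo] --> C * 0)%classic.
  by apply: cvgMr; apply: cvg_expr; rewrite ger0_norm.
rewrite mulr0 => /cvgrPdist_lt /(_ _ e0) [N _ /(_ N (leqnn N))] /=.
by rewrite sub0r normrN => h; exists N; exact: le_lt_trans (ler_norm _) h.
Qed.

Section complex_square_integrable.
Context d (T : measurableType d) (R : realType).
Variable m : {measure set T -> \bar R}.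
Implicit Types f g : T -> R[i].

Local Notation re f := (fun x => complex.Re (f x)).
Local Notation im f := (fun x => complex.Im (f x)).

Lemma Lfun2_sqint (f : T -> R) : f \in Lfun m 2%:E <-> sqint m f.
Proof.
split=> [f2|[mf fi]].
  have := Lfun2_integrable_sqr f2; move: (f2) => /[!inE] /andP[/[!inE]/= mf _].
  move=> /integrableP[_]; under eq_integral => x _ do rewrite /= ger0_norm ?sqr_ge0//.
  by move=> h; split.
rewrite inE; apply/andP; split; rewrite inE//=.
rewrite /finite_norm unlock poweR_lty//.
by under eq_integral => x _ do rewrite /= powR_mulrn// real_normK ?num_real//.
Qed.

Definition cnrm f : R := Num.sqrt (nrm2 m (re f) + nrm2 m (im f)).

Definition csqint f := sqint m (re f) /\ sqint m (im f).

Lemma L2_csqint f : L2 m f <-> csqint f.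
Proof. by split=> -[? ?]; split; apply/Lfun2_sqint. Qed.

Lemma cnrm_ge0 f : 0 <= cnrm f. Proof. exact: sqrtr_ge0. Qed.

Lemma cnrm_sqr f : cnrm f ^+ 2 = nrm2 m (re f) + nrm2 m (im f).
Proof. by rewrite /cnrm sqr_sqrtr// addr_ge0// nrm2_ge0. Qed.

Lemma L2norm_cnrm f : csqint f -> L2norm m f = (cnrm f)%:E.
Proof.
move=> [sr si]; rewrite /L2norm unlock /= .
have -> : (\int[m]_x `|(Normc.normc (f x))%:E| `^ 2 = (cnrm f ^+ 2)%:E)%E.
  rewrite cnrm_sqr EFinD !nrm2E// -ge0_integralD//; last 4 first.
  - by move=> x _; rewrite lee_fin sqr_ge0.
  - by apply/measurable_EFinP; apply: measurable_funX; case: sr.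
  - by move=> x _; rewrite lee_fin sqr_ge0.
  - by apply/measurable_EFinP; apply: measurable_funX; case: si.
  apply: eq_integral => x _; rewrite /= powR_mulrn// real_normK ?num_real//.
  case: (f x) => a b /=; rewrite sqr_sqrtr ?addr_ge0 ?sqr_ge0//.
by rewrite /= -powR_mulrn ?cnrm_ge0// -powRrM mulfV// powRr1 ?cnrm_ge0.
Qed.

Lemma nrm_le_cnrm f : nrm m (re f) <= cnrm f /\ nrm m (im f) <= cnrm f.
Proof. by split; rewrite /nrm /cnrm ler_wsqrtr// ?lerDl ?lerDr nrm2_ge0. Qed.

Lemma cnrm_le f : cnrm f <= nrm m (re f) + nrm m (im f).
Proof.
have h : 0 <= nrm m (re f) + nrm m (im f) by rewrite addr_ge0 ?nrm_ge0.
rewrite -(ger0_norm h) -sqrtr_sqr /cnrm ler_wsqrtr// sqrrD !nrm_sqr.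
by rewrite lerD2r lerDl mulrn_wge0// mulr_ge0 ?nrm_ge0.
Qed.

Lemma re_mulc (l : R[i]) f : (re (fun x => l * f x)) =
  (fun x => complex.Re l * re f x + - complex.Im l * im f x).
Proof. by apply/funext => x; case: l (f x) => p q [a b] /=; ring. Qed.

Lemma im_mulc (l : R[i]) f : (im (fun x => l * f x)) =
  (fun x => complex.Im l * re f x + complex.Re l * im f x).
Proof. by apply/funext => x; case: l (f x) => p q [a b] /=; ring. Qed.

Lemma reB f g : re (fun x => f x - g x) = (fun x => re f x - re g x).
Proof. by apply/funext => x; case: (f x) (g x) => ? ? []. Qed.

Lemma imB f g : im (fun x => f x - g x) = (fun x => im f x - im g x).
Proof. by apply/funext => x; case: (f x) (g x) => ? ? []. Qed.

Lemma cnrmZ (l : R[i]) f : csqint f -> cnrm (fun x => l * f x) = Normc.normc l * cnrm f.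
Proof.
move=> [sr si]; rewrite /cnrm re_mulc im_mulc.
rewrite !nrm2_lin//; try exact: sqintZ.
have Z a (g : T -> R) : sqint m g -> nrm2 m (fun x => a * g x) = a ^+ 2 * nrm2 m g.
  by move=> sg; rewrite -!nrm_sqr nrmZ// exprMn real_normK ?num_real.
have Zi a (g h : T -> R) : sqint m g -> sqint m h -> dot m g (fun x => a * h x) = a * dot m g h.
  move=> sg sh; rewrite /dot -RintegralZl//; last exact: sqintM_integrable.
  by apply: eq_Rintegral => x _; rewrite mulrCA.
rewrite !Z// !Zi//; case: l => p q /=.
rewrite -sqrtrM ?addr_ge0 ?sqr_ge0//; congr Num.sqrt; ring.
Qed.

Lemma cnrmD f g : csqint f -> csqint g -> cnrm (fun x => f x + g x) <= cnrm f + cnrm g.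
Proof.
move=> [fr fi] [gr gi].
have h0 : 0 <= cnrm f + cnrm g by rewrite addr_ge0 ?cnrm_ge0.
rewrite -(ger0_norm h0) -sqrtr_sqr {1}/cnrm ler_wsqrtr//.
have -> : (re (fun x => f x + g x)) = (fun x => 1 * re f x + re g x).
  by apply/funext => x; rewrite mul1r; case: (f x) (g x) => ? ? [].
have -> : (im (fun x => f x + g x)) = (fun x => 1 * im f x + im g x).
  by apply/funext => x; rewrite mul1r; case: (f x) (g x) => ? ? [].
rewrite !nrm2_lin//.
set b := dot m (re f) (re g) + dot m (im f) (im g).
have hb : b ^+ 2 <= (nrm2 m (re g) + nrm2 m (im g)) * (nrm2 m (re f) + nrm2 m (im f)).
  apply: nonneg_quadratic_disc => t.
  have := nrm2_ge0 m (fun x => t * re f x + re g x).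
  have := nrm2_ge0 m (fun x => t * im f x + im g x).
  by rewrite !nrm2_lin// /b; nra.
have {}hb : b <= cnrm f * cnrm g.
  apply: (le_trans (ler_norm _)); rewrite -sqrtr_sqr /cnrm mulrC -sqrtrM ?addr_ge0 ?nrm2_ge0//.
  exact: ler_wsqrtr.
rewrite sqrrD !cnrm_sqr; move: hb; rewrite /b; lra.
Qed.

Lemma nrm2_eq0_ae (f : T -> R) : sqint m f -> nrm2 m f = 0 ->
  {ae m, forall x, f x = 0}.
Proof.
move=> sf; have [mf _] := sf => f0.
have : (\int[m]_x `|(f x ^+ 2)%:E| = 0)%E.
  under eq_integral => x _ do rewrite /= ger0_norm ?sqr_ge0//.
  by rewrite -nrm2E// f0.
have mf2 : measurable_fun setT (fun x => (f x ^+ 2)%:E).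
  by apply/measurable_EFinP; exact: measurable_funX.
move=> /(ae_eq_integral_abs m measurableT mf2); apply: filterS => x /(_ I) /= [].
by move/eqP; rewrite sqrf_eq0 => /eqP.
Qed.

Lemma cnrm_eq0_ae f : csqint f -> cnrm f = 0 -> {ae m, forall x, f x = 0}.
Proof.
move=> [sr si] f0; have [hr hi] := nrm_le_cnrm f.
have z (h : T -> R) : nrm m h <= cnrm f -> nrm2 m h = 0.
  rewrite f0 => h0; rewrite -nrm_sqr; apply/eqP; rewrite sqrf_eq0 eq_le h0.
  exact: nrm_ge0.
apply: filterS2 (nrm2_eq0_ae sr (z _ hr)) (nrm2_eq0_ae si (z _ hi)) => x.
by case: (f x) => a b /= -> ->.
Qed.

Section spectral_bound.
Variables (Mr : (T -> R) -> T -> R) (M : (T -> R[i]) -> T -> R[i]).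
Variables (W : set (T -> R)) (S : set (T -> R[i])) (r : R).
Hypothesis ME : forall f x, M f x = Complex (Mr (re f) x) (Mr (im f) x).
Hypothesis r0 : 0 <= r.
Hypothesis Wsq : W `<=` sqint m.
Hypothesis W0 : W (fun=> 0).
Hypothesis Wlin : forall a u v, W u -> W v -> W (fun x => a * u x + v x).
Hypothesis Wcl : forall u, sqint m u ->
  (forall e, 0 < e -> exists2 h, W h & nrm m (fun x => u x - h x) < e) -> W u.
Hypothesis Mlin : forall a u v,
  Mr (fun x => a * u x + v x) = (fun x => a * Mr u x + Mr v x).
Hypothesis MW : forall u, W u -> W (Mr u).
Hypothesis M_le : forall u, W u -> nrm m (Mr u) <= r * nrm m u.
Hypothesis perpP : forall f, L2perp m S f <-> W (re f) /\ W (im f).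

Let W2 f := W (re f) /\ W (im f).

Let W2_sq f : W2 f -> csqint f.
Proof. by move=> [/Wsq ? /Wsq ?]. Qed.

Let W2lin (l : R[i]) f g : W2 f -> W2 g -> W2 (fun x => l * f x + g x).
Proof.
move=> [fr fi] [gr gi]; split.
- rewrite (_ : (fun x => _) = fun x => complex.Re l * re f x + (- complex.Im l * im f x + re g x)).
    by apply: Wlin => //; exact: Wlin.
  by apply/funext => x; case: l (f x) (g x) => p q [a b] [c e] /=; ring.
- rewrite (_ : (fun x => _) = fun x => complex.Im l * re f x + (complex.Re l * im f x + im g x)).
    by apply: Wlin => //; exact: Wlin.
  by apply/funext => x; case: l (f x) (g x) => p q [a b] [c e] /=; ring.
Qed.

Let W20 : W2 (fun=> 0). Proof. by split. Qed.

Let W2D f g : W2 f -> W2 g -> W2 (fun x => f x + g x).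
Proof.
move=> Wf Wg; rewrite (_ : (fun x => _) = (fun x => 1 * f x + g x)); first exact: W2lin.
by apply/funext => x; rewrite mul1r.
Qed.

Let W2Z l f : W2 f -> W2 (fun x => l * f x).
Proof.
move=> Wf; rewrite (_ : (fun x => _) = (fun x => l * f x + 0)); first exact: W2lin.
by apply/funext => x; rewrite addr0.
Qed.

Let W2B f g : W2 f -> W2 g -> W2 (fun x => f x - g x).
Proof.
move=> Wf Wg; rewrite (_ : (fun x => _) = (fun x => -1 * g x + f x)); first exact: W2lin.
by apply/funext => x; rewrite mulN1r addrC.
Qed.

Let MW2 f : W2 f -> W2 (M f).
Proof.
move=> [fr fi]; split.
- by rewrite (_ : re (M f) = Mr (re f)); [exact: MW|apply/funext => x; rewrite ME].
- by rewrite (_ : im (M f) = Mr (im f)); [exact: MW|apply/funext => x; rewrite ME].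
Qed.

Let M_cnrm f : W2 f -> cnrm (M f) <= r * cnrm f.
Proof.
move=> [fr fi].
have h0 : 0 <= r * cnrm f by rewrite mulr_ge0 ?cnrm_ge0.
rewrite -(ger0_norm h0) -sqrtr_sqr {1}/cnrm ler_wsqrtr// exprMn (cnrm_sqr f).
rewrite (_ : re (M f) = Mr (re f)); last by apply/funext => x; rewrite ME.
rewrite (_ : im (M f) = Mr (im f)); last by apply/funext => x; rewrite ME.
rewrite mulrDr lerD// -[leRHS]/(_) -!nrm_sqr -exprMn ler_pXn2r ?nnegrE ?mulr_ge0 ?nrm_ge0//.
- exact: M_le.
- exact: M_le.
Qed.

Let MB f g : M (fun x => f x - g x) = (fun x => M f x - M g x).
Proof.
apply/funext => x; rewrite !ME.
rewrite (_ : re (fun x => f x - g x) = fun x => -1 * re g x + re f x); last first.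
  by apply/funext => y; case: (f y) (g y) => ? ? [? ?] /=; ring.
rewrite (_ : im (fun x => f x - g x) = fun x => -1 * im g x + im f x); last first.
  by apply/funext => y; case: (f y) (g y) => ? ? [? ?] /=; ring.
rewrite !Mlin; apply/eqP; rewrite eq_complex /=; apply/andP; split; apply/eqP; ring.
Qed.

Let subK_cnrm f g : W2 f -> W2 g -> cnrm f <= cnrm (fun x => f x - g x) + cnrm g.
Proof.
move=> Wf Wg; have := cnrmD (W2_sq (W2B Wf Wg)) (W2_sq Wg).
by under [in X in X -> _]eq_fun do rewrite subrK.
Qed.

Let resolvent_injective (l : R[i]) : r < Normc.normc l -> forall f, W2 f ->
  cnrm f <= (Normc.normc l - r)^-1 * cnrm (fun x => l * f x - M f x).
Proof.
move=> rl f Wf; rewrite mulrC ler_pdivlMr ?subr_gt0//.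
have := subK_cnrm (W2Z l Wf) (MW2 Wf); rewrite cnrmZ ?W2_sq//; last exact: W2_sq.
have := M_cnrm Wf; have := cnrm_ge0 f; nra.
Qed.

Let resolvent_surjective (l : R[i]) : r < Normc.normc l -> forall g, W2 g ->
  exists2 f, W2 f & {ae m, forall x, l * f x - M f x = g x}.
Proof.
move=> rl g Wg.
have l0 : 0 < Normc.normc l := le_lt_trans r0 rl.
have lN0 : l != 0 by apply: contraTneq l0 => ->; rewrite /= expr0n /= addr0 sqrtr0 ltxx.
pose q := r / Normc.normc l.
have q01 : 0 <= q < 1 by rewrite divr_ge0 ?(ltW l0)// ltr_pdivrMr ?mul1r.
(* The solution is the fixed point of f = (g + M f) / l. *)
pose F n := iter n (fun f x => l^-1 * (g x + M f x)) (fun=> 0).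
have WF n : W2 (F n).
  elim: n => [|n IH] //; apply: (@W2Z l^-1 (fun x => g x + M (F n) x)).
  by apply: W2D => //; exact: MW2.
have linvE : Normc.normc l^-1 = (Normc.normc l)^-1.
  have lN : Normc.normc l != 0 by rewrite gt_eqF.
  apply: (mulfI lN).
  rewrite -Normc.normcM (mulfV lN0) (mulfV lN).
  by rewrite /= expr1n expr0n /= addr0 sqrtr1.
pose C := cnrm (F 1%N).
have Fstep n : cnrm (fun x => F n.+1 x - F n x) <= C * q ^+ n.
  elim: n => [|n IH]; first by rewrite expr0 mulr1 /C; under eq_fun do rewrite subr0.
  have WD := W2B (WF n.+1) (WF n).
  have -> : (fun x => F n.+2 x - F n.+1 x) =
     (fun x => l^-1 * M (fun x => F n.+1 x - F n x) x).
    by apply/funext => x; rewrite MB /= -mulrBr; congr (_ * _); rewrite opprD addrACA subrr add0r.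
  rewrite cnrmZ; last by apply: W2_sq; exact: MW2.
  rewrite linvE exprSr mulrA.
  apply: (@le_trans _ _ ((Normc.normc l)^-1 * (r * (C * q ^+ n)))).
    rewrite ler_wpM2l ?invr_ge0 ?(ltW l0)//; apply: (le_trans (M_cnrm WD)).
    by rewrite ler_wpM2l.
  by rewrite le_eqVlt /q; apply/orP; left; apply/eqP; ring.
have C0 : 0 <= C by exact: cnrm_ge0.
have Fre n := le_trans (nrm_le_cnrm (fun x => F n.+1 x - F n x)).1 (Fstep n).
have Fim n := le_trans (nrm_le_cnrm (fun x => F n.+1 x - F n x)).2 (Fstep n).
have {}Fre n := eq_ind _ (fun u => nrm m u <= _) (Fre n) _ (reB (F n.+1) (F n)).
have {}Fim n := eq_ind _ (fun u => nrm m u <= _) (Fim n) _ (imB (F n.+1) (F n)).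
have [a sa ha] := L2_geometric_cvg (h := fun n => re (F n)) C0 q01
  (fun n => (W2_sq (WF n)).1) Fre.
have [b sb hb] := L2_geometric_cvg (h := fun n => im (F n)) C0 q01
  (fun n => (W2_sq (WF n)).2) Fim.
pose f x := Complex (a x) (b x).
have small e : 0 < e -> exists n, C * q ^+ n / (1 - q) < e.
  move=> e0; have [n nrm] := geometric_eventually_lt (C / (1 - q)) q01 e0.
  by exists n; rewrite mulrAC.
have Wf : W2 f.
  split; apply: Wcl => // e /small[n ne].
  - by exists (re (F n)); [case: (WF n)|exact: le_lt_trans (ha n) ne].
  - by exists (im (F n)); [case: (WF n)|exact: le_lt_trans (hb n) ne].
exists f => //.
(* The residual D of the limit f is controlled by the distances from f to two
   consecutive iterates, and thus is arbitrarily small. *)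
pose D := (fun x => (l * f x - M f x) - g x).
have WD : W2 D by apply: W2B => //; apply: W2B; [exact: W2Z|exact: MW2].
suff : cnrm D = 0.
  by move=> /(cnrm_eq0_ae (W2_sq WD)); apply: filterS => x /eqP; rewrite subr_eq0 => /eqP.
have fF n : cnrm (fun x => f x - F n x) <= 2 * (C * q ^+ n / (1 - q)).
  apply: (le_trans (cnrm_le _)); rewrite mulr_natl mulr2n lerD//.
    by rewrite reB; exact: ha.
  by rewrite imB; exact: hb.
apply/eqP; rewrite eq_le cnrm_ge0 andbT leNgt; apply/negP => D0.
pose K := Normc.normc l + r.
have K0 : 0 < K by rewrite /K ltr_pwDl.
have /small[n ne] : 0 < cnrm D / (2 * K) by rewrite divr_gt0// mulr_gt0.
suff : cnrm D <= 2 * K * (C * q ^+ n / (1 - q)).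
  by rewrite leNgt; move: ne; rewrite ltr_pdivlMr ?mulr_gt0// mulrC => ->.
have WfF k := W2B Wf (WF k).
have -> : D = (fun x => l * (f x - F n.+1 x) + -1 * M (fun x => f x - F n x) x).
  apply/funext => x; rewrite MB /D mulN1r !mulrBr /= mulrA mulfV// mul1r; ring.
apply: le_trans (cnrmD _ _) _.
- by apply: W2_sq; exact: W2Z.
- by apply: W2_sq; apply: W2Z; exact: MW2.
rewrite cnrmZ; last exact: W2_sq.
rewrite cnrmZ; last by apply: W2_sq; exact: MW2.
rewrite (_ : Normc.normc (-1 : R[i]) = 1); last first.
  by rewrite /= sqrrN expr1n oppr0 expr0n addr0 sqrtr1.
have hn1 : C * q ^+ n.+1 / (1 - q) <= C * q ^+ n / (1 - q).
  rewrite ler_wpM2r ?invr_ge0 ?subr_ge0 ?(ltW (andP q01).2)// ler_wpM2l//.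
  have /andP[q0 q1] := q01.
  by rewrite exprS ler_piMl ?exprn_ge0// ltW.
have := fF n; have := fF n.+1; have := M_cnrm (WfF n); have := l0; have := r0.
rewrite /K mul1r; move: hn1; set X := C * _ / _; set Y := C * _ / _.
set u := cnrm (M _); set v := cnrm (fun x => f x - F n x); set w := cnrm (fun x => f x - F n.+1 x).
set N := Normc.normc l; clearbody X Y u v w N.
move=> XY rr l0' uv wX vY.
nra.
Qed.

(** If the modulus of l exceeds r, then l - M is bounded below by the triangle
inequality, and it is surjective because f |-> (g + M f) / l is a contraction
of a closed space. M commutes with real and imaginary parts, so it is given by
its action on real functions. *)
Lemma spectral_radius_le : (spectral_radius m (L2perp m S) M <= r%:E)%E.
Proof.
apply: ge_ereal_sup => _ [l lres <-]; rewrite lee_fin leNgt; apply/negP => rl.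
apply: lres; split.
  move=> g /perpP Wg; have [f Wf fg] := resolvent_surjective rl Wg.
  by exists f => //; exact/perpP.
exists (Normc.normc l - r)^-1 => f /perpP Wf.
rewrite !L2norm_cnrm; [| |exact: W2_sq].
  by rewrite -EFinM lee_fin; exact: resolvent_injective.
by apply: W2_sq; apply: W2B; [exact: W2Z|exact: MW2].
Qed.

End spectral_bound.

End complex_square_integrable.

(** * Balls and limits of partial isomorphisms *)

Section balls.
Variables (V : Type) (G : sgraph V).

Lemma gball_self u r : gball G u r u.
Proof. by elim: r => //= r ?; left. Qed.

Lemma gball_mono u r s : (r <= s)%N -> gball G u r `<=` gball G u s.
Proof.
move=> /subnK <-; elim: (s - r)%N => // k IH x /IH xk.
by rewrite addSn /=; left.
Qed.

Lemma gball_trans u v x r s : gball G u r v -> gball G v s x -> gball G u (r + s) x.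
Proof.
move=> uv; elim: s x => [|s IH] x /=; first by rewrite addn0 => ->.
by rewrite addnS /= => -[/IH ?|[y /IH ? ?]]; [left|right; exists y].
Qed.

Lemma gball_nbrs u v r : nbrs G u v -> gball G v r `<=` gball G u r.+1.
Proof.
move=> uv x vx; rewrite -add1n; apply: gball_trans vx.
by rewrite /= bigcup_set1; right.
Qed.

Lemma gball_sym u v r : gball G u r v -> gball G v r u.
Proof.
elim: r u v => [|r IH] u v /=; first by move=> ->.
move=> [/IH ?|[x /IH xr xv]]; first by left.
by apply: (gball_nbrs _ xr); rewrite /nbrs /= adj_sym.
Qed.

Lemma path_gball u p : path G u p -> gball G u (size p) (last u p).
Proof.
elim/last_ind: p => [|p x IH] //=; rewrite rcons_path last_rcons size_rcons.
by move=> /andP[/IH ? ?] /=; right; exists (last u p).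
Qed.

Lemma connected_gball u v : connected_graph G -> exists r, gball G u r v.
Proof.
by move=> /(_ u v)[p pP <-]; exists (size p); exact: path_gball.
Qed.

End balls.

Section bounded_degrees.
Variables (V : choiceType) (G : sgraph V) (D : nat).
Hypothesis G_deg : degrees_le G D.

Lemma nbrs_finite x : finite_set (nbrs G x).
Proof. exact: card_le_finite (G_deg x) (finite_II D). Qed.

Lemma mem_nbrs x y : (y \in fset_set (nbrs G x)) = G x y.
Proof.
by rewrite in_fset_set; [apply/idP/idP => [/set_mem|/mem_set]|exact: nbrs_finite].
Qed.

End bounded_degrees.

Section near_isomorphisms.
Variables (R : realType).

Section ball_maps.
Variables (V V' : Type) (G : sgraph V) (u : V) (G' : sgraph V') (u' : V').
Variables (r : nat) (f : V -> V').
Hypothesis fb : set_bij (gball G u r) (gball G' u' r) f.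
Hypothesis fu : f u = u'.
Hypothesis fG : forall x y, gball G u r x -> gball G u r y ->
  G' (f x) (f y) = G x y.

(** As long as the s-balls around v and its image stay inside the r-balls, distances
from v are preserved, one edge at a time. *)
Lemma ball_map_gball v s x :
  gball G v s `<=` gball G u r -> gball G' (f v) s `<=` gball G' u' r ->
  gball G u r v -> gball G u r x -> gball G' (f v) s (f x) <-> gball G v s x.
Proof.
have [ff fi fs] := fb => + + vr.
elim: s x => [|s IH] x sr sr' xr.
  by split=> [/= fxv|-> //]; apply: fi => //; exact/mem_set.
have {}IH y : gball G u r y -> gball G' (f v) s (f y) <-> gball G v s y.
  by move=> yr; apply: IH => // z ?; [apply: sr|apply: sr']; left.
split=> [[/(IH _ xr) ?|[y' y's y'x]]|[/(IH _ xr) ?|[y ys yx]]]; try by left.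
- have [y yr yy'] := fs _ (sr' _ (or_introl y's)).
  by right; exists y; [apply/(IH _ yr); rewrite yy'|rewrite /nbrs /= -fG// yy'].
- have yr : gball G u r y by apply: sr; left.
  by right; exists (f y); [exact/(IH _ yr)|rewrite /nbrs /= fG].
Qed.

Lemma ball_map_root s x : (s <= r)%N -> gball G u r x ->
  gball G' u' s (f x) <-> gball G u s x.
Proof.
rewrite -fu => sr; apply: ball_map_gball; last exact: gball_self.
- exact: gball_mono.
- by rewrite fu; exact: gball_mono.
Qed.

(** Around a vertex at distance k of the root, only the ball of radius r - k is
known to be contained in the r-ball; there the same map serves. *)
Lemma ball_map_shift k s v : (k + s <= r)%N -> gball G u k v ->
  set_bij (gball G v s) (gball G' (f v) s) f.
Proof.
have [ff fi fs] := fb => ksr vk.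
have kr : (k <= r)%N by apply: leq_trans ksr; exact: leq_addr.
have vr := gball_mono kr vk.
have in_u : gball G v s `<=` gball G u r.
  by move=> x vx; apply: gball_mono ksr _ _; exact: gball_trans vx.
have in_u' : gball G' (f v) s `<=` gball G' u' r.
  move=> x vx; apply: gball_mono ksr _ _; apply: gball_trans vx.
  exact/ball_map_root.
split.
- by move=> x xs; apply/ball_map_gball => //; exact: in_u.
- by move=> x y /set_mem/in_u ? /set_mem/in_u ?; apply: fi; exact/mem_set.
- move=> y' y's; have [x xr xy'] := fs _ (in_u' _ y's).
  by exists x => //; apply/ball_map_gball => //; rewrite xy'.
Qed.

Lemma ball_map_nbrs : (0 < r)%N -> nbrs G' u' = f @` nbrs G u.
Proof.
have [ff fi fs] := fb => r0.
have g1 (W : Type) (H : sgraph W) h : gball H h 1 = h |` nbrs H h by rewrite /= bigcup_set1.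
apply/seteqP; split=> [y' uy'|_ [y uy <-]].
  have y'r : gball G' u' r y' by apply: (gball_mono r0); rewrite g1; right.
  have [y yr yy'] := fs _ y'r; exists y => //.
  by rewrite /nbrs /= -fG//; [rewrite fu yy'|exact: gball_self].
rewrite /nbrs /= -fu fG//; first exact: gball_self.
by apply: (gball_mono r0); rewrite g1; right.
Qed.

End ball_maps.

Lemma near_iso_le (r s : nat) (e e' : R) (V V' : Type) (G : sgraph V) u w
    (G' : sgraph V') u' w' : (s <= r)%N -> e <= e' ->
  near_iso r e G u w G' u' w' -> near_iso s e' G u w G' u' w'.
Proof.
move=> sr ee' [f [fb fu fG fw]]; exists f; split => //.
- by have := ball_map_shift (k := 0) (s := s) fb fu fG sr (gball_self G u 0); rewrite fu.
- by move=> x y xs ys; apply: fG; exact: (gball_mono sr).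
- move=> x xs; apply: (lt_le_trans (fw _ _) ee'); exact: (gball_mono sr).
Qed.

Lemma near_iso_trans (r : nat) (e1 e2 : R) (V1 V2 V3 : Type)
    (G1 : sgraph V1) u1 w1 (G2 : sgraph V2) u2 w2 (G3 : sgraph V3) u3 w3 :
  near_iso r e1 G1 u1 w1 G2 u2 w2 -> near_iso r e2 G2 u2 w2 G3 u3 w3 ->
  near_iso r (e1 + e2) G1 u1 w1 G3 u3 w3.
Proof.
move=> [f [fb fu fG fw]] [g [gb gu gG gw]]; have [ff _ _] := fb.
exists (g \o f); split => /=.
- exact: set_bij_comp gb.
- by rewrite fu.
- by move=> x y xr yr; rewrite gG ?fG//; exact: ff.
- move=> x xr; have := gw _ (ff _ xr); have := fw _ xr => h1 h2.
  rewrite -(subrKA (w2 (f x))%:num) (le_lt_trans (ler_normD _ _))// addrC.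
  exact: ltrD.
Qed.

Lemma near_iso_sym (r : nat) (e : R) (V V' : Type)
    (G : sgraph V) u w (G' : sgraph V') u' w' :
  near_iso r e G u w G' u' w' -> near_iso r e G' u' w' G u w.
Proof.
move=> [f [fb fu fG fw]]; have [ff fi fs] := fb.
have /choice[g gP] : forall y, exists x, gball G' u' r y -> gball G u r x /\ f x = y.
  move=> y; have [/fs[x xr xy]|ny] := pselect (gball G' u' r y); first by exists x.
  by exists u.
have gK x : gball G u r x -> g (f x) = x.
  move=> xr; have [h1 h2] := gP _ (ff _ xr).
  by apply: fi => //; exact/mem_set.
exists g; split.
- split.
  + by move=> y /gP[].
  + move=> y z /set_mem yr /set_mem zr yz.
    by have [_ <-] := gP _ yr; have [_ <-] := gP _ zr; rewrite yz.
  + by move=> x xr; exists (f x); [exact: ff|exact: gK].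
- by rewrite -fu gK//; exact: gball_self.
- by move=> x y /gP[xr <-] /gP[yr <-]; rewrite !gK// fG.
- by move=> x /gP[xr <-]; rewrite gK// distrC; exact: fw.
Qed.

Lemma near_iso_refl (r : nat) (e : R) (V : Type) (G : sgraph V) u w : 0 < e ->
  near_iso r e G u w G u w.
Proof.
move=> e0; exists id; split => //; last by move=> x _; rewrite subrr normr0.
by split => // x xr; exists x.
Qed.

Lemma rl_iso_near (r : nat) (e : R) (V V' : Type)
    (G : sgraph V) u w (G' : sgraph V') u' w' : 0 < e ->
  rl_iso G u w G' u' w' -> near_iso r e G u w G' u' w'.
Proof. by move=> e0; apply: near_iso_rl_iso; exact: near_iso_refl. Qed.

Lemma near_iso_unlabelled (r : nat) (e : R) (V V' : Type)
    (G : sgraph V) u w (G' : sgraph V') u' w' (c : {i01 R}) :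
  near_iso r e G u w G' u' w' ->
  near_iso r 1 G u (fun=> c) G' u' (fun=> c).
Proof.
by move=> [f [fb fu fG fw]]; exists f; split => // x _; rewrite subrr normr0.
Qed.

End near_isomorphisms.

(** A function with finitely many values is constant on a set of the ultrafilter.
This replaces the repeated extraction of subsequences. *)
Lemma ultra_finite_choice (I T : Type) (F : set_system I) (FU : UltraFilter F)
    (h : I -> T) (B : set T) : finite_set B -> F [set i | B (h i)] ->
  exists2 y, B y & F [set i | h i = y].
Proof.
move=> /finite_setP[n]; elim: n B => [|n IH] B.
  rewrite II0 card_eq0 => /eqP -> F0.
  by have [i []] := filter_ex F0.
move=> /eq_cardSP[y By Bn] FB.
have [Fy|Fny] := in_ultra_setVsetC [set i | h i = y] FU; first by exists y.
have [|z [Bz _] Fz] := IH _ Bn; last by exists z.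
by apply: filterS2 FB Fny => i Bi hiy; split.
Qed.

(** Along an ultrafilter on the radii, the isomorphisms of balls stabilise at every
vertex, since a vertex at distance s has only the finitely many vertices of the
ball of radius s as possible images; likewise for preimages. The labels are
taken constant, so that [near_iso] compares the unlabelled balls. *)
Lemma ball_iso_limit (R : realType) (V V' : Type) (G : sgraph V) (u : V)
    (G' : sgraph V') (u' : V') (c : {i01 R}) :
  connected_graph G -> connected_graph G' ->
  (forall r, finite_set (gball G u r)) -> (forall r, finite_set (gball G' u' r)) ->
  (forall r, near_iso r 1 G u (fun=> c) G' u' (fun=> c)) ->
  exists f : V -> V', [/\ bijective f, forall x y, G' (f x) (f y) = G x y & f u = u'].
Proof.
move=> Gc G'c Gf G'f /choice[f fP].
have [F [FU FN]] := ultraFilterLemma (eventually_filter : ProperFilter \oo).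
have Fge s : F [set r | (s <= r)%N] by apply: FN; exact: nbhs_infty_ge.
have fix_ x : exists y, F [set r | f r x = y].
  have [s xs] := connected_gball u x Gc.
  have [|y _ Fy] := @ultra_finite_choice _ _ F FU (fun r => f r x) _ (G'f s).
    apply: filterS (Fge s) => r /= sr; have [fb fu fG _] := fP r.
    by apply/(ball_map_root fb fu fG) => //; exact: gball_mono xs.
  by exists y.
have {fix_} [g gP] := choice fix_.
have common x y : exists r, [/\ gball G u r x, gball G u r y, f r x = g x & f r y = g y].
  have [s xs] := connected_gball u x Gc; have [k yk] := connected_gball u y Gc.
  have [r [[? ?] [? ?]]] := filter_ex (filterI (filterI (gP x) (gP y)) (filterI (Fge s) (Fge k))).
  by exists r; split => //; [exact: gball_mono xs|exact: gball_mono yk].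
have gG x y : G' (g x) (g y) = G x y.
  by have [r [? ? <- <-]] := common x y; have [_ _ ->] := fP r.
have g_inj : injective g.
  move=> x y gxy; have [r [? ? fx fy]] := common x y.
  have [[_ fi _] _ _ _] := fP r; apply: fi; rewrite ?fx ?fy//; exact: mem_set.
have g_surj y : exists x, g x = y.
  have [s ys] := connected_gball u' y G'c.
  have /choice[h hP] : forall r, exists x, (s <= r)%N -> gball G u s x /\ f r x = y.
    move=> r; have [sr|sr] := leqP s r; last by exists u.
    have [fb fu fG _] := fP r; have [_ _ fs] := fb.
    have [x xr xy] := fs _ (gball_mono sr ys).
    exists x => _; split => //.
    by apply/(ball_map_root fb fu fG) => //; rewrite xy.
  have [|x xs Fx] := @ultra_finite_choice _ _ F FU h _ (Gf s).
    by apply: filterS (Fge s) => r /hP[].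
  exists x; have [r [[hx fx] sr]] := filter_ex (filterI (filterI Fx (gP x)) (Fge s)).
  by rewrite -fx -hx; have [] := hP _ sr.
have [g' g'K] := choice g_surj.
exists g; split => //; first by exists g' => // x; apply: g_inj; rewrite g'K.
by have [r [_ _ <- _]] := common u u; have [_ -> _] := fP r.
Qed.

Lemma sum_fset_set_image (R : nmodType) (I J : choiceType) (f : I -> J) (A : set I)
    (h : J -> R) : finite_set A -> {in A &, injective f} ->
  \sum_(y <- fset_set (f @` A)) h y = \sum_(x <- fset_set A) h (f x).
Proof.
move=> fA fi; rewrite -(big_map f xpredT h); apply: perm_big.
have fI : finite_set (f @` A) by exact: finite_image.
apply: uniq_perm; first exact: fset_uniq.
  rewrite map_inj_in_uniq ?fset_uniq// => x y; rewrite !in_fset_set// => xA yA.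
  exact: fi.
move=> y; rewrite in_fset_set//; apply/idP/mapP => [/set_mem[x Ax <-]|[x]].
  by exists x => //; rewrite in_fset_set//; exact: mem_set.
by rewrite in_fset_set// => /set_mem Ax ->; apply/mem_set; exists x.
Qed.

(** * The topology of local convergence *)

Section local_topology.
Context (R : realType) (D : nat).
Implicit Types (x y z : rlgraph R D) (U : set (rl_class R D)).

Local Notation nearz r e x y :=
  (near_iso r e (rl_graph x) (rl_root x) (@rl_label _ _ x)
    (rl_graph y) (rl_root y) (@rl_label _ _ y)).

Definition local_open U := forall x, U (\pi_(rl_class R D) x) ->
  exists r (e : R), 0 < e /\ local_ball x r e `<=` U.

Lemma pi_surj (c : rl_class R D) : exists x, c = \pi_(rl_class R D) x.
Proof. by exists (repr c); rewrite reprK. Qed.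

Lemma local_openP U : local_open U <-> forall x, U (\pi_(rl_class R D) x) ->
  exists r (e : R), 0 < e /\ forall y, nearz r e x y -> U (\pi_(rl_class R D) y).
Proof.
split=> oU x /oU[r [e [e0 h]]]; exists r, e; split => //.
  by move=> y xy; apply: h; exact/local_ballP.
by move=> _ [y xy <-]; exact: h.
Qed.

Lemma rlgraph_gball_finite x u r : finite_set (gball (rl_graph x) u r).
Proof. exact: gball_finite (@rl_degrees _ _ x). Qed.

Let bseq x r := enum_fset (fset_set (gball (rl_graph x) (rl_root x) r)).

Let mem_bseq x r a : (a \in bseq x r) <-> gball (rl_graph x) (rl_root x) r a.
Proof.
rewrite /bseq (_ : (a \in enum_fset _) = (a \in fset_set (gball (rl_graph x) (rl_root x) r)))//.
rewrite in_fset_set; last exact: rlgraph_gball_finite.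
by split=> [/set_mem|/mem_set].
Qed.

(** Adjacency, position of the root, and labels rounded down to multiples of
1 / (n+1), in an enumeration of the ball. *)
Definition ball_code x r n : seq (seq bool) * seq bool * seq int :=
  ([seq [seq rl_graph x a b | b <- bseq x r] | a <- bseq x r],
   [seq a == rl_root x | a <- bseq x r],
   [seq Num.floor ((rl_label a)%:num * n.+1%:R : R) | a <- bseq x r]).

Lemma ball_code_near x y r n : ball_code x r n = ball_code y r n ->
  nearz r (n.+1%:R^-1 : R) x y.
Proof.
move=> [xyG xyr xyl].
have sz : size (bseq x r) = size (bseq y r) by have := congr1 size xyr; rewrite !size_map.
pose f a := nth (rl_root y) (bseq y r) (index a (bseq x r)).
have uy : uniq (bseq y r) by exact: fset_uniq.
have ux : uniq (bseq x r) by exact: fset_uniq.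
exists f; split.
- split.
  + move=> a /mem_bseq ax; apply/mem_bseq/mem_nth.
    by rewrite -sz index_mem.
  + move=> a b /set_mem/mem_bseq ax /set_mem/mem_bseq bx /eqP.
    rewrite /f nth_uniq// -?sz ?index_mem// => /eqP ab.
    by rewrite -(nth_index (rl_root x) ax) ab nth_index.
  + move=> b /mem_bseq yb.
    have bx : (index b (bseq y r) < size (bseq x r))%N by rewrite sz index_mem.
    exists (nth (rl_root x) (bseq x r) (index b (bseq y r))).
      exact/mem_bseq/mem_nth.
    by rewrite /f index_uniq// nth_index.
- have rx : rl_root x \in bseq x r by apply/mem_bseq; exact: gball_self.
  have := congr1 (fun c => nth false c (index (rl_root x) (bseq x r))) xyr.
  rewrite (nth_map (rl_root x)) ?index_mem// nth_index// eqxx.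
  by rewrite (nth_map (rl_root y)) -?sz ?index_mem// => /esym/eqP.
- move=> a b /mem_bseq ax /mem_bseq bx.
  have := congr1 (fun c => nth false (nth [::] c (index a (bseq x r)))
    (index b (bseq x r))) xyG.
  rewrite !(nth_map (rl_root x)) ?index_mem// !nth_index// => ->.
  by rewrite !(nth_map (rl_root y)) -?sz ?index_mem.
- move=> a /mem_bseq ax.
  have := congr1 (fun c => nth 0 c (index a (bseq x r))) xyl.
  rewrite (nth_map (rl_root x)) ?index_mem// nth_index//.
  rewrite (nth_map (rl_root y)) -?sz ?index_mem// -/(f a).
  set p := (rl_label a)%:num; set q := (rl_label (f a))%:num => /= flE.
  have n0 : 0 < n.+1%:R :> R by [].
  suff : `|q * n.+1%:R - p * n.+1%:R| < 1.
    by rewrite -mulrBl normrM (ger0_norm (ltW n0)) -ltr_pdivlMr// div1r.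
  have := floor_itv (p * n.+1%:R).
  have := floor_itv (q * n.+1%:R).
  rewrite -flE intrD => /andP[h1 h2] /andP[h3 h4].
  by rewrite ltr_norml; apply/andP; split; lra.
Qed.

(** There are countably many codes, and graphs with the same code are close; so an
open set is a countable union of generating balls. *)
Lemma local_open_measurable (U : set (Omega R D)) : local_open U -> measurable U.
Proof.
move=> oU.
(* A i is the ball around some graph with code i.2 whose ball lies in U. *)
pose A (i : nat * nat * (seq (seq bool) * seq bool * seq int)) : set (Omega R D) :=
  if pselect (exists x, ball_code x i.1.1 i.1.2 = i.2 /\
     local_ball x i.1.1 (i.1.2.+1%:R^-1 : R) `<=` U) is left h
  then local_ball (projT1 (cid h)) i.1.1 (i.1.2.+1%:R^-1 : R) else set0.
rewrite (_ : U = \bigcup_(i in setT) A i).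
  apply: countable_bigcupT_measurable => [|i]; first exact: countableP.
  rewrite /A; case: pselect => [h|_]; last exact: measurable0.
  by apply: sub_sigma_algebra; exists (projT1 (cid h)), i.1.1, (i.1.2.+1%:R^-1 : R); split.
apply/seteqP; split => [c|c [i _]]; last first.
  by rewrite /A; case: pselect => // h; case: cid => x /= [_]; exact.
have [x ->] := pi_surj c => /oU[r [e [e0 h]]].
have [n ne] : exists n : nat, n.+1%:R^-1 < e.
  exists (Num.trunc e^-1); rewrite invf_plt ?posrE//.
  have : 0 <= e^-1 by rewrite invr_ge0 ltW.
  by move=> /truncn_itv/andP[].
exists ((r, n), ball_code x r n) => //; rewrite /A /=.
case: pselect => [h'|]; last first.
  case; exists x; split => // _ [y xy <-]; apply: h; apply/local_ballP.
  exact: near_iso_le (ltW ne) xy.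
case: cid => y [/= yx yU]; exact/local_ballP/ball_code_near.
Qed.

(** The finitely many strict inequalities between labels leave a positive margin. *)
Lemma local_ball_open x r (e : R) : 0 < e -> local_open (local_ball x r e).
Proof.
move=> e0; apply/local_openP => y /local_ballP [f [fb fu fG fw]].
have [s sE] : exists s : seq _, forall a, gball (rl_graph x) (rl_root x) r a -> a \in s.
  by have /finite_seqP[s ->] := rlgraph_gball_finite (rl_root x) r; exists s.
pose dst a := `|(rl_label (f a))%:num - (rl_label a)%:num| : R.
have [e' [e'0 e'P]] : exists e', 0 < e' /\
    forall a, a \in s -> gball (rl_graph x) (rl_root x) r a -> dst a + e' <= e.
  elim: s {sE} => [|b s [e1 [e10 IH]]]; first by exists 1.
  have [bx|bx] := pselect (gball (rl_graph x) (rl_root x) r b); last first.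
    exists e1; split => // a; rewrite inE => /orP[/eqP -> //|]; exact: IH.
  exists (Num.min e1 (e - dst b)); split.
    by rewrite lt_min e10 subr_gt0; exact: fw.
  move=> a; rewrite inE => /orP[/eqP -> _|/IH h /h {}h].
    by rewrite addrC -lerBrDr ge_min lexx orbT.
  by apply: le_trans h; rewrite lerD2l ge_min lexx.
have [ff _ _] := fb.
exists r, e'; split => // z [g [gb gu gG gw]]; apply/local_ballP.
exists (g \o f); split => /=.
- exact: set_bij_comp gb.
- by rewrite fu.
- by move=> a b ar br; rewrite gG ?fG//; exact: ff.
- move=> a ar; have := gw _ (ff _ ar); have := e'P _ (sE _ ar) ar => h1 h2.
  apply: lt_le_trans h1.
  by rewrite -(subrKA (rl_label (f a))%:num) (le_lt_trans (ler_normD _ _))// addrC ltrD2l.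
Qed.

Lemma local_openI U1 U2 : local_open U1 -> local_open U2 -> local_open (U1 `&` U2).
Proof.
move=> /local_openP o1 /local_openP o2; apply/local_openP => x [/o1[r1 [e1 [e10 h1]]] /o2[r2 [e2 [e20 h2]]]].
exists (maxn r1 r2), (Num.min e1 e2); split; first by rewrite lt_min e10.
move=> y xy; split; [apply: h1|apply: h2]; apply: near_iso_le xy.
- exact: leq_maxl.
- by rewrite ge_min lexx.
- exact: leq_maxr.
- by rewrite ge_min lexx orbT.
Qed.

Lemma local_openT : local_open setT.
Proof. by move=> x _; exists 0%N, 1. Qed.

Definition nbr_sum (f : Omega R D -> R) (c : Omega R D) : R :=
  \sum_(v <- fset_set (root_nbrs c)) f (move_root c v).

Lemma reroot_iso_pi x y (h : {n | rl_dom x n} -> {n | rl_dom y n}) v :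
  bijective h -> (forall a b, rl_graph y (h a) (h b) = rl_graph x a b) ->
  (forall a, rl_label (h a) = rl_label a) ->
  \pi_(rl_class R D) (reroot (h v)) = \pi_(rl_class R D) (reroot v).
Proof.
move=> hb hG hl; apply/eqmodP/asboolP; apply: rl_iso_sym.
by exists h; split.
Qed.

(** The representative in the definition can be any graph of the class, since an
isomorphism maps the neighbours of the root to the neighbours of the root. *)
Lemma nbr_sum_pi f x : nbr_sum f (\pi_(rl_class R D) x) =
  \sum_(v <- fset_set (nbrs (rl_graph x) (rl_root x))) f (\pi_(rl_class R D) (reroot v)).
Proof.
rewrite /nbr_sum; set c := \pi_(rl_class R D) x.
have /asboolP[h [hb hG hu hl]] : rl_equiv x (repr c).
  by apply/eqmodP; rewrite reprK.
rewrite (_ : root_nbrs c = h @` nbrs (rl_graph x) (rl_root x)); last first.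
  have [g hK gK] := hb; rewrite /root_nbrs -hu; apply/seteqP; split=> [y|_ [y uy <-]].
    by exists (g y); [rewrite /nbrs /= -hG gK|exact: gK].
  by rewrite /nbrs /= hG.
rewrite sum_fset_set_image; first last.
- by move=> a b _ _; exact: bij_inj.
- exact: nbrs_finite (@rl_degrees _ _ x) _.
by apply: eq_bigr => v _; congr f; exact: reroot_iso_pi.
Qed.

Lemma near_iso_reroot r (e : R) x y (f : {n | rl_dom x n} -> {n | rl_dom y n}) v :
  set_bij (gball (rl_graph x) (rl_root x) r.+1) (gball (rl_graph y) (rl_root y) r.+1) f ->
  f (rl_root x) = rl_root y ->
  (forall a b, gball (rl_graph x) (rl_root x) r.+1 a ->
    gball (rl_graph x) (rl_root x) r.+1 b -> rl_graph y (f a) (f b) = rl_graph x a b) ->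
  (forall a, gball (rl_graph x) (rl_root x) r.+1 a ->
    `|(rl_label (f a))%:num - (rl_label a)%:num : R| < e) ->
  nbrs (rl_graph x) (rl_root x) v -> nearz r e (reroot v) (reroot (f v)).
Proof.
move=> fb fu fG fw xv; exists f; split => //=.
- apply: (ball_map_shift (k := 1) fb fu fG); first by rewrite add1n.
  by rewrite /= bigcup_set1; right.
- by move=> a b /(gball_nbrs xv) ? /(gball_nbrs xv) ?; exact: fG.
- by move=> a /(gball_nbrs xv); exact: fw.
Qed.

(** If the r-balls around the neighbours of the root certify that the graph rooted
there is in U, for those neighbours for which this is true, then the ball of
radius r + 1 around the root certifies all of this at once. *)
Lemma nbr_sum_open_lsc U (a : R) : local_open U ->
  local_open [set c | a < nbr_sum (\1_U) c].
Proof.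
move=> /local_openP oU; apply/local_openP => x /= ax.
pose N := nbrs (rl_graph x) (rl_root x).
have re_ (s : seq {n | rl_dom x n}) : exists r (e : R), 0 < e /\ forall v, v \in s ->
    U (\pi_(rl_class R D) (reroot v)) -> forall y, nearz r e (reroot v) y -> U (\pi_(rl_class R D) y).
  elim: s => [|v s [r [e [e0 IH]]]]; first by exists 0%N, 1.
  have [Uv|nUv] := pselect (U (\pi_(rl_class R D) (reroot v))); last first.
    by exists r, e; split => // b; rewrite inE => /orP[/eqP ->|]//; exact: IH.
  have [r1 [e1 [e10 h1]]] := oU _ Uv.
  exists (maxn r1 r), (Num.min e1 e); split; first by rewrite lt_min e10.
  move=> b; rewrite inE => /orP[/eqP -> _ y|bs Ub y] xy.
    by apply: h1; apply: near_iso_le xy; [exact: leq_maxl|rewrite ge_min lexx].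
  by apply: (IH _ bs) => //; apply: near_iso_le xy; [exact: leq_maxr|rewrite ge_min lexx orbT].
have {re_} [r [e [e0 re]]] := re_ (fset_set N).
exists r.+1, e; split => // y [f [fb fu fG fw]] /=.
apply: lt_le_trans ax _; rewrite !nbr_sum_pi.
rewrite (ball_map_nbrs fb fu fG)// sum_fset_set_image; first last.
- have [_ fi _] := fb; move=> v w /set_mem xv /set_mem xw; apply: fi; apply/mem_set.
    by apply: (gball_nbrs xv); exact: gball_self.
  by apply: (gball_nbrs xw); exact: gball_self.
- exact: nbrs_finite (@rl_degrees _ _ x) _.
rewrite !big_seq; apply: ler_sum => v vN; rewrite !indicE.
have [Uv|] := boolP (\pi_(rl_class R D) (reroot v) \in U); last by rewrite ler0n.
rewrite mem_set//; apply: re (vN) (set_mem Uv) _ _.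
apply: near_iso_reroot => //; move: vN; rewrite in_fset_set; first by move/set_mem.
exact: nbrs_finite (@rl_degrees _ _ x) _.
Qed.

(** For open sets this follows from semicontinuity. They are stable under
intersection and generate the measurable sets, and the sum over neighbours is
additive on disjoint unions, so Dynkin's lemma applies. *)
Lemma measurable_nbr_sum_indic (A : set (Omega R D)) : measurable A ->
  measurable_fun setT (nbr_sum (\1_A)).
Proof.
have mopen U : local_open U -> measurable_fun setT (nbr_sum (\1_U)).
  move=> oU _; apply: (measurability _ (RGenOInfty.measurableE R)) => //.
  move=> _ [_ [a ->] <-]; rewrite setTI preimage_itvoy; apply: local_open_measurable.
  exact: nbr_sum_open_lsc.
have genE : @measurable _ (Omega R D) = <<s local_open >>.
  apply/seteqP; split=> B.
    apply: smallest_sub; first exact: smallest_sigma_algebra.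
    move=> _ [x [r [e [e0 ->]]]]; apply: sub_sigma_algebra; exact: local_ball_open.
  apply: smallest_sub; last by move=> U; exact: local_open_measurable.
  exact: sigma_algebra_measurable.
rewrite {1}genE; move: A.
apply: (@dynkin_induction _ (Omega R D) local_open
  (fun A => measurable_fun setT (nbr_sum (\1_A)))) => //.
- exact: local_openI.
- by apply: mopen; exact: local_openT.
- move=> A mA IH.
  rewrite (_ : nbr_sum _ = (fun c => nbr_sum (\1_setT) c - nbr_sum (\1_A) c)).
    by apply: measurable_funB => //; apply: mopen; exact: local_openT.
  apply/funext => c; rewrite /nbr_sum -sumrB; apply: eq_bigr => v _.
  rewrite !indicE in_setC in_setT.
  by case: (_ \in A); rewrite /= ?subrr ?subr0.
- move=> F mF tF IH.
  apply: (measurable_fun_cvg (h := fun n c => \sum_(k < n) nbr_sum (\1_(F k)) c)).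
    by move=> n; apply: measurable_sum.
  move=> c _; rewrite /nbr_sum.
  rewrite (_ : (fun n => _) = (fun n => \sum_(v <- fset_set (root_nbrs c)) \sum_(k < n) (\1_(F k) (move_root c v) : R))).
    apply: cvg_big => [|v _]; first exact: add_continuous.
    set y := move_root c v; have [[k _ Fky]|ny] := pselect ((\bigcup_k F k) y).
      rewrite indicE mem_set//=; last by exists k.
      apply: cvg_near_cst; exists k.+1 => // n /= kn; apply/eqP.
      rewrite (bigD1 (Ordinal kn))//= indicE mem_set// big1 ?addr0// => j jk.
      rewrite indicE; have [/set_mem Fjy|//] := boolP (y \in F j).
      exfalso; move/eqP: jk; apply; apply: val_inj => /=.
      by apply: (tF j k) => //; exists y.
    rewrite indicE memNset//=; apply: cvg_near_cst; exists 0%N => // n _ /=; apply/eqP.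
    rewrite big1// => j _; rewrite indicE memNset// => Fy; apply: ny; by exists j.
  by apply/funext => n; rewrite exchange_big.
Qed.

Import HBNNSimple.

Lemma measurable_nbr_sum (f : Omega R D -> R) : measurable_fun setT f ->
  measurable_fun setT (nbr_sum f).
Proof.
have pos (g : Omega R D -> R) : measurable_fun setT g -> (forall c, 0 <= g c) ->
    measurable_fun setT (nbr_sum g).
  move=> mg g0; have mg' : measurable_fun setT (EFin \o g) by exact/measurable_EFinP.
  pose h := nnsfun_approx measurableT mg'.
  have hg c : (fun n => h n c) @ \oo --> g c.
    have := cvg_nnsfun_approx measurableT mg' (fun c' _ => g0 c' : (0 <= (EFin \o g) c')%E) (I : setT c).
    by move=> /fine_cvg.
  apply: (measurable_fun_cvg (h := fun n => nbr_sum (h n))).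
    move=> n; rewrite (_ : nbr_sum _ = (fun c => \sum_(y <- fset_set (range (h n)))
        y * nbr_sum (\1_(h n @^-1` [set y])) c)).
      apply: measurable_sum => y; apply: measurable_funM => //.
      by apply: measurable_nbr_sum_indic.
    apply/funext => c; rewrite /nbr_sum.
    under [RHS]eq_bigr do rewrite mulr_sumr; rewrite exchange_big /=.
    by apply: eq_bigr => v _; rewrite fimfunE fsbig_finite.
  by move=> c _; apply: cvg_big => [|v _]; [exact: add_continuous|exact: hg].
move=> mf; rewrite (_ : nbr_sum f = (fun c => nbr_sum (fun c' => Num.max (f c') 0) c -
    nbr_sum (fun c' => Num.max (- f c') 0) c)).
  apply: measurable_funB; apply: pos.
  - exact: measurable_maxr.
  - by move=> x; rewrite le_max lexx orbT.
  - by apply: measurable_maxr => //; exact: measurableT_comp.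
  - by move=> x; rewrite le_max lexx orbT.
apply/funext => c; rewrite /nbr_sum -sumrB; apply: eq_bigr => v _.
by rewrite !maxEle; case: (leP (f _) 0); case: (leP (- f _) 0); lra.
Qed.

End local_topology.

(** * The classes of G in Omega *)

Section rooted_classes.
Context (R : realType) (V : countType) (G : sgraph V) (D : nat).
Hypotheses (G_conn : connected_graph G) (G_deg : degrees_le G D).

Local Notation rc := (@rooted_class R V G D G_conn G_deg).

Lemma rc_piP (z : rlgraph R D) v w : \pi_(rl_class R D) z = rc v w <->
  rl_iso G v w (rl_graph z) (rl_root z) (@rl_label _ _ z).
Proof.
have iso := rooted_rlgraph_iso G_conn G_deg v w.
split=> [/eqmodP/asboolP zi|zi].
  by apply: rl_iso_trans iso _; exact: rl_iso_sym.
by apply/eqmodP/asboolP; exact: rl_iso_trans (rl_iso_sym zi) iso.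
Qed.

Lemma rc_eqP v w v' w' : rc v w = rc v' w' <-> rl_iso G v w G v' w'.
Proof.
have iso := rooted_rlgraph_iso G_conn G_deg v w.
split=> [/rc_piP zi|vv].
  by apply: rl_iso_trans iso _; exact: rl_iso_sym.
by apply/rc_piP; apply: rl_iso_trans iso; exact: rl_iso_sym.
Qed.

(** The labels being invariant in law, this makes the law of a lift depend on the
orbit of the vertex only. *)
Lemma rc_aut g v w : graph_aut G g -> rc (g v) w = rc v (w \o g).
Proof. by move=> [gb gG]; apply/esym/rc_eqP; exists g; split. Qed.

Lemma rc_orbit v w v' w' : rc v w = rc v' w' -> aut_orbit G v v'.
Proof. by move=> /rc_eqP[g [gb gG gv _]]; exists g. Qed.

(** The graphing looks like G itself from the classes of G, even though G may have
automorphisms that preserve the labels: neighbours are counted in a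
representative and not as classes. *)
Lemma nbr_sum_rc (f : Omega R D -> R) v w :
  nbr_sum f (rc v w) = \sum_(u <- fset_set (nbrs G v)) f (rc u w).
Proof.
rewrite {1}/rooted_class nbr_sum_pi.
have := rooted_rlgraph_iso G_conn G_deg v w.
move: (rooted_rlgraph _ _ _ _) => z [h [hb hG hv hl]].
rewrite (_ : nbrs (rl_graph z) (rl_root z) = h @` nbrs G v); last first.
  have [g hK gK] := hb; rewrite -hv; apply/seteqP; split=> [y|_ [y uy <-]].
    by exists (g y); [rewrite /nbrs /= -hG gK|exact: gK].
  by rewrite /nbrs /= hG.
rewrite sum_fset_set_image; first last.
- by move=> a b _ _; exact: bij_inj.
- exact: nbrs_finite G_deg _.
apply: eq_bigr => u _; congr f; apply/rc_piP => /=.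
by exists h; split.
Qed.

Lemma nbr_sum1 (c : Omega R D) : nbr_sum (cst 1) c = (root_deg c)%:R.
Proof.
by rewrite /nbr_sum /root_deg /deg /set_size big_const_seq count_predT iter_addr_0.
Qed.

Lemma root_deg_rc v w : root_deg (rc v w) = deg G v.
Proof.
apply/eqP; rewrite -(eqr_nat R) -nbr_sum1 nbr_sum_rc /deg /set_size.
by rewrite big_const_seq count_predT iter_addr_0.
Qed.

Definition root_classes v : set (Omega R D) := [set x | exists w, x = rc v w].

Lemma root_classes_orbit v u w : aut_orbit G v u -> root_classes v (rc u w).
Proof. by move=> [g ga <-]; exists (w \o g); rewrite rc_aut. Qed.

Lemma root_classesP v u w : root_classes v (rc u w) <-> aut_orbit G v u.
Proof.
split=> [[w' /esym]|]; first exact: rc_orbit.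
exact: root_classes_orbit.
Qed.

(** The complement is open: a graph that is not isomorphic to (G, v) differs from it
on some finite ball ([ball_iso_limit]), and so do all graphs with the same ball. *)
Lemma measurable_root_classes v : measurable (root_classes v).
Proof.
rewrite -(setCK (root_classes v)); apply: measurableC; apply: local_open_measurable.
apply/local_openP => z nz.
pose c := (point : {i01 R}).
have [r nr] : exists r, ~ near_iso r 1 G v (fun=> c) (rl_graph z) (rl_root z) (fun=> c).
  apply/existsNP => iso; apply: nz.
  have [|||f [fb fG fv]] := @ball_iso_limit R _ _ G v (rl_graph z) (rl_root z) c G_conn _ _ _ iso.
  - exact: rl_connected.
  - by move=> r; exact: gball_finite G_deg.
  - by move=> r; exact: rlgraph_gball_finite.
  by exists (@rl_label _ _ z \o f); apply/rc_piP; exists f; split.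
exists r, 1; split => // y zy [w /rc_piP yw]; apply: nr.
have := near_iso_trans (rl_iso_near r ltr01 yw) (near_iso_sym zy).
exact: near_iso_unlabelled.
Qed.

Variables (t : nat) (o : 'I_t -> V).

Lemma orbit_classesE (T : {set 'I_t}) : @orbit_classes R V G D G_conn G_deg t o T =
  \bigcup_(i in [set i | i \in T]) root_classes (o i).
Proof.
apply/seteqP; split=> [x [i [v [w [iT iv ->]]]]|x [i iT [w ->]]].
  by exists i => //; exact: root_classes_orbit.
by exists i, (o i), w; split => //; exists id => //; split => //; exists id.
Qed.

Lemma measurable_orbit_classes (T : {set 'I_t}) :
  measurable (@orbit_classes R V G D G_conn G_deg t o T).
Proof.
rewrite orbit_classesE; apply: fin_bigcup_measurable => [|i _].
  exact: finite_finset.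
exact: measurable_root_classes.
Qed.

End rooted_classes.

(** * Invariance and independence of the labels *)

Section measure_preserving.
Context d d' (T1 : measurableType d) (T2 : measurableType d') (R : realType).
Variables (m1 : {measure set T1 -> \bar R}) (m2 : {measure set T2 -> \bar R}).
Variables (phi : T1 -> T2) (mphi : measurable_fun setT phi).
Hypothesis phiP : forall A, measurable A -> m1 (phi @^-1` A) = m2 A.

Lemma ge0_integral_measure_preserving (f : T2 -> \bar R) :
  measurable_fun setT f -> (forall x, (0 <= f x)%E) ->
  (\int[m2]_x f x = \int[m1]_x f (phi x))%E.
Proof.
move=> mf f0.
transitivity (\int[measure_function_pushforward__canonical__measure_function_Measure m1 mphi]_x f x)%E.
  by apply: eq_measure_integral => A mA _; rewrite -phiP.
by rewrite ge0_integral_pushforward.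
Qed.

Lemma integral_measure_preserving (f : T2 -> \bar R) :
  measurable_fun setT f -> (\int[m2]_x f x = \int[m1]_x f (phi x))%E.
Proof.
move=> mf; rewrite integralE [RHS]integralE; congr (_ - _)%E.
  rewrite (ge0_integral_measure_preserving (measurable_funepos mf))//.
  by   apply: eq_integral => x _; rewrite !funeposE.
rewrite (ge0_integral_measure_preserving (measurable_funeneg mf))//.
by apply: eq_integral => x _; rewrite !funenegE.
Qed.

Lemma Rintegral_measure_preserving (f : T2 -> R) :
  measurable_fun setT f -> \int[m2]_x f x = \int[m1]_x f (phi x).
Proof.
move=> mf; rewrite /Rintegral (@integral_measure_preserving (EFin \o f))//.
exact/measurable_EFinP.
Qed.

End measure_preserving.

Lemma bounded_integrable d (T : measurableType d) (R : realType)
    (m : {measure set T -> \bar R}) (f : T -> R) (C : R) : (m setT < +oo)%E ->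
  measurable_fun setT f -> (forall x, `|f x| <= C) ->
  m.-integrable setT (EFin \o f).
Proof.
move=> m_fin mf fC; apply: measurable_bounded_integrable => //.
exists C; split; first exact: num_real.
by move=> y Cy x _ /=; apply: le_trans (fC x) (ltW Cy).
Qed.

Section iid_labels.
Context (R : realType) (V : countType).
Local Notation lab := (labeling R V).

Definition cylinder (F : {fset V}) (B : V -> set R) : set lab :=
  [set w | forall v, v \in F -> B v (w v)%:num].

Definition cylinders : set (set lab) :=
  [set A | exists F B, (forall v, measurable (B v)) /\ A = cylinder F B].

Lemma measurable_coordinate (v : V) :
  measurable_fun setT (fun w : lab => (w v)%:num : R).
Proof.
move=> _ B mB; rewrite setTI; apply: sub_sigma_algebra.
by exists v, B.
Qed.

Lemma measurable_cylinder F B : (forall v, measurable (B v)) ->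
  measurable (cylinder F B).
Proof.
move=> mB; rewrite (_ : cylinder F B =
    \bigcap_(v in [set` F]) ((fun w : lab => (w v)%:num : R) @^-1` B v)); last first.
  by apply/seteqP; split=> w h v vF; exact: h.
apply: fin_bigcap_measurable => [|v _]; first exact: finite_fset.
rewrite -[X in measurable X]setTI; exact: measurable_coordinate.
Qed.

Lemma cylinders_generate : @measurable _ lab = <<s cylinders >>.
Proof.
apply/seteqP; split=> B; apply: smallest_sub.
- exact: smallest_sigma_algebra.
- move=> _ [v [C [mC ->]]]; apply: sub_sigma_algebra.
  exists [fset v]%fset, (fun=> C); split => //; apply/seteqP; split=> w /=.
    by move=> Cw u; rewrite in_fset1 => /eqP ->.
  by apply; rewrite in_fset1.
- exact: sigma_algebra_measurable.
- by move=> _ [F [C [mC ->]]]; exact: measurable_cylinder.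
Qed.

Lemma cylinders_setI : setI_closed cylinders.
Proof.
move=> _ _ [F1 [B1 [mB1 ->]]] [F2 [B2 [mB2 ->]]].
exists (F1 `|` F2)%fset, (fun v => (if v \in F1 then B1 v else setT) `&` (if v \in F2 then B2 v else setT)).
split.
  by move=> v; apply: measurableI; case: ifP.
apply/seteqP; split=> w.
  move=> [h1 h2] v _; split.
    by case: ifP => // vF; exact: h1.
  by case: ifP => // vF; exact: h2.
move=> h; split=> v vF.
  by have := h v; rewrite inE vF /= => /(_ isT)[].
by have := h v; rewrite inE vF orbT /= => /(_ isT)[_].
Qed.

Lemma labeling_measure_unique (m1 m2 : {measure set lab -> \bar R}) :
  (m1 setT < +oo)%E ->
  (forall F B, (forall v, measurable (B v)) -> m1 (cylinder F B) = m2 (cylinder F B)) ->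
  forall A, measurable A -> m1 A = m2 A.
Proof.
move=> m1oo m12 A mA; apply: (measure_unique cylinders (fun=> setT)) => //.
- exact: cylinders_generate.
- exact: cylinders_setI.
- move=> _; exists fset0, (fun=> setT); split => //.
  by apply/seteqP; split => // w _ v; rewrite in_fset0.
- by rewrite bigcup_const.
- by move=> _ [F [B [mB ->]]]; exact: m12.
Qed.

Lemma measurable_into_labeling d (T : measurableType d) (h : T -> lab) :
  (forall v, measurable_fun setT (fun x => (h x v)%:num : R)) ->
  measurable_fun setT h.
Proof.
move=> mh; apply: (@measurability _ _ T lab setT h (@coordinate_sets R V)) => //.
move=> _ [_ [v [B [mB ->]]] <-]; exact: mh.
Qed.

Variable L : probability lab R.
Hypothesis L_unif : iid_uniform L.

Definition relabel (g : V -> V) (w : lab) : lab := w \o g.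

Lemma measurable_relabel g : measurable_fun setT (relabel g).
Proof.
apply: measurable_into_labeling => v.
exact: (measurable_coordinate (g v)).
Qed.

(** A cylinder is sent to a cylinder with the same factors, at other vertices. *)
Lemma relabel_preserving g : bijective g -> forall A, measurable A ->
  L (relabel g @^-1` A) = L A.
Proof.
move=> [g' gK g'K] A mA; apply/esym.
apply: (@labeling_measure_unique L
  (measure_function_pushforward__canonical__measure_function_Measure L (measurable_relabel g))) => //.
  by apply: le_lt_trans (ltry 1); exact: probability_le1.
move=> F B mB /=; rewrite /pushforward L_unif//.
rewrite (_ : _ @^-1` _ = [set w : lab | forall v, v \in (g @` F)%fset -> (B \o g') v (w v)%:num]).
  rewrite L_unif; last by move=> v; exact: mB.
  rewrite big_imfset /=; last by move=> x y _ _; exact: (can_inj gK).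
  by apply: eq_bigr => v _; rewrite gK.
apply/seteqP; split=> w h v.
  by move=> /imfsetP[u /= uF ->]; rewrite /= gK; exact: h.
by move=> vF; have := h (g v); rewrite /= gK; apply; exact: in_imfset.
Qed.

Definition splice (S : set V) (p : lab * lab) : lab :=
  fun v => if v \in S then p.1 v else p.2 v.

Lemma measurable_splice S : measurable_fun setT (splice S).
Proof.
apply: measurable_into_labeling => v; rewrite /splice; case: (v \in S).
  exact: (measurableT_comp (measurable_coordinate v) measurable_fst).
exact: (measurableT_comp (measurable_coordinate v) measurable_snd).
Qed.

(** Labels taken on S from one sample and off S from an independent one are again
independent and uniform. This reduces the independence of disjoint families of
labels to Fubini's theorem. *)
Lemma splice_preserving S A : measurable A ->
  (L \x L)%E (splice S @^-1` A) = L A.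
Proof.
move=> mA; apply/esym.
apply: (@labeling_measure_unique L
  (measure_function_pushforward__canonical__measure_function_Measure (L \x L)%E (measurable_splice S))) => //.
  by apply: le_lt_trans (ltry 1); exact: probability_le1.
move=> F B mB /=; rewrite /pushforward.
pose F1 := [fset v in F | v \in S]%fset; pose F2 := [fset v in F | v \notin S]%fset.
rewrite (_ : _ @^-1` _ = cylinder F1 B `*` cylinder F2 B).
  rewrite product_measure1E; [|exact: measurable_cylinder|exact: measurable_cylinder].
  apply: (etrans (L_unif F mB)); apply/esym.
  apply: (etrans (congr2 mule (L_unif F1 mB) (L_unif F2 mB))).
  rewrite /F1 /F2 -!big_fset_condE/=.
  by rewrite [RHS](bigID (fun v => v \in S)).
apply/seteqP; split=> -[w1 w2] /=.
  move=> h; split=> v; rewrite !inE /= => /andP[vF vS]; have := h v vF; rewrite /splice.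
    by rewrite vS.
  by rewrite (negbTE vS).
move=> [h1 h2] v vF; rewrite /splice; case: ifPn => vS.
  by apply: h1; rewrite !inE vF.
by apply: h2; rewrite !inE vF.
Qed.

Definition depends_on (S : set V) (f : lab -> R) :=
  forall w w', (forall v, S v -> w v = w' v) -> f w = f w'.

(** After splicing along S, f is a function of the first sample and g a function of
the second one. *)
Lemma disjoint_labels_expectation (f g : lab -> R) (S S' : set V) (C C' : R) :
  measurable_fun setT f -> measurable_fun setT g ->
  (forall w, `|f w| <= C) -> (forall w, `|g w| <= C') ->
  depends_on S f -> depends_on S' g -> (forall v, S v -> ~ S' v) ->
  \int[L]_w (f w * g w) = (\int[L]_w f w) * (\int[L]_w g w).
Proof.
move=> mf mg fC gC fS gS SS'.
have mfg : measurable_fun setT (fun w => f w * g w) by exact: measurable_funM.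
have ms := measurable_splice S.
rewrite (Rintegral_measure_preserving ms (@splice_preserving S) mfg).
have e p : f (splice S p) * g (splice S p) = f p.1 * g p.2.
  congr (_ * _).
    by apply: fS => v Sv; rewrite /splice mem_set.
  by apply: gS => v S'v; rewrite /splice memNset// => Sv; exact: (SS' v).
under eq_Rintegral do rewrite e.
have mh : measurable_fun setT (fun p : lab * lab => f p.1 * g p.2).
  by apply: measurable_funM; apply: measurableT_comp.
have L_fin : (L setT < +oo)%E := le_lt_trans (probability_le1 L measurableT) (ltry 1).
have intg : L.-integrable setT (EFin \o g).
  exact: bounded_integrable L_fin mg gC.
have intf : L.-integrable setT (EFin \o f).
  exact: bounded_integrable L_fin mf fC.
have inth : (L \x L)%E.-integrable setT (EFin \o (fun p : lab * lab => f p.1 * g p.2)).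
  apply: (bounded_integrable _ mh (C := C * C')) => [|p].
    apply: le_lt_trans (ltry 1); exact: probability_le1.
  by rewrite normrM; exact: ler_pM.
rewrite /Rintegral -(integral12_prod_meas1 inth) /fubini_F /=.
transitivity (fine (\int[L]_x ((\int[L]_y (g y))%:E * (f x)%:E))%E).
  congr fine; apply: eq_integral => x _.
  rewrite /Rintegral fineK; last exact: integrable_fin_num.
  transitivity (\int[L]_y ((f x)%:E * (g y)%:E))%E; first by apply: eq_integral.
  by rewrite integralZl// muleC.
rewrite integralZl// fineM//; last exact: integrable_fin_num.
by rewrite mulrC.
Qed.

End iid_labels.

(** * Decay of the return probabilities *)

Section walk.
Context (R : realType) (V : countType) (G : sgraph V) (D : nat).
Hypotheses (G_conn : connected_graph G) (G_deg : degrees_le G D).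
Implicit Types (h : V -> R) (x y z : V).

Local Arguments walk_prob : simpl never.

Local Notation ws := (@walk_step R V G).
Local Notation p := (@walk_prob R V G).
Local Notation N x := (fset_set (nbrs G x)).

Let mem_N := mem_nbrs G_deg.

Lemma sum_N_const x (a : R) : \sum_(z <- N x) a = (deg G x)%:R * a.
Proof. by rewrite big_const_seq count_predT iter_addr_0 /deg /set_size mulr_natl. Qed.

Lemma walk_step_ge0 h : (forall z, 0 <= h z) -> forall x, 0 <= ws h x.
Proof.
by move=> h0 x; rewrite /walk_step; case: ifP => // _; rewrite divr_ge0// sumr_ge0.
Qed.

Lemma walk_step_le1 h : (forall z, h z <= 1) -> forall x, ws h x <= 1.
Proof.
move=> h1 x; rewrite /walk_step; case: ifPn => // d0.
rewrite ler_pdivrMr ?ltr0n ?lt0n// mul1r -[leRHS]mulr1 -sum_N_const.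
exact: ler_sum.
Qed.

Lemma walk_prob_ge0 n x y : 0 <= p n x y.
Proof.
rewrite /walk_prob; elim: n x => [|n IH] x /=; first by rewrite ler0n.
exact: walk_step_ge0.
Qed.

Lemma walk_prob_le1 n x y : p n x y <= 1.
Proof.
rewrite /walk_prob; elim: n x => [|n IH] x /=; first by rewrite lern1 leq_b1.
exact: walk_step_le1.
Qed.

(** As the upper limit of the n-th roots is below s, the bound s^n holds from some n
on; the constant takes care of the finitely many remaining terms. *)
Lemma non_amenable_decay : non_amenable R G ->
  exists s C : R, [/\ 0 < s < 1, 0 <= C & exists x y, forall n, p n x y <= C * s ^+ n].
Proof.
move=> [x [y]]; rewrite /rho /limn_esup => /ereal_inf_lt[_ [A [k _ kA] <-] A1].
set u := (fun n : nat => _) in A1.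
have uA n : (k <= n)%N -> (u n <= ereal_sup (u @` A))%E.
  by move=> kn; apply: ereal_sup_ubound; exists n => //; exact: kA.
have fin : ereal_sup (u @` A) \is a fin_num.
  rewrite fin_numElt (lt_trans A1) ?ltry// andbT.
  by apply: lt_le_trans (uA _ (leqnn k)); rewrite ltNyr.
have [a aE] : exists a : R, a%:E = ereal_sup (u @` A) by exists (fine (ereal_sup (u @` A))); rewrite fineK.
move: A1 uA; rewrite -aE lte_fin => a1 uA.
(* a may be zero or negative; the maximum makes s positive. *)
pose s := Num.max a 2^-1.
have s01 : 0 < s < 1.
  by rewrite /s lt_max gt_max a1 invr_gt0 ltr0n orbT /= invf_lt1 ?ltr1n.
have /andP[s0 s1] := s01.
have pk n : (k <= n)%N -> (0 < n)%N -> p n x y <= s ^+ n.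
  move=> kn n0; have := uA n kn; rewrite /u lee_fin => h.
  have : p n x y `^ n%:R^-1 <= s by apply: le_trans h _; rewrite /s le_max lexx.
  move=> /(fun q => ge0_ler_powR (ler0n R n) _ _ q).
  rewrite !nnegrE powR_ge0 (ltW s0) => /(_ isT isT).
  rewrite -powRrM mulVf ?pnatr_eq0 -?lt0n// powRr1 ?walk_prob_ge0//.
  by rewrite powR_mulrn// ltW.
exists s, ((s ^+ k.+1)^-1); split => //; first by rewrite invr_ge0 exprn_ge0// ltW.
exists x, y => n; have [kn|nk] := leqP k.+1 n.
  apply: le_trans (pk _ (ltnW kn) (leq_ltn_trans (leq0n k) kn)) _.
  by rewrite ler_peMl ?exprn_ge0 ?(ltW s0)// invf_ge1 ?exprn_gt0// exprn_ile1// ltW.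
apply: le_trans (walk_prob_le1 _ _ _) _.
rewrite mulrC ler_pdivlMr ?exprn_gt0// mul1r.
by apply: ler_wiXn2l; rewrite ?(ltW s0) ?(ltW s1)// ltnW.
Qed.

(** In a connected graph an isolated vertex is the only one; the walk stays there
with probability 1, which contradicts the decay. *)
Lemma non_amenable_deg : non_amenable R G -> forall x, deg G x != 0%N.
Proof.
move=> /non_amenable_decay[s [C [/andP[s0 s1] C0 [x [y pC]]]]] z; apply/negP => dz.
have nz u : ~~ G z u.
  apply/negP => zu; move: dz; rewrite /deg /set_size => /eqP/cardfs0_eq/fsetP/(_ u).
  by rewrite mem_N zu inE.
have allz u : u = z.
  have [[|b q] /=] := G_conn z u; first by move=> _ ->.
  by rewrite (negbTE (nz b)).
have p1 n : p n z z = 1.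
  rewrite /walk_prob; elim: n => [|n IH] /=; first by rewrite eqxx.
  by rewrite /walk_step dz.
have s01 : 0 <= s < 1 by rewrite (ltW s0).
have [n] := geometric_eventually_lt C s01 ltr01.
by rewrite ltNge; have := pC n; rewrite (allz x) (allz y) p1 => ->.
Qed.

Hypothesis deg0 : forall x, deg G x != 0%N.

Let degR0 x : 0 < (deg G x)%:R :> R.
Proof. by rewrite ltr0n lt0n. Qed.

Lemma walk_stepE h x : ws h x = (\sum_(z <- N x) h z) / (deg G x)%:R.
Proof. by rewrite /walk_step (negbTE (deg0 x)). Qed.

Lemma walk_probS n x y : p n.+1 x y = (\sum_(z <- N x) p n z y) / (deg G x)%:R.
Proof. by rewrite /walk_prob /= walk_stepE. Qed.

Lemma iter_walk_stepE n h x (S : {fset V}) : (forall y, gball G x n y -> y \in S) ->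
  iter n ws h x = \sum_(y <- S) p n x y * h y.
Proof.
elim: n x => [|n IH] x xS.
  rewrite (big_fsetD1 x)/=; last exact: xS.
  rewrite /walk_prob /= eqxx mul1r big_seq big1 ?addr0// => y.
  by rewrite in_fsetD1 eq_sym => /andP[/negbTE -> _]; rewrite mul0r.
rewrite iterS walk_stepE; under [RHS]eq_bigr do rewrite walk_probS mulrAC.
rewrite -mulr_suml; congr (_ / _).
under [RHS]eq_bigr do rewrite mulr_suml; rewrite exchange_big /=.
rewrite !big_seq; apply: eq_bigr => z; rewrite mem_N => xz.
by apply: IH => y zy; apply: xS; exact: gball_nbrs zy.
Qed.

Lemma walk_probD n m x z (S : {fset V}) : (forall y, gball G x n y -> y \in S) ->
  p (n + m) x z = \sum_(y <- S) p n x y * p m y z.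
Proof.
by move=> xS; rewrite {1}/walk_prob iterD (iter_walk_stepE _ xS).
Qed.

Lemma gball_fset x n : exists S : {fset V}, forall y, gball G x n y -> y \in S.
Proof.
exists (fset_set (gball G x n)) => y yn; rewrite in_fset_set; first exact: mem_set.
exact: gball_finite G_deg.
Qed.

Lemma walk_prob_mul_le n m x y z : p n x y * p m y z <= p (n + m) x z.
Proof.
have [S xS] := gball_fset x n.
have xS' u : gball G x n u -> u \in (y |` S)%fset by move=> /xS uS; rewrite in_fset1U uS orbT.
rewrite (walk_probD m z xS') (big_fsetD1 y)/=; last by rewrite in_fset1U eqxx.
by rewrite lerDl sumr_ge0// => u _; rewrite mulr_ge0// walk_prob_ge0.
Qed.

Lemma walk_prob1 x y : p 1%N x y = (G x y)%:R / (deg G x)%:R.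
Proof.
rewrite walk_probS; congr (_ / _).
under eq_bigr do rewrite /walk_prob /=.
have [xy|xy] := boolP (G x y).
  rewrite (big_fsetD1 y)/= ?mem_N// eqxx big_seq big1 ?addr0// => z.
  by rewrite in_fsetD1 => /andP[/negbTE -> _].
rewrite big_seq big1// => z; rewrite mem_N => xz.
by case: eqP xz xy => // -> ->.
Qed.

Lemma walk_prob_rev n x y : (deg G x)%:R * p n x y = (deg G y)%:R * p n y x.
Proof.
elim: n x y => [|n IH] x y.
  by rewrite /walk_prob /= eq_sym; case: eqP => [->//|]; rewrite !mulr0.
rewrite walk_probS mulrC divfK ?gt_eqF//.
have [S0 yS0] := gball_fset y n.
have yS u : gball G y n u -> u \in (S0 `|` N x)%fset by move=> /yS0 uS; rewrite inE uS.
rewrite -addn1 (walk_probD 1%N x yS) mulr_sumr.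
rewrite [RHS](bigID (fun u => u \in N x)) /= [RHS]addrC [X in _ = X + _]big1 ?add0r; last first.
  by move=> u; rewrite mem_N adj_sym walk_prob1 => /negbTE ->; rewrite mul0r !mulr0.
rewrite [RHS]big_fset_condE.
rewrite (_ : [fset i in S0 `|` N x | i \in N x]%fset = N x); last first.
  by apply/fsetP => u; rewrite !inE /=; case: (u \in N x); rewrite ?orbT ?andbF.
rewrite [LHS]big_seq [RHS]big_seq; apply: eq_bigr => u; rewrite mem_N => xu.
rewrite walk_prob1 adj_sym xu mulrA -IH mul1r mulrAC mulfV ?mul1r// gt_eqF//.
Qed.

Let degD x : (deg G x)%:R <= D%:R :> R.
Proof.
by rewrite ler_nat /deg /set_size; exact: geq_card_fset_set.
Qed.

Lemma walk_prob1_ge x y : G x y -> D%:R^-1 <= p 1%N x y.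
Proof.
move=> xy; rewrite walk_prob1 xy div1r.
have D0 : 0 < D%:R :> R by apply: lt_le_trans (degR0 x) (degD x).
by rewrite lef_pV2 ?posrE ?degR0 ?degD.
Qed.

Lemma walk_prob_gball k x y : gball G x k y ->
  exists2 j, (j <= k)%N & D%:R^-1 ^+ j <= p j x y.
Proof.
elim: k y => [|k IH] y /=.
  by move=> ->; exists 0%N => //; rewrite expr0 /walk_prob /= eqxx.
move=> [/IH[j jk h]|[z /IH[j jk h] zy]]; first by exists j => //; exact: leqW.
exists j.+1 => //; rewrite -addn1; apply: le_trans (walk_prob_mul_le _ _ _ z _).
rewrite exprD expr1; have D0 : 0 <= D%:R^-1 :> R by rewrite invr_ge0.
by apply: ler_pM => //; exact: walk_prob1_ge.
Qed.

(** Walking from a to x, then back to x, then to b is one way to go from a to b, so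
the decay for one pair of vertices gives the decay of the returns to any x. *)
Lemma return_decay : non_amenable R G -> exists2 s : R, 0 < s < 1 &
  forall x, exists2 C : R, 0 <= C & forall n, p n x x <= C * s ^+ n.
Proof.
move=> /non_amenable_decay[s [C [s01 C0 [a [b abC]]]]]; exists s => // x.
have /andP[s0 s1] := s01.
have D0 : 0 < D%:R :> R by apply: lt_le_trans (degR0 x) (degD x).
have [k1 ax] := connected_gball a x G_conn.
have [k2 xb] := connected_gball x b G_conn.
have [i _ hi] := walk_prob_gball ax.
have [j _ hj] := walk_prob_gball xb.
have pi : 0 < p i a x by apply: lt_le_trans hi; rewrite exprn_gt0// invr_gt0.
have pj : 0 < p j x b by apply: lt_le_trans hj; rewrite exprn_gt0// invr_gt0.
exists (C / (p i a x * p j x b)); first by rewrite divr_ge0// ltW// mulr_gt0.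
move=> n; rewrite mulrAC ler_pdivlMr; last by rewrite mulr_gt0.
apply: (@le_trans _ _ (p (i + (n + j)) a b)).
  apply: le_trans (walk_prob_mul_le i (n + j) a x b).
  rewrite mulrCA; apply: ler_wpM2l; first exact: ltW.
  exact: walk_prob_mul_le.
apply: le_trans (abC _) _; rewrite ler_wpM2l//.
by apply: ler_wiXn2l; rewrite ?(ltW s0) ?(ltW s1)// addnCA leq_addr.
Qed.

(** When the ends u and v of two n-step walks from x are within distance k, a walk
of some length j <= k from u to v, followed by the second walk reversed, closes
the first one into a loop at x. Such a connecting walk has probability at least
D^-j, which accounts for the factor D^k; reversing the second walk costs at
most the ratio of two degrees, hence the last factor D. *)
Lemma walk_prob_pair_sum k x : exists2 K : R, 0 <= K & forall n (S : {fset V}),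
  (forall y, gball G x (n + k) y -> y \in S) ->
  \sum_(u <- S) \sum_(v <- S) p n x u * p n x v * (`[< gball G u k v >])%:R
    <= K * \sum_(j < k.+1) p (n + (j + n)) x x.
Proof.
have D0 : 0 < D%:R :> R by apply: lt_le_trans (degR0 x) (degD x).
have D1 : 1 <= D%:R :> R by rewrite ler1n -(ltr_nat R).
exists (D%:R ^+ k * D%:R); first by rewrite mulr_ge0// exprn_ge0// ltW.
move=> m S xS.
have bnd u v : (`[< gball G u k v >])%:R <= D%:R ^+ k * \sum_(j < k.+1) p j u v :> R.
  have s0 : 0 <= \sum_(j < k.+1) p j u v by apply: sumr_ge0 => j _; exact: walk_prob_ge0.
  case: asboolP => [/walk_prob_gball[j jk h]|_]; last by rewrite mulr_ge0// exprn_ge0// ltW.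
  rewrite (bigD1 (Ordinal (jk : j < k.+1)%N))//= mulrDr -[leLHS]addr0 lerD//.
    apply: (@le_trans _ _ (D%:R ^+ k * D%:R^-1 ^+ j)); last by rewrite ler_wpM2l// exprn_ge0// ltW.
    by rewrite exprVn ler_pdivlMr ?exprn_gt0// mul1r ler_weXn2l.
  by rewrite mulr_ge0 ?exprn_ge0 ?(ltW D0)// sumr_ge0// => i _; exact: walk_prob_ge0.
have rev v : p m x v <= D%:R * p m v x.
  rewrite -(ler_pM2l (degR0 x)) walk_prob_rev.
  apply: (@le_trans _ _ (D%:R * p m v x)); first by rewrite ler_wpM2r// walk_prob_ge0.
  have d1 : 1 <= (deg G x)%:R :> R by rewrite ler1n lt0n.
  by rewrite ler_peMl// mulr_ge0 ?walk_prob_ge0// ltW.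
have gx i u : (i <= m + k)%N -> gball G x i u -> u \in S.
  by move=> im iu; apply: xS; exact: (gball_mono im).
apply: (@le_trans _ _ (\sum_(u <- S) \sum_(v <- S) \sum_(j < k.+1)
    D%:R ^+ k * D%:R * (p m x u * (p j u v * p m v x)))).
  apply: ler_sum => u _; apply: ler_sum => v _; rewrite -mulr_sumr.
  have p0 := walk_prob_ge0 m x u; have p1 := walk_prob_ge0 m x v.
  apply: (@le_trans _ _ (p m x u * (D%:R * p m v x) * (D%:R ^+ k * \sum_(j < k.+1) p j u v))).
    apply: ler_pM => //; first by rewrite mulr_ge0.
    by rewrite ler_wpM2l.
  rewrite -mulr_sumr -mulr_suml le_eqVlt; apply/orP; left; apply/eqP; ring.
have pair j : (j <= k)%N -> \sum_(u <- S) \sum_(v <- S) p m x u * (p j u v * p m v x) = p (m + (j + m)) x x.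
  move=> jk; rewrite addnA (@walk_probD (m + j) m x x S); last first.
    by move=> y; apply: gx; rewrite leq_add2l.
  rewrite exchange_big /=; apply: eq_bigr => v _.
  rewrite (@walk_probD m j x v S); last by move=> y; apply: gx; exact: leq_addr.
  by rewrite mulr_suml; apply: eq_bigr => u _; rewrite mulrA.
under eq_bigr do rewrite exchange_big /=; rewrite exchange_big /= mulr_sumr.
apply: ler_sum => j _; rewrite -(pair j); last by rewrite -ltnS.
rewrite mulr_sumr; apply: ler_sum => u _.
by rewrite mulr_sumr.
Qed.

End walk.

(** * Mass transport *)

Section automorphisms.
Variables (V : choiceType) (G : sgraph V).

Lemma graph_aut_id : graph_aut G id.
Proof. by split => //; exists id. Qed.

Lemma graph_aut_comp g h : graph_aut G g -> graph_aut G h -> graph_aut G (g \o h).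
Proof.
by move=> [gb gG] [hb hG]; split => [|x y /=]; [exact: bij_comp|rewrite gG hG].
Qed.

Lemma graph_aut_inv g : graph_aut G g ->
  exists2 g', graph_aut G g' & cancel g g' /\ cancel g' g.
Proof.
move=> [[g' gK g'K] gG]; exists g' => //; split; first by exists g.
by move=> x y; rewrite -gG !g'K.
Qed.

Lemma graph_aut_inj g : graph_aut G g -> injective g.
Proof. by move=> [gb _]; exact: bij_inj. Qed.

Lemma aut_orbit_refl x : aut_orbit G x x.
Proof. by exists id; [exact: graph_aut_id|]. Qed.

Lemma aut_orbit_sym x y : aut_orbit G x y -> aut_orbit G y x.
Proof.
by move=> [g /graph_aut_inv[g' ag' [gK g'K]] <-]; exists g'.
Qed.

Lemma aut_orbit_trans x y z : aut_orbit G x y -> aut_orbit G y z -> aut_orbit G x z.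
Proof.
move=> [g ag <-] [h ah <-]; exists (h \o g) => //; exact: graph_aut_comp.
Qed.

Definition stab_orbit x y : set V := [set g y | g in stab G x].

Lemma stab_orbit_nbrs x y : G x y -> stab_orbit x y `<=` nbrs G x.
Proof. by move=> xy _ [g [[gb gG] gx] <-]; rewrite /nbrs /= -[X in G X]gx gG. Qed.

Lemma stab_orbit_aut g x y : graph_aut G g ->
  stab_orbit (g x) (g y) = g @` stab_orbit x y.
Proof.
move=> ag; have [g' ag' [gK g'K]] := graph_aut_inv ag.
apply/seteqP; split=> [_ [k [ak kx] <-]|_ [_ [k [ak kx] <-] <-]].
  exists (g' (k (g y))); last exact: g'K.
  exists (g' \o k \o g) => //; split; last by rewrite /= kx gK.
  by apply: graph_aut_comp => //; exact: graph_aut_comp.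
exists (g \o k \o g'); last by rewrite /= gK.
split; last by rewrite /= gK kx.
by apply: graph_aut_comp => //; exact: graph_aut_comp.
Qed.

End automorphisms.

Section mass_transport.
Context (R : realType) (V : countType) (G : sgraph V) (D : nat).
Hypothesis G_deg : degrees_le G D.
Variables (t : nat) (o : 'I_t -> V) (mu : V -> {posnum R}).
Hypothesis o_reps : orbit_representatives G o.
Hypothesis mu_mod : modular_function G mu.
Hypothesis mu_orbit : forall x y, aut_orbit G x y -> mu x = mu y.

Local Notation N x := (fset_set (nbrs G x)).
Let N_fin := nbrs_finite G_deg.

Local Notation a x y := ((set_size (stab_orbit G x y))%:R : R).

Let fin_stab x y : G x y -> finite_set (stab_orbit G x y).
Proof. by move=> xy; apply: sub_finite_set (stab_orbit_nbrs xy) (N_fin x). Qed.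

Let a_gt0 x y : G x y -> 0 < a x y.
Proof.
move=> xy; rewrite ltr0n /set_size cardfs_gt0; apply/fset0Pn; exists y.
rewrite in_fset_set; last exact: fin_stab.
apply/mem_set; exists id => //; split; last by [].
exact: graph_aut_id.
Qed.

Let a_aut g x y : graph_aut G g -> G x y -> a (g x) (g y) = a x y.
Proof.
move=> ag xy; rewrite stab_orbit_aut// /set_size fset_set_image; last exact: fin_stab.
by rewrite card_in_imfset//= => u v _ _; exact: (graph_aut_inj ag).
Qed.

(** Equivalence under automorphisms of an edge leaving a representative, from [o i]
to [v], and an edge entering a representative, from [u] to [o j]. *)
Let sim (i : 'I_t) (v : V) (j : 'I_t) (u : V) : Prop :=
  exists2 g, graph_aut G g & g (o i) = u /\ g v = o j.

Let sim_sym i v j u : sim i v j u -> sim j u i v.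
Proof.
move=> [g /graph_aut_inv[g' ag' [gK g'K]] [<- gv]]; exists g' => //.
by rewrite gK -gv gK.
Qed.

(** Moving v to its representative [o j], the edges equivalent to the one from [o i]
to v are those from the images of [o i] under the stabiliser of v. *)
Let sim_count i v : G (o i) v ->
  \sum_(j < t) \sum_(u <- N (o j)) (`[< sim i v j u >])%:R = a v (o i).
Proof.
move=> iv; have [j [jv juniq]] := o_reps v.
have vi : G v (o i) by rewrite adj_sym.
have [g0 ag0 g0v] := aut_orbit_sym jv.
rewrite (bigD1 j)//= [X in _ + X]big1 ?addr0; last first.
  move=> k kj; rewrite big1_seq// => u _; case: asboolP => // -[g ag [_ gv]].
  have [g' ag' [gK g'K]] := graph_aut_inv ag.
  exfalso; move/eqP: kj; apply; apply/esym/juniq; exists g' => //.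
  by rewrite -gv gK.
transitivity (\sum_(u <- fset_set (g0 @` stab_orbit G v (o i))) (1 : R)); last first.
  rewrite sum_fset_set_image; [|by apply: fin_stab|by move=> x y _ _; exact: (graph_aut_inj ag0)].
  by rewrite big_const_seq count_predT iter_addr_0 /set_size.
transitivity (\sum_(u <- N (o j) | `[< sim i v j u >]) (1 : R)).
  by rewrite [RHS]big_mkcond /=; apply: eq_bigr => u _; case: asboolP.
rewrite [LHS]big_fset_condE; congr (\big[_/_]_(u <- enum_fset _) _); apply/fsetP => u.
rewrite !inE /= (in_fset_set (N_fin _)) in_fset_set; last by apply: finite_image; exact: fin_stab.
apply/andP/idP => [[_ /asboolP[g ag [gi gv]]]|].
  have [g' ag' [gK g'K]] := graph_aut_inv ag0.
  apply/mem_set; exists (g' u); last exact: g'K.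
  exists (g' \o g) => /=; last by rewrite gi.
  split; first exact: graph_aut_comp.
  by rewrite /= gv -g0v gK.
move=> /set_mem[_ [k [ak kv] <-] <-]; split.
  apply/mem_set; rewrite /nbrs /= -g0v; have [_ ->] := ag0.
  by rewrite -{1}kv; have [_ ->] := ak.
apply/asboolP; exists (g0 \o k); first exact: graph_aut_comp.
by rewrite /= kv g0v.
Qed.

(** Count in two ways the pairs of equivalent edges, the first one leaving and the
second one entering a representative. An edge from x to y of the first kind
occurs in |Stab y . x| pairs, and one of the second kind in |Stab x . y| pairs.
The modular function at x and y accounts for the ratio of these numbers, and
its constancy on orbits brings it back to the representatives. *)
Lemma mass_transport (h : V -> V -> R) :
  (forall g x y, graph_aut G g -> h (g x) (g y) = h x y) ->
  \sum_(i < t) (mu (o i))%:num^-1 * \sum_(v <- N (o i)) h (o i) v =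
  \sum_(i < t) (mu (o i))%:num^-1 * \sum_(v <- N (o i)) h v (o i).
Proof.
move=> hinv.
have memN := mem_nbrs G_deg.
transitivity (\sum_(i < t) \sum_(v <- N (o i)) \sum_(j < t) \sum_(u <- N (o j))
   (`[< sim i v j u >])%:R * ((mu (o i))%:num^-1 * h (o i) v / a v (o i))).
  apply: eq_bigr => i _; rewrite mulr_sumr !big_seq; apply: eq_bigr => v.
  rewrite memN => iv.
  under eq_bigr do rewrite -mulr_suml; rewrite -mulr_suml sim_count//.
  by rewrite [RHS]mulrC divfK// gt_eqF// a_gt0// adj_sym.
transitivity (\sum_(j < t) \sum_(u <- N (o j)) \sum_(i < t) \sum_(v <- N (o i))
   (`[< sim j u i v >])%:R * ((mu (o j))%:num^-1 * h u (o j) / a u (o j))); last first.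
  apply: eq_bigr => i _; rewrite mulr_sumr !big_seq; apply: eq_bigr => v.
  rewrite memN => iv.
  under eq_bigr do rewrite -mulr_suml; rewrite -mulr_suml sim_count//.
  by rewrite [LHS]mulrC divfK// gt_eqF// a_gt0// adj_sym.
rewrite [RHS](eq_bigr (fun j => \sum_(i < t) \sum_(u <- N (o j)) \sum_(v <- N (o i))
   (`[< sim j u i v >])%:R * ((mu (o j))%:num^-1 * h u (o j) / a u (o j)))); last first.
  by move=> j _; rewrite exchange_big.
rewrite [RHS]exchange_big /=; apply: eq_bigr => i _.
rewrite [LHS]exchange_big /=; apply: eq_bigr => j _.
rewrite [RHS]exchange_big /= !big_seq; apply: eq_bigr => v; rewrite memN => iv.
rewrite !big_seq; apply: eq_bigr => u; rewrite memN => ju.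
case: asboolP => [sij|nsij]; last first.
  rewrite mul0r; case: asboolP => [/sim_sym //|]; last by rewrite mul0r.
case: asboolP => [_|nsji]; last by exfalso; apply: nsji; exact: sim_sym.
rewrite !mul1r; have [g ag [gi gv]] := sij.
have hE : h u (o j) = h (o i) v by rewrite -gi -gv hinv.
rewrite hE.
have muv : mu v = mu (o j) by apply: mu_orbit; exists g.
have auj : a u (o j) = a (o i) v by rewrite -gi -gv a_aut.
have := mu_mod (o i) v; rewrite -/(stab_orbit G (o i) v) -/(stab_orbit G v (o i)).
rewrite muv => E; rewrite auj {auj}.
have ai : 0 < a (o i) v by exact: a_gt0.
have av : 0 < a v (o i) by apply: a_gt0; rewrite adj_sym.
have m10 : 0 < (mu (o i))%:num by exact: gt0.
have m20 : 0 < (mu (o j))%:num by exact: gt0.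
move: E m10 m20; set m1 := (mu (o i))%:num; set m2 := (mu (o j))%:num; set a1 := a (o i) v; set a2 := a v (o i).
move=> E m10 m20; have E' : m1 * a2 = a1 * m2.
  have /(congr1 (fun q => q * (m2 * a2))) := E.
  rewrite mulrA divfK ?gt_eqF// => ->.
  by rewrite [m2 * _]mulrC mulrA divfK ?gt_eqF.
rewrite mulrAC [RHS]mulrAC; congr (_ * _); rewrite -!invfM; congr (_^-1).
by rewrite E' mulrC.
Qed.

End mass_transport.

(** * The Markov operator on real functions *)

Lemma ge0_integral_mixture d (T : measurableType d) (R : realType) (N : nat)
    (c : 'I_N -> R) (m_ : 'I_N -> {measure set T -> \bar R})
    (nu : {measure set T -> \bar R}) (f : T -> \bar R) :
  (forall i, 0 <= c i) ->
  (forall A, measurable A -> nu A = \sum_(i < N) (c i)%:E * m_ i A)%E ->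
  measurable_fun setT f -> (forall x, (0 <= f x)%E) ->
  (\int[nu]_x f x = \sum_(i < N) (c i)%:E * \int[m_ i]_x f x)%E.
Proof.
move=> c0 nuE mf f0.
pose M (n : nat) : {measure set T -> \bar R} :=
  if insub n is Some i then mscale (NngNum (c0 i)) (m_ i) else mzero.
transitivity (\int[msum M N]_x f x)%E.
  apply: eq_measure_integral => A mA _; rewrite nuE// /msum.
  by apply: eq_bigr => i _; rewrite /M valK.
rewrite ge0_integral_measure_sum//; apply: eq_bigr => i _.
by rewrite /M valK ge0_integral_mscale.
Qed.

Lemma integrable_sum_seq d (T : measurableType d) (R : realType)
    (m : {measure set T -> \bar R}) (I : Type) (s : seq I) (h : I -> T -> R) :
  (forall i, m.-integrable setT (EFin \o h i)) ->
  m.-integrable setT (EFin \o (fun x => \sum_(i <- s) h i x)).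
Proof.
move=> ih; elim: s => [|i s IH].
  by rewrite (_ : EFin \o _ = cst 0%E); [exact: integrable0|apply/funext => x /=; rewrite big_nil].
pose hs x := \sum_(j <- s) h j x.
rewrite (_ : EFin \o _ = ((EFin \o h i) \+ (EFin \o hs))%E).
  exact: integrableD.
by apply/funext => x /=; rewrite big_cons EFinD.
Qed.

Lemma Rintegral_sum_seq d (T : measurableType d) (R : realType)
    (m : {measure set T -> \bar R}) (I : Type) (s : seq I) (h : I -> T -> R) :
  (forall i, m.-integrable setT (EFin \o h i)) ->
  \int[m]_x (\sum_(i <- s) h i x) = \sum_(i <- s) \int[m]_x h i x.
Proof.
move=> ih; elim: s => [|i s IH].
  by under eq_Rintegral do rewrite big_nil; rewrite big_nil /Rintegral integral0.
rewrite big_cons -IH -RintegralD//; last exact: integrable_sum_seq.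
by apply: eq_Rintegral => x _; rewrite big_cons.
Qed.

Lemma sqint_sum_seq d (T : measurableType d) (R : realType)
    (m : {measure set T -> \bar R}) (I : Type) (s : seq I) (h : I -> T -> R) :
  (forall i, sqint m (h i)) -> sqint m (fun x => \sum_(i <- s) h i x).
Proof.
move=> sh; elim: s => [|i s IH].
  by under eq_fun do rewrite big_nil; exact: sqint0.
by under eq_fun do rewrite big_cons; exact: sqintD.
Qed.

Section bernoulli_graphing.
Context (R : realType) (V : countType) (G : sgraph V) (D : nat).
Hypotheses (G_conn : connected_graph G) (G_deg : degrees_le G D).
Variables (t : nat) (o : 'I_t -> V) (mu : V -> {posnum R}).
Hypothesis o_reps : orbit_representatives G o.
Hypothesis mu_mod : modular_function G mu.
Hypothesis mu_orbit : forall x y, aut_orbit G x y -> mu x = mu y.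
Hypothesis deg0 : forall x, deg G x != 0%N.
Variable v0 : V.
Variable L : probability (labeling R V) R.
Hypothesis L_unif : iid_uniform L.

Local Notation rc := (@rooted_class R V G D G_conn G_deg).
Local Notation nu := (bernoulli_measure G_conn G_deg o mu L).
Local Notation nu_st := (degree_biased nu).
Local Notation N x := (fset_set (nbrs G x)).
Local Notation lab := (labeling R V).
Local Notation Om := (Omega R D).

Let w_ i : R := orbit_weight o mu i.

Definition deg_mass : R := \sum_(i < t) w_ i * (deg G (o i))%:R.

(** The mass that the degree-biased measure gives to the orbit of [o i], and the
stationary distribution of the chain on the orbits. *)
Definition st_weight i : R := w_ i * (deg G (o i))%:R / deg_mass.

Lemma sum_inv_mu_gt0 : 0 < \sum_(j < t) (mu (o j))%:num^-1.
Proof.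
have [i _] := o_reps v0.
rewrite (bigD1 i)//=; apply: ltr_pwDl; first by rewrite invr_gt0.
by apply: sumr_ge0 => j _; rewrite invr_ge0.
Qed.

Let w_gt0 i : 0 < w_ i.
Proof. by rewrite /w_ /orbit_weight divr_gt0// ?invr_gt0// sum_inv_mu_gt0. Qed.

Let degR0 x : 0 < (deg G x)%:R :> R.
Proof. by rewrite ltr0n lt0n. Qed.

Lemma deg_mass_gt0 : 0 < deg_mass.
Proof.
have [i _] := o_reps v0.
rewrite /deg_mass (bigD1 i)//=; apply: ltr_pwDl; first by rewrite mulr_gt0.
by apply: sumr_ge0 => j _; rewrite mulr_ge0 ?ltW.
Qed.

Lemma st_weight_gt0 i : 0 < st_weight i.
Proof. by apply: divr_gt0; [exact: mulr_gt0|exact: deg_mass_gt0]. Qed.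

Lemma sum_st_weight : \sum_(i < t) st_weight i = 1.
Proof. by rewrite /st_weight -mulr_suml divff// gt_eqF// deg_mass_gt0. Qed.

Let mrc v : measurable_fun setT (rc v).
Proof. exact: measurable_rooted_class. Qed.

Let pf i := measure_function_pushforward__canonical__measure_function_Measure L (mrc (o i)).

Lemma ge0_integral_nu (f : Om -> \bar R) : measurable_fun setT f ->
  (forall x, (0 <= f x)%E) ->
  (\int[nu]_x f x = \sum_(i < t) (w_ i)%:E * \int[L]_w f (rc (o i) w))%E.
Proof.
move=> mf f0; rewrite (@ge0_integral_mixture _ _ _ t w_ pf)//.
- apply: eq_bigr => i _; congr (_ * _)%E.
  by rewrite /pf /= (ge0_integral_pushforward (mrc (o i)) L measurableT mf (fun y _ => f0 y)) preimage_setT.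
- by move=> i; exact: ltW.
Qed.

Let mdeg : measurable_fun setT (fun x : Om => (root_deg x)%:R%:E : \bar R).
Proof. apply/measurable_EFinP; exact: measurable_root_deg. Qed.

Let int_deg A : measurable A ->
  (\int[nu]_(x in A) (root_deg x)%:R%:E =
   \sum_(i < t) (w_ i * (deg G (o i))%:R)%:E * pf i A)%E.
Proof.
move=> mA; rewrite integral_mkcond ge0_integral_nu; first last.
- by move=> x; rewrite /patch; case: ifP.
- apply/(measurable_restrictT _ mA); exact: measurable_funTS.
apply: eq_bigr => i _; rewrite (EFinM (w_ i)) -muleA; congr (_ * _)%E.
rewrite /pf /= /pushforward.
have mi : measurable (rc (o i) @^-1` A) by rewrite -[X in measurable X]setTI; exact: mrc.
apply: etrans (integral_cst L mi (deg G (o i))%:R%:E); rewrite [RHS]integral_mkcond.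
apply: eq_integral => w _; rewrite /patch.
rewrite (_ : (w \in _) = (rc (o i) w \in A)); last by apply/idP/idP => /set_mem ?; exact/mem_set.
by case: ifP => // _; rewrite root_deg_rc.
Qed.

Lemma nu_stE A : measurable A ->
  nu_st A = (\sum_(i < t) (st_weight i)%:E * L (rc (o i) @^-1` A))%E.
Proof.
move=> mA; rewrite /degree_biased int_deg//.
have -> : fine (\int[nu]_x (root_deg x)%:R%:E)%E = deg_mass.
  rewrite int_deg// /deg_mass (_ : (\sum_(i < t) _)%E = (\sum_(i < t) w_ i * (deg G (o i))%:R)%:E)//.
  rewrite -sumEFin; apply: eq_bigr => i _.
  by rewrite /pf /= /pushforward preimage_setT probability_setT mule1.
rewrite ge0_sume_distrl; last first.
  by move=> i _; rewrite mule_ge0// lee_fin mulr_ge0// ltW.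
apply: eq_bigr => i _; rewrite muleAC -EFinM.
by rewrite /pf /= /pushforward.
Qed.

Lemma ge0_integral_nu_st (f : Om -> \bar R) : measurable_fun setT f ->
  (forall x, (0 <= f x)%E) ->
  (\int[nu_st]_x f x = \sum_(i < t) (st_weight i)%:E * \int[L]_w f (rc (o i) w))%E.
Proof.
move=> mf f0; rewrite (@ge0_integral_mixture _ _ _ t st_weight pf)//.
- apply: eq_bigr => i _; congr (_ * _)%E.
  by rewrite /pf /= (ge0_integral_pushforward (mrc (o i)) L measurableT mf (fun y _ => f0 y)) preimage_setT.
- by move=> i; exact/ltW/st_weight_gt0.
- by move=> A mA; exact: (nu_stE mA).
Qed.

Lemma nu_st_fin : (nu_st setT < +oo)%E.
Proof.
rewrite (_ : nu_st setT = 1%E) ?ltry//; apply: (etrans (nu_stE measurableT)).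
under eq_bigr do rewrite preimage_setT probability_setT mule1.
by rewrite sumEFin sum_st_weight.
Qed.

Local Notation F f v := (fun w : lab => f (rc v w)).

Lemma measurable_lift d (T : measurableType d) (f : Om -> T) v : measurable_fun setT f ->
  measurable_fun setT (F f v).
Proof. by move=> mf; exact: measurableT_comp. Qed.

Lemma integral_lift_aut (f : Om -> \bar R) g v : measurable_fun setT f -> graph_aut G g ->
  (\int[L]_w f (rc (g v) w) = \int[L]_w f (rc v w))%E.
Proof.
move=> mf ag.
rewrite [RHS](integral_measure_preserving (measurable_relabel g) (relabel_preserving L_unif ag.1)).
  by apply: eq_integral => w _; rewrite rc_aut.
exact: measurable_lift.
Qed.

(** Finiteness on the representatives propagates to all vertices, the law of a lift
being constant on orbits. *)
Lemma integral_nu_st_lty (f : Om -> \bar R) : measurable_fun setT f ->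
  (forall x, (0 <= f x)%E) ->
  (\int[nu_st]_x f x < +oo)%E <-> forall v, (\int[L]_w f (rc v w) < +oo)%E.
Proof.
move=> mf f0; rewrite ge0_integral_nu_st//; split=> [foo v|foo].
  have [i [[g ag <-] _]] := o_reps v.
  rewrite (integral_lift_aut (o i) mf ag).
  have ge0 j : (0 <= (st_weight j)%:E * \int[L]_w f (rc (o j) w))%E.
    by rewrite mule_ge0 ?integral_ge0// lee_fin ltW// st_weight_gt0.
  have : ((st_weight i)%:E * \int[L]_w f (rc (o i) w) < +oo)%E.
    apply: le_lt_trans foo; rewrite (bigD1 i)//= leeDl// sume_ge0//.
  rewrite !ltey; apply: contra_neq => ->.
  by rewrite gt0_muley// lte_fin st_weight_gt0.
apply: lte_sum_pinfty => i _.
by rewrite lte_mul_pinfty// ?lee_fin ?(ltW (st_weight_gt0 i)).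
Qed.

Lemma sqint_lift (f : Om -> R) : sqint nu_st f -> forall v, sqint L (F f v).
Proof.
move=> [mf foo] v; split; first exact: measurable_lift.
apply: (integral_nu_st_lty (f := fun x => (f x ^+ 2)%:E) _ _).1 => //.
  by apply/measurable_EFinP; exact: measurable_funX.
by move=> x; rewrite lee_fin sqr_ge0.
Qed.

Lemma sqint_of_lift (f : Om -> R) : measurable_fun setT f ->
  (forall v, sqint L (F f v)) -> sqint nu_st f.
Proof.
move=> mf sf; split => //.
apply: (integral_nu_st_lty (f := fun x => (f x ^+ 2)%:E) _ _).2 => //.
- by apply/measurable_EFinP; exact: measurable_funX.
- by move=> x; rewrite lee_fin sqr_ge0.
- by move=> v; case: (sf v).
Qed.

Lemma integrable_lift (f : Om -> R) : nu_st.-integrable setT (EFin \o f) ->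
  forall v, L.-integrable setT (EFin \o (F f v)).
Proof.
move=> /integrableP[/measurable_EFinP mf foo] v; apply/integrableP; split.
  by apply/measurable_EFinP; exact: measurable_lift.
apply: (integral_nu_st_lty (f := fun x => `|(f x)%:E|%E) _ _).1 => //.
by apply: measurableT_comp => //; exact/measurable_EFinP.
Qed.

Lemma Rintegral_nu_st (f : Om -> R) : nu_st.-integrable setT (EFin \o f) ->
  \int[nu_st]_x f x = \sum_(i < t) st_weight i * \int[L]_w f (rc (o i) w).
Proof.
move=> intf; have mf : measurable_fun setT (EFin \o f) by exact: measurable_int intf.
have iL i := integrable_lift intf (o i).
rewrite /Rintegral integralE ge0_integral_nu_st ?(ge0_integral_nu_st (f := (EFin \o f)^\-%E)) //; last 2 first.
- exact: measurable_funeneg.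
- exact: measurable_funepos.
have dot i : (\int[L]_w (EFin \o f)^\+ (rc (o i) w))%E \is a fin_num.
  have := integrable_fin_num measurableT (integrable_funepos measurableT (iL i)).
  by congr (_ \is a fin_num); apply: eq_integral => w _; rewrite !funeposE.
have im i : (\int[L]_w (EFin \o f)^\- (rc (o i) w))%E \is a fin_num.
  have := integrable_fin_num measurableT (integrable_funeneg measurableT (iL i)).
  by congr (_ \is a fin_num); apply: eq_integral => w _; rewrite !funenegE.
under eq_bigr do rewrite -(fineK (dot _)) -EFinM.
under [X in fine (_ - X)]eq_bigr do rewrite -(fineK (im _)) -EFinM.
rewrite !sumEFin -EFinB /= -sumrB; apply: eq_bigr => i _; rewrite -mulrBr; congr (_ * _).
rewrite -fineB//; congr fine; rewrite [RHS]integralE; congr (_ - _)%E.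
  by apply: eq_integral => w _; rewrite !funeposE.
by apply: eq_integral => w _; rewrite !funenegE.
Qed.

Lemma dot_nu_st (f g : Om -> R) : sqint nu_st f -> sqint nu_st g ->
  dot nu_st f g = \sum_(i < t) st_weight i * dot L (F f (o i)) (F g (o i)).
Proof. by move=> sf sg; rewrite /dot Rintegral_nu_st//; exact: sqintM_integrable. Qed.

Lemma nrm2_nu_st (f : Om -> R) : sqint nu_st f ->
  nrm2 nu_st f = \sum_(i < t) st_weight i * nrm2 L (F f (o i)).
Proof. by move=> sf; rewrite /nrm2 dot_nu_st. Qed.

Definition real_markov (f : Om -> R) (x : Om) : R := nbr_sum f x / (root_deg x)%:R.

Lemma real_markov_lin a f g :
  real_markov (fun x => a * f x + g x) = (fun x => a * real_markov f x + real_markov g x).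
Proof.
apply/funext => x; rewrite /real_markov mulrA -mulrDl; congr (_ / _).
by rewrite /nbr_sum big_split /= mulr_sumr.
Qed.

(** This is how the random walk on G enters the study of the graphing. *)
Lemma real_markov_rc f v w :
  real_markov f (rc v w) = walk_step G (fun u => f (rc u w)) v.
Proof. by rewrite /real_markov nbr_sum_rc root_deg_rc /walk_step (negbTE (deg0 v)). Qed.

Lemma lift_real_markov f v : (fun w => real_markov f (rc v w)) =
  (fun w => walk_step G (fun u => f (rc u w)) v).
Proof. by apply/funext => w; rewrite real_markov_rc. Qed.

Lemma iter_real_markov_rc n f v w :
  iter n real_markov f (rc v w) = iter n (@walk_step R V G) (fun u => f (rc u w)) v.
Proof.
elim: n v => //= n IH v; rewrite real_markov_rc; congr (walk_step G _ v).
by apply/funext.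
Qed.

Lemma measurable_real_markov f : measurable_fun setT f ->
  measurable_fun setT (real_markov f).
Proof.
move=> mf; apply: measurable_funM; first exact: measurable_nbr_sum.
rewrite (_ : (fun x => _) = (fun x : Om => (root_deg x)%:R `^ (-1) : R)).
  apply: (measurableT_comp (measurable_powR _)); exact: measurable_root_deg.
by apply/funext => x; rewrite powR_inv1.
Qed.

Lemma dot_lift_aut (f g : Om -> R) h x y : measurable_fun setT f -> measurable_fun setT g ->
  graph_aut G h -> dot L (F f (h y)) (F g (h x)) = dot L (F f y) (F g x).
Proof.
move=> mf mg ah; rewrite /dot.
rewrite [RHS](Rintegral_measure_preserving (measurable_relabel h) (relabel_preserving L_unif ah.1)).
  by apply: eq_Rintegral => w _; rewrite !rc_aut.
by apply: measurable_funM; exact: measurable_lift.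
Qed.

Let transport (h : V -> V -> R) :
  (forall g x y, graph_aut G g -> h (g x) (g y) = h x y) ->
  \sum_(i < t) st_weight i * ((\sum_(v <- N (o i)) h (o i) v) / (deg G (o i))%:R) =
  \sum_(i < t) st_weight i * ((\sum_(v <- N (o i)) h v (o i)) / (deg G (o i))%:R).
Proof.
move=> /(mass_transport G_deg o_reps mu_mod mu_orbit) mt.
pose c := (\sum_(j < t) (mu (o j))%:num^-1)^-1 / deg_mass.
have E i (a : R) : st_weight i * (a / (deg G (o i))%:R) = c * ((mu (o i))%:num^-1 * a).
  have d := lt0r_neq0 (degR0 (o i)); have m := lt0r_neq0 deg_mass_gt0.
  rewrite /st_weight /w_ /orbit_weight /c.
  set S := \sum_(j < t) _; set dg := (deg G (o i))%:R in d *.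
  transitivity (S^-1 / deg_mass * ((mu (o i))%:num^-1 * a) * (dg / dg)); first ring.
  by rewrite divff// mulr1.
under eq_bigr do rewrite E; under [RHS]eq_bigr do rewrite E.
by rewrite -!mulr_sumr mt.
Qed.

Lemma sqint_walk_step (f : Om -> R) v : (forall u, sqint L (F f u)) ->
  sqint L (fun w => walk_step G (fun u => f (rc u w)) v).
Proof.
move=> sf; rewrite (_ : (fun w => _) = (fun w => (deg G v)%:R^-1 * \sum_(u <- N v) f (rc u w))).
  by apply: sqintZ; exact: sqint_sum_seq.
by apply/funext => w; rewrite /walk_step (negbTE (deg0 v)) mulrC.
Qed.

Lemma sqint_real_markov f : sqint nu_st f -> sqint nu_st (real_markov f).
Proof.
move=> sf; apply: sqint_of_lift; first by apply: measurable_real_markov; case: sf.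
move=> v; rewrite lift_real_markov.
by apply: sqint_walk_step => u; exact: sqint_lift.
Qed.

Lemma dot_walk_step (f : Om -> R) (g : lab -> R) v : (forall u, sqint L (F f u)) ->
  sqint L g -> dot L (fun w => walk_step G (fun u => f (rc u w)) v) g =
    (\sum_(u <- N v) dot L (F f u) g) / (deg G v)%:R.
Proof.
move=> sf sg; rewrite /dot -Rintegral_sum_seq; last by move=> u; exact: sqintM_integrable.
rewrite mulrC -RintegralZl//; last first.
  have -> : (fun x => \sum_(u <- N v) f (rc u x) * g x) = (fun x => (\sum_(u <- N v) f (rc u x)) * g x).
    by apply/funext => x; rewrite mulr_suml.
  by apply: sqintM_integrable => //; exact: sqint_sum_seq.
apply: eq_Rintegral => w _; rewrite /walk_step (negbTE (deg0 v)) -mulr_suml.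
by rewrite mulrAC mulrC.
Qed.

(** The degree in the weight of an orbit cancels the normalisation of the walk, so
the two inner products are sums over the edges leaving and over the edges
entering a representative, and mass transport identifies them. *)
Lemma real_markov_self_adjoint f g : sqint nu_st f -> sqint nu_st g ->
  dot nu_st (real_markov f) g = dot nu_st f (real_markov g).
Proof.
move=> sf sg; have sMf := sqint_real_markov sf; have sMg := sqint_real_markov sg.
have [mf _] := sf; have [mg _] := sg.
rewrite !dot_nu_st//.
rewrite (eq_bigr (fun i => st_weight i *
   ((\sum_(v <- N (o i)) dot L (F f v) (F g (o i))) / (deg G (o i))%:R))); last first.
  move=> i _; congr (_ * _); rewrite lift_real_markov.
  apply: dot_walk_step; [exact: sqint_lift|exact: sqint_lift].
rewrite [RHS](eq_bigr (fun i => st_weight i *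
   ((\sum_(v <- N (o i)) dot L (F f (o i)) (F g v)) / (deg G (o i))%:R))); last first.
  move=> i _; congr (_ * _); rewrite dotC; rewrite lift_real_markov.
  rewrite dot_walk_step; [|exact: sqint_lift|exact: sqint_lift].
  by congr (_ / _); apply: eq_bigr => v _; rewrite dotC.
apply: (transport (h := fun x y => dot L (F f y) (F g x))) => h x y ah.
exact: (dot_lift_aut x y mf mg ah).
Qed.

Lemma sum_sqr_le (I : eqType) (s : seq I) (a : I -> R) : (0 < size s)%N ->
  ((\sum_(i <- s) a i) / (size s)%:R) ^+ 2 <= (\sum_(i <- s) a i ^+ 2) / (size s)%:R.
Proof.
move=> s0; have n0 : 0 < (size s)%:R :> R by rewrite ltr0n.
set m := _ / _; rewrite ler_pdivlMr//.
have : 0 <= \sum_(i <- s) (a i - m) ^+ 2 by apply: sumr_ge0 => i _; exact: sqr_ge0.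
have -> : \sum_(i <- s) (a i - m) ^+ 2 =
    \sum_(i <- s) a i ^+ 2 - 2 * m * \sum_(i <- s) a i + (size s)%:R * m ^+ 2.
  rewrite mulr_sumr -sumrB -(_ : \sum_(i <- s) m ^+ 2 = (size s)%:R * m ^+ 2).
    by rewrite -big_split /=; apply: eq_bigr => i _; ring.
  by rewrite big_const_seq count_predT iter_addr_0 mulr_natl.
have -> : \sum_(i <- s) a i = m * (size s)%:R by rewrite /m divfK// gt_eqF.
nra.
Qed.

(** The square of a mean over the neighbours is at most the mean of the squares,
whose integral mass transport identifies with that of the square of f. *)
Lemma real_markov_contraction f : sqint nu_st f ->
  nrm nu_st (real_markov f) <= nrm nu_st f.
Proof.
move=> sf; rewrite /nrm ler_wsqrtr//.
have sMf := sqint_real_markov sf; have [mf _] := sf.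
have sF v := sqint_lift sf v.
rewrite !nrm2_nu_st//.
apply: (@le_trans _ _ (\sum_(i < t) st_weight i *
    ((\sum_(v <- N (o i)) nrm2 L (F f v)) / (deg G (o i))%:R))).
  apply: ler_sum => i _; rewrite ler_wpM2l//; first exact/ltW/st_weight_gt0.
  rewrite lift_real_markov.
  have sW := sqint_walk_step (o i) sF.
  rewrite /nrm2 {2}/dot -Rintegral_sum_seq; last by move=> u; exact: sqintM_integrable.
  have isum : L.-integrable setT (EFin \o (fun w => \sum_(v <- N (o i)) f (rc v w) * f (rc v w))).
    by apply: integrable_sum_seq => u; exact: sqintM_integrable.
  rewrite mulrC -RintegralZl//; apply: le_Rintegral => //.
  - exact: sqintM_integrable.
  - exact: (integrableZl measurableT (deg G (o i))%:R^-1 isum).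
  move=> w _; rewrite -expr2 /walk_step (negbTE (deg0 (o i))) [leRHS]mulrC.
  by apply: sum_sqr_le; rewrite lt0n; exact: deg0.
rewrite (transport (h := fun x y => nrm2 L (F f y))); last first.
  by move=> h x y ah; exact: (dot_lift_aut y y mf mf ah).
apply: ler_sum => i _; rewrite ler_wpM2l//; first exact/ltW/st_weight_gt0.
rewrite big_const_seq count_predT iter_addr_0 -[X in X / _]mulr_natr.
by rewrite mulfK ?gt_eqF// degR0.
Qed.

End bernoulli_graphing.

(** * Density of the bounded local functions *)

Lemma L2_dominated_cvg d (T : measurableType d) (R : realType)
    (m : {measure set T -> \bar R}) (h : nat -> T -> R) (f phi : T -> R) :
  (forall n, measurable_fun setT (h n)) -> measurable_fun setT f -> sqint m phi ->
  (forall x, h n x @[n --> \oo] --> f x) ->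
  (forall n x, `|f x - h n x| <= phi x) ->
  forall e, 0 < e -> exists n, nrm m (fun x => f x - h n x) < e.
Proof.
move=> mh mf sphi hf hphi e e0.
have mD n : measurable_fun setT (fun x => f x - h n x) by apply: measurable_funB.
have mD2 n : measurable_fun setT (EFin \o (fun x => (f x - h n x) ^+ 2)).
  by apply/measurable_EFinP; exact: measurable_funX.
have sD n : sqint m (fun x => f x - h n x).
  by apply: (sqint_dominated _ sphi) => // x; apply: le_trans (hphi n x) (ler_norm _).
have := @dominated_convergence _ _ _ m setT measurableT
  (fun n => EFin \o (fun x => (f x - h n x) ^+ 2)) (cst 0%E) (EFin \o (fun x => phi x ^+ 2)).
case.
- by move=> n; exact: mD2.
- exact: measurable_cst.
- apply: aeW => x _ /=; apply: cvg_EFin; first by near=> k.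
  have c : (fun n => f x - h n x) @ \oo --> f x - f x by apply: cvgB; [exact: cvg_cst|exact: hf].
  have c2 : (fun n => (f x - h n x) * (f x - h n x)) @ \oo --> (0 : R).
    by rewrite -[0](mulr0 (f x - f x)) -[X in _ * X](subrr (f x)); exact: (cvgM c c).
  exact: c2.
- exact: sqint_integrable.
- apply: aeW => x n _ /=; rewrite lee_fin ger0_norm ?sqr_ge0//.
  rewrite -[leLHS]real_normK ?num_real// ler_pXn2r// ?nnegrE//.
  exact: le_trans (hphi n x).
move=> _ _; rewrite integral0 => /fine_cvg /= c0.
have : (fun n => nrm2 m (fun x => f x - h n x)) @ \oo --> (0 : R).
  rewrite (_ : (fun n => _) = (fun n => fine (\int[m]_x ((f x - h n x) ^+ 2)%R%:E)%E)); first exact: c0.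
  by apply/funext => n; congr fine; apply: eq_integral => x _; rewrite /= expr2.
move=> /cvgrPdist_lt/(_ (e ^+ 2)) [|N _ /(_ N (leqnn N)) /=]; first exact: exprn_gt0.
rewrite sub0r normrN ger0_norm ?nrm2_ge0// => lt.
by exists N; rewrite -(ltr_pXn2r (ltn0Sn 1)) ?nnegrE ?nrm_ge0 ?(ltW e0)// nrm_sqr.
Unshelve. all: by end_near. Qed.

Lemma bounded_sqint d (T : measurableType d) (R : realType)
    (m : {measure set T -> \bar R}) (f : T -> R) (C : R) : (m setT < +oo)%E ->
  measurable_fun setT f -> (forall x, `|f x| <= C) -> sqint m f.
Proof.
move=> m_fin mf fC; apply: (@sqint_dominated _ _ _ _ _ (fun=> C)) => // [|x].
  split; first exact: measurable_cst.
  rewrite (_ : (\int[m]_x _)%E = (\int[m]_x (cst (C ^+ 2)%:E) x)%E)//.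
  by rewrite integral_cst// lte_mul_pinfty// lee_fin sqr_ge0.
exact: le_trans (fC x) (ler_norm C).
Qed.

Section density.
Context (R : realType) (V : countType) (G : sgraph V) (D : nat).
Hypotheses (G_conn : connected_graph G) (G_deg : degrees_le G D).
Local Notation rc := (@rooted_class R V G D G_conn G_deg).
Local Notation lab := (labeling R V).
Local Notation Om := (Omega R D).
Implicit Types f g h : Om -> R.

(** The radius does not depend on the vertex: lifts at vertices that are far apart
in G are then functions of disjoint sets of labels. *)
Definition local_fun f := exists r, forall v, depends_on (gball G v r) (fun w : lab => f (rc v w)).

Definition bounded_local f := [/\ measurable_fun setT f,
  exists C, forall x, `|f x| <= C & local_fun f].

Lemma local_fun2 f g (phi : R -> R -> R) : local_fun f -> local_fun g ->
  local_fun (fun x => phi (f x) (g x)).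
Proof.
move=> [r fr] [s gs]; exists (maxn r s) => v w w' ww'; congr phi.
  by apply: fr => u ur; apply: ww'; exact: (gball_mono (leq_maxl r s)).
by apply: gs => u us; apply: ww'; exact: (gball_mono (leq_maxr r s)).
Qed.

Lemma bounded_local_lin a f g : bounded_local f -> bounded_local g ->
  bounded_local (fun x => a * f x + g x).
Proof.
move=> [mf [C fC] lf] [mg [C' gC] lg]; split.
- by apply: measurable_funD => //; exact: measurable_funM.
- exists (`|a| * C + C') => x; apply: (le_trans (ler_normD _ _)); rewrite lerD// normrM.
  by rewrite ler_wpM2l.
- exact: (local_fun2 (fun u v => a * u + v) lf lg).
Qed.

Lemma bounded_local_cst a : bounded_local (fun=> a).
Proof.
split; first exact: measurable_cst; first by exists `|a|.
by exists 0%N => v w w' _.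
Qed.

Lemma bounded_local_indic (A : set Om) : measurable A -> local_fun (\1_A) ->
  bounded_local (\1_A).
Proof.
move=> mA lA; split => //; exists 1 => x.
by rewrite indicE ger0_norm ?ler0n// lern1 leq_b1.
Qed.

Let LS : set (set Om) := [set A | measurable A /\ local_fun (\1_A)].

Let local_ball_local x r e : 0 < e -> LS (local_ball x r e : set Om).
Proof.
move=> e0; split; first by apply: local_open_measurable; exact: local_ball_open.
exists r => v w w' ww'; rewrite !indicE; congr (nat_of_bool _)%:R.
have nearE (w1 : lab) : local_ball x r e (rc v w1) <->
    near_iso r e (rl_graph x) (rl_root x) (@rl_label _ _ x) G v w1.
  rewrite /rooted_class; split => [/local_ballP|] h.
    exact: near_iso_rl_iso h (rl_iso_sym (rooted_rlgraph_iso G_conn G_deg v w1)).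
  by apply/local_ballP; exact: near_iso_rl_iso h (rooted_rlgraph_iso G_conn G_deg v w1).
have imp (w1 w2 : lab) : (forall u, gball G v r u -> w1 u = w2 u) ->
    local_ball x r e (rc v w1) -> local_ball x r e (rc v w2).
  move=> w12 /nearE[f [fb fu fG fw]]; apply/nearE; exists f; split => // a ar.
  rewrite -w12; first exact: fw.
  by have [ff _ _] := fb; exact: ff.
apply/idP/idP => /set_mem h; apply/mem_set.
  exact: imp h.
by apply: imp h => u ur; rewrite ww'.
Qed.

Let LS_generate : @measurable _ Om = <<s LS >>.
Proof.
apply/seteqP; split=> B; apply: smallest_sub.
- exact: smallest_sigma_algebra.
- by move=> _ [x [r [e [e0 ->]]]]; apply: sub_sigma_algebra; exact: local_ball_local.
- exact: sigma_algebra_measurable.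
- by move=> A [].
Qed.

Variable m : {measure set Om -> \bar R}.
Hypothesis m_fin : (m setT < +oo)%E.

Lemma bounded_local_sqint f : bounded_local f -> sqint m f.
Proof. by move=> [mf [C fC] _]; exact: (bounded_sqint m_fin mf fC). Qed.

Let closure_ f := sqint m f /\
  forall e, 0 < e -> exists2 g, bounded_local g & nrm m (fun x => f x - g x) < e.

Let closure_local f : bounded_local f -> closure_ f.
Proof.
move=> lf; split; first exact: bounded_local_sqint.
by move=> e e0; exists f => //; under eq_fun do rewrite subrr; rewrite nrm0.
Qed.

Let nrmB f g h : sqint m f -> sqint m g -> sqint m h ->
  nrm m (fun x => f x - h x) <= nrm m (fun x => f x - g x) + nrm m (fun x => g x - h x).
Proof.
move=> sf sg sh; rewrite (_ : (fun x => f x - h x) = (fun x => (f x - g x) + (g x - h x))).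
  by apply: nrmD; exact: sqintB.
by apply/funext => x; rewrite subrKA.
Qed.

Let closure_closed f : sqint m f ->
  (forall e, 0 < e -> exists2 h, closure_ h & nrm m (fun x => f x - h x) < e) -> closure_ f.
Proof.
move=> sf fc; split => // e e0.
have e2 : 0 < e / 2 by rewrite divr_gt0.
have [h [sh hc] he] := fc _ e2; have [g lg ge] := hc _ e2.
exists g => //; apply: le_lt_trans (nrmB sf sh (bounded_local_sqint lg)) _.
by rewrite (splitr e) ltrD.
Qed.

Let closure_lin a f g : closure_ f -> closure_ g -> closure_ (fun x => a * f x + g x).
Proof.
move=> [sf fc] [sg gc]; split; first exact: sqint_lin.
move=> e e0; have a1 : 0 < `|a| + 1 by rewrite ltr_wpDl.
have [f' lf' fe] := fc (e / (2 * (`|a| + 1))) ltac:(by rewrite divr_gt0// mulr_gt0).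
have [g' lg' ge] := gc (e / 2) ltac:(by rewrite divr_gt0).
exists (fun x => a * f' x + g' x); first exact: bounded_local_lin.
rewrite (_ : (fun x => _) = (fun x => a * (f x - f' x) + (g x - g' x))); last first.
  by apply/funext => x; ring.
have sf' := bounded_local_sqint lf'; have sg' := bounded_local_sqint lg'.
have sff := sqintB sf sf'; have sgg := sqintB sg sg'.
apply: le_lt_trans (nrmD (sqintZ a sff) sgg) _.
rewrite nrmZ// [ltRHS](splitr e); apply: ler_ltD => //.
apply: (@le_trans _ _ (`|a| * (e / (2 * (`|a| + 1))))); first by rewrite ler_wpM2l// ltW.
have -> : `|a| * (e / (2 * (`|a| + 1))) = e / 2 * (`|a| / (`|a| + 1)) by rewrite invfM; ring.
rewrite ler_piMr ?divr_ge0 ?(ltW e0)//.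
by rewrite ler_pdivrMr// mul1r lerDl.
Qed.

Let closure_indic (A : set Om) : measurable A -> closure_ (\1_A).
Proof.
rewrite {1}LS_generate; move: A.
apply: (@dynkin_induction _ Om LS (fun A => closure_ (\1_A))) => //.
- move=> A B [mA lA] [mB lB]; split; first exact: measurableI.
  rewrite (_ : \1_(A `&` B) = (fun x => (\1_A x : R) * \1_B x)).
    exact: (local_fun2 (fun u v => u * v) lA lB).
  by apply/funext => x; rewrite indicI.
- by apply: closure_local; rewrite indicT; exact: bounded_local_cst.
- by move=> A [mA lA]; apply: closure_local; exact: bounded_local_indic.
- move=> A mA cA; rewrite (_ : \1_(~` A) = (fun x => -1 * (\1_A x : R) + 1)).
    by apply: closure_lin => //; apply: closure_local; exact: bounded_local_cst.
  by apply/funext => x; rewrite !indicE in_setC mulN1r addrC; case: (x \in A); rewrite /= ?subrr ?subr0.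
- move=> F mF tF cF.
  have mU : measurable (\bigcup_k F k) by exact: bigcup_measurable.
  pose h n x : R := \sum_(k < n) (\1_(F k) x).
  have ch n : closure_ (h n).
    rewrite /h; elim: n => [|n IH].
      under eq_fun do rewrite big_ord0; apply: closure_local; exact: bounded_local_cst.
    rewrite (_ : (fun x => _) = (fun x => 1 * (\1_(F n) x : R) + h n x)); first exact: closure_lin.
    by apply/funext => x; rewrite big_ord_recr /= mul1r addrC.
  have hE n x : h n x = (`[< exists2 k, (k < n)%N & F k x >])%:R.
    rewrite /h; case: asboolP => [[k kn Fkx]|nF].
      rewrite (bigD1 (Ordinal kn))//= indicE mem_set// big1 ?addr0// => j jk.
      rewrite indicE; have [/set_mem Fjx|//] := boolP (x \in F j).
      exfalso; move/eqP: jk; apply; apply: val_inj => /=.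
      by apply: (tF j k) => //; exists x.
    by rewrite big1// => k _; rewrite indicE memNset// => Fkx; apply: nF; exists k.
  have sU : sqint m (\1_(\bigcup_k F k)).
    by apply: (bounded_sqint (C := 1) m_fin) => // x; rewrite indicE ger0_norm ?ler0n// lern1 leq_b1.
  apply: closure_closed => // e e0.
  have [] := @L2_dominated_cvg _ _ _ m h (\1_(\bigcup_k F k)) (fun=> 1) _ _ _ _ _ e e0.
  - by move=> n; case: (ch n) => -[].
  - exact: measurable_indic.
  - by apply: (bounded_sqint (C := 1) m_fin) => // x; rewrite normr1.
  - move=> x; have [[k _ Fkx]|nF] := pselect ((\bigcup_k F k) x).
      apply: cvg_near_cst; exists k.+1 => // n /= kn; apply/eqP.
      rewrite hE indicE mem_set; last by exists k.
      by rewrite asboolT//; exists k.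
    apply: cvg_near_cst; exists 0%N => // n _ /=; apply/eqP.
    rewrite hE indicE memNset// asboolF//; move=> [k _ Fkx]; apply: nF; by exists k.
  - move=> n x; rewrite hE indicE.
    by case: (_ \in _); case: asboolP => _; rewrite ?subrr ?normr0 ?subr0 ?sub0r ?normrN ?normr1 ?ler01.
  by move=> n ne; exists (h n).
Qed.

Import HBNNSimple.

(** Local balls are measurable and depend on the labels of one ball only. The sets
with these two properties are stable under intersection and generate, so the
indicators of all measurable sets are limits in L2 of bounded local functions
by Dynkin's lemma; simple functions and dominated convergence do the rest. *)
Lemma bounded_local_dense f : sqint m f -> forall e, 0 < e ->
  exists2 g, bounded_local g & nrm m (fun x => f x - g x) < e.
Proof.
move=> sf; suff [] : closure_ f by [].
have pos g : sqint m g -> (forall x, 0 <= g x) -> closure_ g.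
  move=> sg g0; have [mg _] := sg.
  have mg' : measurable_fun setT (EFin \o g) by exact/measurable_EFinP.
  pose h := nnsfun_approx measurableT mg'.
  have hg c : (fun n => h n c) @ \oo --> g c.
    have := cvg_nnsfun_approx measurableT mg' (fun c' _ => g0 c' : (0 <= (EFin \o g) c')%E) (I : setT c).
    by move=> /fine_cvg.
  have hle n x : h n x <= g x.
    rewrite -(cvg_lim _ (hg x))//; apply: nondecreasing_cvgn_le; last by apply/cvg_ex; exists (g x).
    by move=> a b ab; have /lefP := nd_nnsfun_approx measurableT mg' ab; apply.
  apply: closure_closed => // e e0.
  have [] := @L2_dominated_cvg _ _ _ m (fun n => h n) g g _ _ _ _ _ e e0 => //.
    by move=> n x; rewrite ger0_norm ?subr_ge0// lerBlDr lerDl.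
  move=> n ne; exists (h n) => //.
  rewrite (_ : (h n : Om -> R) = (fun x => \sum_(y <- fset_set (range (h n))) y * \1_(h n @^-1` [set y]) x)); last first.
    by apply/funext => x; rewrite fimfunE fsbig_finite.
  elim: (enum_fset _) => [|y s IH].
    by under eq_fun do rewrite big_nil; apply: closure_local; exact: bounded_local_cst.
  rewrite (_ : (fun x => _) = (fun x => y * (\1_(h n @^-1` [set y]) x : R) +
     \sum_(z <- s) z * \1_(h n @^-1` [set z]) x)).
    by apply: closure_lin => //; exact: closure_indic.
  by apply/funext => x; rewrite big_cons.
have [mf _] := sf.
have part (u : Om -> R) : measurable_fun setT u -> (forall x, 0 <= u x <= `|f x|) -> sqint m u.
  move=> mu_ uf; apply: (sqint_dominated mu_ sf) => x.
  by have /andP[u0 uf'] := uf x; rewrite ger0_norm.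
rewrite (_ : f = (fun x => -1 * Num.max (- f x) 0 + Num.max (f x) 0)).
  apply: closure_lin; apply: pos.
  - apply: part; first by apply: measurable_maxr => //; exact: measurableT_comp.
    by move=> x; rewrite le_max lexx orbT ge_max normr_ge0 andbT -normrN ler_norm.
  - by move=> x; rewrite le_max lexx orbT.
  - apply: part; first exact: measurable_maxr.
    by move=> x; rewrite le_max lexx orbT ge_max normr_ge0 andbT ler_norm.
  - by move=> x; rewrite le_max lexx orbT.
apply/funext => x.
by rewrite !maxEle; case: (leP (f _) 0); case: (leP (- f _) 0); lra.
Qed.

End density.

(** * Contraction of the centered functions *)

Lemma sqint_cst d (T : measurableType d) (R : realType)
    (m : probability T R) (a : R) : sqint m (fun=> a).
Proof.
apply: (bounded_sqint (C := `|a|)) => //.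
exact: le_lt_trans (probability_le1 _ measurableT) (ltry _).
Qed.

Lemma Rintegral_prob_cst d (T : measurableType d) (R : realType)
    (m : probability T R) (a : R) : \int[m]_(x in setT) a = a.
Proof.
have m1 : fine (m setT) = 1 by rewrite (_ : m setT = 1%E)//; exact: probability_setT.
by rewrite -[RHS]mulr1 -m1; exact: Rintegral_cst.
Qed.

Lemma sqint_prob_integrable d (T : measurableType d) (R : realType)
    (m : probability T R) (f : T -> R) : sqint m f -> m.-integrable setT (EFin \o f).
Proof.
move=> sf; have := sqintM_integrable sf (sqint_cst m 1).
by under [X in EFin \o X]eq_fun do rewrite mulr1.
Qed.

Lemma sqr_expectation_le d (T : measurableType d) (R : realType)
    (m : probability T R) (f : T -> R) : sqint m f -> (\int[m]_x f x) ^+ 2 <= nrm2 m f.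
Proof.
move=> sf; have := dot_cauchy_schwarz sf (sqint_cst m 1).
rewrite /nrm2 [X in _ * X](_ : _ = 1) ?mulr1; last first.
  by rewrite /dot Rintegral_prob_cst mulr1.
by rewrite {1}/dot; under eq_Rintegral do rewrite mulr1.
Qed.

(** Log-convexity makes the ratios a (n+1) / a n nondecreasing, so if the first one
exceeded s, the sequence would grow too fast for its assumed decay. This turns
a decay whose constant depends on the function into a contraction with a
uniform rate. *)
Lemma log_convex_decay (R : realType) (a : nat -> R) (C s : R) :
  0 <= s -> (forall n, 0 <= a n) ->
  (forall n, a n.+1 ^+ 2 <= a n * a n.+2) ->
  (forall n, a n <= C * s ^+ n) -> a 1%N <= s * a 0%N.
Proof.
move=> s0 a0 alog adec; rewrite leNgt; apply/negP => sa.
have a0gt : 0 < a 0%N.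
  rewrite lt_neqAle a0 andbT eq_sym; apply/eqP => a00.
  have := alog 0%N; rewrite a00 mul0r; move: sa; rewrite a00 mulr0; have := a0 1%N; nra.
pose q := a 1%N / a 0%N.
have sq : s < q by rewrite /q ltr_pdivlMr.
have q0 : 0 < q := le_lt_trans s0 sq.
have step n : 0 < a n /\ q * a n <= a n.+1.
  elim: n => [|n [IH1 IH2]]; first by rewrite /q divfK ?gt_eqF.
  have an1 : 0 < a n.+1 by apply: lt_le_trans IH2; exact: mulr_gt0.
  split=> //; have := alog n => h.
  rewrite -(ler_pM2l IH1); nra.
have geo n : q ^+ n * a 0%N <= a n.
  elim: n => [|n IH]; first by rewrite expr0 mul1r.
  rewrite exprS -mulrA; apply: le_trans (step n).2.
  by rewrite ler_wpM2l// ltW.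
have bnd n : a 0%N <= C * (s / q) ^+ n.
  by rewrite expr_div_n mulrA ler_pdivlMr ?exprn_gt0// mulrC (le_trans (geo n)).
have : (C * (s / q) ^+ n @[n --> \oo] --> C * 0)%classic.
  apply: cvgMr; apply: cvg_expr.
  by rewrite ger0_norm ?divr_ge0 ?(ltW q0)// ltr_pdivrMr// mul1r.
rewrite mulr0 => /cvgrPdist_lt /(_ _ a0gt) [N _ /(_ N (leqnn N))] /=.
rewrite sub0r normrN => h; have := bnd N; rewrite leNgt => /negP; apply.
exact: le_lt_trans (ler_norm _) h.
Qed.

Section decay.
Context (R : realType) (V : countType) (G : sgraph V) (D : nat).
Hypotheses (G_conn : connected_graph G) (G_deg : degrees_le G D).
Variables (t : nat) (o : 'I_t -> V) (mu : V -> {posnum R}).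
Hypothesis o_reps : orbit_representatives G o.
Hypothesis mu_mod : modular_function G mu.
Hypothesis mu_orbit : forall x y, aut_orbit G x y -> mu x = mu y.
Hypothesis deg0 : forall x, deg G x != 0%N.
Variable v0 : V.
Variable L : probability (labeling R V) R.
Hypothesis L_unif : iid_uniform L.

Local Notation rc := (@rooted_class R V G D G_conn G_deg).
Local Notation nu := (bernoulli_measure G_conn G_deg o mu L).
Local Notation nu_st := (degree_biased nu).
Local Notation N x := (fset_set (nbrs G x)).
Local Notation lab := (labeling R V).
Local Notation Om := (Omega R D).
Local Notation F f v := (fun w : lab => f (rc v w)).
Local Notation st_weight := (st_weight G o mu).
Local Notation M := (@real_markov R D).
Local Notation p := (@walk_prob R V G).
Implicit Types f g : Om -> R.

Let sw_gt0 i : 0 < st_weight i := st_weight_gt0 mu o_reps deg0 v0 i.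
Let sqL f : sqint nu_st f -> forall v, sqint L (F f v).
Proof. exact: (sqint_lift o_reps deg0 v0 L_unif). Qed.
Let sqofL f : measurable_fun setT f -> (forall v, sqint L (F f v)) -> sqint nu_st f.
Proof. move=> mf sf; exact: (sqint_of_lift mu o_reps deg0 v0 L_unif mf sf). Qed.
Let nrm2E f : sqint nu_st f -> nrm2 nu_st f = \sum_(i < t) st_weight i * nrm2 L (F f (o i)).
Proof. exact: (nrm2_nu_st o_reps deg0 v0 L_unif). Qed.
Let sM f : sqint nu_st f -> sqint nu_st (M f).
Proof. exact: (sqint_real_markov o_reps deg0 v0 L_unif). Qed.

Definition root_mean f v : R := \int[L]_w f (rc v w).

Lemma root_mean_orbit f u v : measurable_fun setT f -> aut_orbit G u v ->
  root_mean f v = root_mean f u.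
Proof.
move=> mf [g ag <-]; rewrite /root_mean.
rewrite [RHS](Rintegral_measure_preserving (measurable_relabel g) (relabel_preserving L_unif ag.1)).
  by apply: eq_Rintegral => w _; rewrite rc_aut.
exact: measurable_lift.
Qed.

Lemma root_mean_lin a f g v : sqint nu_st f -> sqint nu_st g ->
  root_mean (fun x => a * f x + g x) v = a * root_mean f v + root_mean g v.
Proof.
move=> sf sg; rewrite /root_mean.
have jf := sqint_prob_integrable (sqL sf v); have jg := sqint_prob_integrable (sqL sg v).
rewrite RintegralD//; last exact: (integrableZl measurableT a jf).
by rewrite RintegralZl.
Qed.

(** The conditional expectation of f given the orbit of the root. *)
Definition orbit_mean f (x : Om) : R :=
  \sum_(i < t) root_mean f (o i) * \1_(root_classes G_conn G_deg (o i)) x.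

Lemma orbit_fun_rc (a : 'I_t -> R) i v w : aut_orbit G (o i) v ->
  \sum_(j < t) a j * \1_(root_classes G_conn G_deg (o j)) (rc v w) = a i.
Proof.
move=> iv; have [k [kv kuniq]] := o_reps v.
have ki : k = i by exact: kuniq.
rewrite (bigD1 i)//= indicE mem_set ?mulr1; last exact/root_classesP.
rewrite big1 ?addr0// => j ji; rewrite indicE memNset ?mulr0// => /root_classesP jv.
by move/eqP: ji; apply; rewrite -ki; apply/esym/kuniq.
Qed.

Lemma orbit_mean_rc f v w : measurable_fun setT f ->
  orbit_mean f (rc v w) = root_mean f v.
Proof.
move=> mf; have [i [iv _]] := o_reps v.
by rewrite /orbit_mean (orbit_fun_rc _ w iv) (root_mean_orbit mf iv).
Qed.

Lemma measurable_orbit_fun (a : 'I_t -> R) : measurable_fun setT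
  (fun x : Om => \sum_(j < t) a j * \1_(root_classes G_conn G_deg (o j)) x).
Proof.
apply: measurable_sum => i; apply: measurable_funM => //.
by apply: measurable_indic; exact: measurable_root_classes.
Qed.

Lemma orbit_mean_lift f v : measurable_fun setT f ->
  F (orbit_mean f) v = fun=> root_mean f v.
Proof. by move=> mf; apply/funext => w; rewrite orbit_mean_rc. Qed.

Lemma sqint_orbit_fun (a : 'I_t -> R) : sqint nu_st
  (fun x : Om => \sum_(j < t) a j * \1_(root_classes G_conn G_deg (o j)) x).
Proof.
apply: sqofL; first exact: measurable_orbit_fun.
move=> v; have [i [iv _]] := o_reps v.
rewrite (_ : (fun w => _) = fun=> a i); first exact: sqint_cst.
by apply/funext => w; rewrite (orbit_fun_rc _ w iv).
Qed.

Lemma sqint_orbit_mean f : sqint nu_st (orbit_mean f).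
Proof. exact: sqint_orbit_fun. Qed.

Lemma orbit_mean_contraction f : sqint nu_st f -> nrm nu_st (orbit_mean f) <= nrm nu_st f.
Proof.
move=> sf; have [mf _] := sf; rewrite /nrm ler_wsqrtr// !nrm2E//; last exact: sqint_orbit_mean.
apply: ler_sum => i _; rewrite ler_wpM2l//; first exact: ltW.
rewrite orbit_mean_lift// {1}/nrm2 /dot Rintegral_prob_cst -expr2.
apply: sqr_expectation_le; exact: sqL.
Qed.

Definition centered f := forall v, root_mean f v = 0.

Lemma centered_sub_orbit_mean f : sqint nu_st f ->
  centered (fun x => f x - orbit_mean f x).
Proof.
move=> sf v; have [mf _] := sf.
rewrite (_ : (fun x => _) = (fun x => -1 * orbit_mean f x + f x)); last first.
  by apply/funext => x; rewrite mulN1r addrC.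
rewrite root_mean_lin//; last exact: sqint_orbit_mean.
rewrite {1}/root_mean; under eq_Rintegral do rewrite orbit_mean_rc//.
by rewrite Rintegral_prob_cst mulN1r addNr.
Qed.

Lemma orbit_mean_local f : measurable_fun setT f -> bounded_local G_conn G_deg (orbit_mean f).
Proof.
move=> mf; split; first exact: measurable_orbit_fun.
  exists (\sum_(i < t) `|root_mean f (o i)|) => x; apply: (le_trans (ler_norm_sum _ _ _)).
  apply: ler_sum => i _; rewrite normrM ler_piMr// indicE ger0_norm ?ler0n//.
  by rewrite lern1 leq_b1.
by exists 0%N => v w w' _; rewrite !orbit_mean_rc.
Qed.

Let nu_st_fin : (nu_st setT < +oo)%E.
Proof. exact: (nu_st_fin G_conn G_deg mu o_reps deg0 v0 L). Qed.

(** Subtract from a local approximation g of f its orbit mean, which is local. As f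
has orbit mean zero and the orbit mean is a contraction, this at most doubles
the distance to f. *)
Lemma centered_local_dense f : sqint nu_st f -> centered f -> forall e, 0 < e ->
  exists g, [/\ bounded_local G_conn G_deg g, centered g & nrm nu_st (fun x => f x - g x) < e].
Proof.
move=> sf cf e e0; have e2 : 0 < e / 2 by rewrite divr_gt0.
have [g lg fg] := bounded_local_dense G_conn G_deg nu_st_fin sf e2.
have sg : sqint nu_st g by exact: (bounded_local_sqint nu_st_fin lg).
have [mf _] := sf; have [mg _] := sg.
have sfg := sqintB sf sg.
exists (fun x => g x - orbit_mean g x); split.
- rewrite (_ : (fun x => _) = (fun x => -1 * orbit_mean g x + g x)); last first.
    by apply/funext => x; rewrite mulN1r addrC.
  by apply: bounded_local_lin => //; exact: orbit_mean_local.
- exact: centered_sub_orbit_mean.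
have om : orbit_mean (fun x => f x - g x) = fun x => - orbit_mean g x.
  apply/funext => x; rewrite /orbit_mean -sumrN; apply: eq_bigr => i _.
  rewrite (_ : (fun x => _) = (fun x => -1 * g x + f x)); last first.
    by apply/funext => y; rewrite mulN1r addrC.
  by rewrite root_mean_lin// cf addr0 mulN1r mulNr.
rewrite (_ : (fun x => _) = (fun x => (f x - g x) + -1 * orbit_mean (fun x => f x - g x) x)); last first.
  by apply/funext => x; rewrite om; ring.
have sO := sqint_orbit_mean (fun x => f x - g x).
apply: le_lt_trans (nrmD sfg (sqintZ (-1) sO)) _.
rewrite nrmZ// normrN1 mul1r [ltRHS](splitr e) ltr_leD//.
by apply: le_trans (orbit_mean_contraction sfg) _; exact: ltW.
Qed.

(** At a distance greater than twice the radius of g, the two lifts are functions of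
disjoint sets of labels, so the mean of their product is the product of their
means, which is zero. *)
Lemma local_correlation g : bounded_local G_conn G_deg g -> centered g ->
  exists r C, 0 <= C /\ forall u v,
    dot L (F g u) (F g v) <= C * (`[< gball G u r v >])%:R.
Proof.
move=> [mg [C gC] [r gr]] cg; exists (r + r)%N, (C ^+ 2).
split => [|u v]; first exact: sqr_ge0.
have mF x : measurable_fun setT (F g x) by exact: measurable_lift.
case: asboolP => [uv|nuv].
  rewrite mulr1; have sF x : sqint L (F g x).
    apply: (bounded_sqint (C := C)) => //.
    exact: le_lt_trans (probability_le1 _ measurableT) (ltry _).
  rewrite -[leRHS](Rintegral_prob_cst L); apply: le_Rintegral => //.
  - exact: sqintM_integrable.
  - by have := sqint_prob_integrable (sqint_cst L (C ^+ 2)).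
  move=> w _; apply: le_trans (ler_norm _) _; rewrite normrM expr2.
  by apply: ler_pM.
rewrite mulr0 /dot (disjoint_labels_expectation L_unif (mF u) (mF v) _ _ (gr u) (gr v) (C := C) (C' := C))//.
  by rewrite -/(root_mean g u) cg mul0r.
move=> x ux vx; apply: nuv; apply: gball_trans ux _; exact: gball_sym.
Qed.

Hypothesis nonam : non_amenable R G.

(** The n-th iterate of g at x is the mean of g at the end of an n-step walk from x,
so its second moment is the mean correlation of g between the ends of two
independent walks. Only nearby ends are correlated, and the probability of
ending nearby is bounded by return probabilities. *)
Lemma local_decay : exists2 s : R, 0 < s < 1 & forall g, bounded_local G_conn G_deg g ->
  centered g -> exists K, forall n, nrm2 nu_st (iter n M g) <= K * (s ^+ 2) ^+ n.
Proof.
have [s s01 ret] := return_decay G_conn G_deg deg0 nonam; exists s => // g lg cg.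
have /andP[s0 s1] := s01.
have [r [C [C0 gC]]] := local_correlation lg cg.
have sg : sqint nu_st g by exact: (bounded_local_sqint nu_st_fin lg).
have siter n : sqint nu_st (iter n M g) by elim: n => //= n; exact: sM.
have bnd x : exists K, forall n, nrm2 L (F (iter n M g) x) <= K * (s ^+ 2) ^+ n.
  have [C1 C10 pC] := ret x.
  have [K K0 KP] := walk_prob_pair_sum R G_deg deg0 r x.
  exists (C * (K * (C1 *+ r.+1))) => n.
  have [S xS] := gball_fset G_deg x (n + r).
  have E : F (iter n M g) x = fun w => \sum_(y <- S) p n x y * g (rc y w).
    apply/funext => w; rewrite iter_real_markov_rc// (@iter_walk_stepE _ _ _ _ G_deg deg0 n _ x S)//.
    by move=> y yn; apply: xS; apply: gball_mono yn; exact: leq_addr.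
  have sF y := sqL sg y.
  have -> : nrm2 L (F (iter n M g) x) =
      \sum_(u <- S) \sum_(v <- S) p n x u * p n x v * dot L (F g u) (F g v).
    rewrite E /nrm2 /dot.
    have iuv u v : L.-integrable setT (EFin \o (fun w => p n x u * p n x v * (g (rc u w) * g (rc v w)))).
      exact: (integrableZl measurableT (p n x u * p n x v) (sqintM_integrable (sF u) (sF v))).
    transitivity (\int[L]_w (\sum_(u <- S) \sum_(v <- S) p n x u * p n x v * (g (rc u w) * g (rc v w)))).
      apply: eq_Rintegral => w _; rewrite mulr_suml; apply: eq_bigr => u _.
      by rewrite mulr_sumr; apply: eq_bigr => v _; ring.
    rewrite Rintegral_sum_seq; last by move=> u; apply: integrable_sum_seq => v; exact: iuv.
    apply: eq_bigr => u _; rewrite Rintegral_sum_seq; last by move=> v; exact: iuv.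
    by apply: eq_bigr => v _; rewrite RintegralZl//; exact: sqintM_integrable.
  apply: (@le_trans _ _ (C * (\sum_(u <- S) \sum_(v <- S) p n x u * p n x v * (`[< gball G u r v >])%:R))).
    rewrite mulr_sumr; apply: ler_sum => u _; rewrite mulr_sumr; apply: ler_sum => v _.
    by rewrite mulrCA ler_wpM2l ?mulr_ge0 ?walk_prob_ge0.
  rewrite -mulrA ler_wpM2l//; apply: (le_trans (KP n S xS)); rewrite -mulrA ler_wpM2l//.
  rewrite mulrnAl -[X in _ *+ X](card_ord r.+1) -sumr_const.
  apply: ler_sum => j _; apply: (le_trans (pC _)); rewrite ler_wpM2l//.
  rewrite -exprM; apply: ler_wiXn2l; rewrite ?(ltW s0) ?(ltW s1)//.
  by rewrite mulSn mul1n leq_add2l leq_addl.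
have [K KP] := choice bnd.
exists (\sum_(i < t) st_weight i * K (o i)) => n; rewrite nrm2E// mulr_suml.
by apply: ler_sum => i _; rewrite -mulrA ler_wpM2l// ltW.
Qed.

(** M being self-adjoint, the square norms of the iterates at a function are
log-convex, so their common rate of decay for local functions already bounds
the first step. Density and continuity of M extend this to all centered
functions. *)
Lemma centered_contraction : exists2 s : R, 0 < s < 1 &
  forall f, sqint nu_st f -> centered f -> nrm nu_st (M f) <= s * nrm nu_st f.
Proof.
have [s s01 dec] := local_decay; exists s => // f sf cf.
have /andP[s0 s1] := s01.
have loc g : bounded_local G_conn G_deg g -> centered g -> nrm nu_st (M g) <= s * nrm nu_st g.
  move=> lg cg; have [K KP] := dec g lg cg.
  have sg : sqint nu_st g by exact: (bounded_local_sqint nu_st_fin lg).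
  have siter n : sqint nu_st (iter n M g) by elim: n => //= n; exact: sM.
  have := @log_convex_decay R (fun n => nrm2 nu_st (iter n M g)) K (s ^+ 2) (sqr_ge0 s)
     (fun n => nrm2_ge0 nu_st _) _ KP.
  rewrite /= => h; apply: nrm_le; first by rewrite mulr_ge0 ?nrm_ge0// ltW.
  rewrite exprMn nrm_sqr; apply: h => n.
  rewrite {1}/nrm2 /= (real_markov_self_adjoint o_reps mu_mod mu_orbit deg0 v0 L_unif (siter n) (siter n.+1)).
  apply: dot_cauchy_schwarz; [exact: siter|exact: (siter n.+2)].
apply/ler_addgt0Pr => e e0.
have [g [lg cg fg]] := centered_local_dense sf cf (ltac:(by rewrite divr_gt0) : 0 < e / 2).
have sg : sqint nu_st g by exact: (bounded_local_sqint nu_st_fin lg).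
have sfg := sqintB sf sg.
have h1 : nrm nu_st (M f) <= nrm nu_st (M (fun x => f x - g x)) + nrm nu_st (M g).
  rewrite (_ : M f = fun x => M (fun x => f x - g x) x + M g x).
    by apply: nrmD; exact: sM.
  rewrite (_ : (fun x => f x - g x) = (fun x => -1 * g x + f x)); last first.
    by apply/funext => x; rewrite mulN1r addrC.
  by rewrite real_markov_lin; apply/funext => x; ring.
have h2 : nrm nu_st g <= nrm nu_st f + nrm nu_st (fun x => f x - g x).
  rewrite [X in X <= _](_ : _ = nrm nu_st (fun x => f x + -1 * (f x - g x))); last first.
    by congr nrm; apply/funext => x; ring.
  by apply: le_trans (nrmD sf (sqintZ (-1) sfg)) _; rewrite nrmZ// normrN1 mul1r.
have h3 := real_markov_contraction o_reps mu_mod mu_orbit deg0 v0 L_unif sfg.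
have h4 := loc g lg cg.
have := nrm_ge0 nu_st (fun x => f x - g x); have := nrm_ge0 nu_st f.
move: h1 h2 h3 h4 fg; set a := nrm _ (M f); set b := nrm _ (M (fun x => _)).
set c := nrm _ (M g); set d := nrm _ g; set x := nrm _ f; set y := nrm _ (fun x => _).
move=> h1 h2 h3 h4 fg x0 y0.
have h5 : s * d <= s * x + y by nra.
lra.
Qed.

End decay.

(** * Finite reversible chains *)

Definition chain_op (R : realType) (t : nat) (P : 'M[R]_t) (f : 'I_t -> R) i : R :=
  \sum_j P i j * f j.

Section chain_bipartitions.
Variables (R : realType) (t : nat) (P : 'M[R]_t) (T1 T2 : {set 'I_t}).
Hypothesis T12 : chain_bipartition P T1 T2.

Lemma chain_bipartition_cases i :
  (i \in T1 /\ i \notin T2) \/ (i \in T2 /\ i \notin T1).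
Proof.
have [T12T T120 _ _] := T12.
have : i \in (T1 :|: T2)%SET by rewrite T12T finset.in_setT.
have : (i \in (T1 :&: T2)%SET) = false by rewrite T120 finset.in_set0.
by rewrite finset.in_setI finset.in_setU; case: (i \in T1); case: (i \in T2) => // _ _; [left|right].
Qed.

Lemma chain_bipartition_alternates i j : 0 < P i j ->
  (i \in T1 /\ j \in T2) \/ (i \in T2 /\ j \in T1).
Proof.
have [_ _ T1P T2P] := T12 => Pij.
case: (chain_bipartition_cases i) => -[i1 i2]; case: (chain_bipartition_cases j) => -[j1 j2].
- by move: Pij; rewrite T1P// ltxx.
- by left.
- by right.
- by move: Pij; rewrite T2P// ltxx.
Qed.

Definition part_sign (i : 'I_t) : R := (i \in T1)%:R - (i \in T2)%:R.

Lemma part_sign_neq0 i : part_sign i != 0.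
Proof.
by rewrite /part_sign; case: (chain_bipartition_cases i) => -[-> /negbTE ->] /=;
  rewrite ?subr0 ?sub0r ?oppr_eq0 oner_eq0.
Qed.

(** An edge of the chain joins the two parts. *)
Lemma part_sign_alternates i j : 0 < P i j -> part_sign j = - part_sign i.
Proof.
rewrite /part_sign => /chain_bipartition_alternates.
case: (chain_bipartition_cases i) => -[-> /negbTE ->];
  case: (chain_bipartition_cases j) => -[-> /negbTE ->] [] [] //= _ _;
  by rewrite subr0 sub0r ?opprK.
Qed.

Lemma chain_op_part_sign i : (forall j, 0 <= P i j) -> \sum_j P i j = 1 ->
  chain_op P part_sign i = - part_sign i.
Proof.
move=> P0 P1; rewrite -[RHS]mul1r -P1 mulr_suml; apply: eq_bigr => j _.
have [->|Pij] := eqVneq (P i j) 0; first by rewrite !mul0r.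
by rewrite (@part_sign_alternates i j) ?mulrN// lt_neqAle eq_sym Pij P0.
Qed.

End chain_bipartitions.

Section reversible_chain.
Variables (R : realType) (t : nat) (P : 'M[R]_t) (pi : 'I_t -> R).
Hypothesis P0 : forall i j, 0 <= P i j.
Hypothesis P1 : forall i, \sum_j P i j = 1.
Hypothesis pi0 : forall i, 0 < pi i.
Hypothesis rev : forall i j, pi i * P i j = pi j * P j i.
Hypothesis irr : forall A : set 'I_t, (exists i, A i) ->
  (forall i j, A i -> 0 < P i j -> A j) -> forall i, A i.
Implicit Types f g : 'I_t -> R.

Local Notation chain_op := (chain_op P).
Definition chain_nrm2 f : R := \sum_i pi i * f i ^+ 2.

Let pi_P_sqr_ge0 i j x : 0 <= pi i * P i j * x ^+ 2.
Proof. by apply: mulr_ge0 (sqr_ge0 x); apply: mulr_ge0 => //; exact: ltW. Qed.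

Lemma chain_pos_sym i j : 0 < P i j -> 0 < P j i.
Proof.
move=> Pij; have : 0 < pi j * P j i by rewrite -rev mulr_gt0.
by rewrite pmulr_rgt0.
Qed.

Lemma chain_stationary f : \sum_i pi i * chain_op f i = \sum_i pi i * f i.
Proof.
under eq_bigr do rewrite /chain_op mulr_sumr; rewrite exchange_big /=.
apply: eq_bigr => j _; under eq_bigr do rewrite mulrA rev mulrAC.
by rewrite -mulr_sumr P1 mulr1.
Qed.

(** Averaging loses, at each state, the variance of f after one step; the weighted
sum of the mean squares is the square norm of f by stationarity. *)
Lemma chain_variance f : chain_nrm2 f - chain_nrm2 (chain_op f) =
  \sum_i \sum_j pi i * P i j * (f j - chain_op f i) ^+ 2.
Proof.
have -> : chain_nrm2 f = _ := esym (chain_stationary (fun i => f i ^+ 2)).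
rewrite /chain_nrm2 -sumrB; apply: eq_bigr => i _.
under eq_bigr do rewrite -mulrA; rewrite -mulr_sumr -mulrBr; congr (_ * _).
set c := chain_op f i.
rewrite (eq_bigr (fun j => P i j * f j ^+ 2 - 2 * c * (P i j * f j) + c ^+ 2 * P i j)); last first.
  by move=> j _; ring.
by rewrite big_split sumrB /= -!mulr_sumr P1 -/(chain_op f i) -/c /chain_op; ring.
Qed.

Lemma chain_nrm2_ge0 f : 0 <= chain_nrm2 f.
Proof. by apply: sumr_ge0 => i _; rewrite mulr_ge0 ?sqr_ge0// ltW. Qed.

Lemma chain_contraction f : chain_nrm2 (chain_op f) <= chain_nrm2 f.
Proof.
rewrite -subr_ge0 chain_variance; apply: sumr_ge0 => i _; apply: sumr_ge0 => j _.
exact: pi_P_sqr_ge0.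
Qed.

Lemma chain_isometric f : chain_nrm2 (chain_op f) = chain_nrm2 f ->
  forall i j, 0 < P i j -> f j = chain_op f i.
Proof.
move=> e i j Pij.
have /eqP := chain_variance f; rewrite e subrr eq_sym psumr_eq0; last first.
  by move=> k _; apply: sumr_ge0 => l _; exact: pi_P_sqr_ge0.
move=> /allP/(_ i (mem_index_enum _)) /=; rewrite psumr_eq0; last first.
  by move=> l _; exact: pi_P_sqr_ge0.
move=> /allP/(_ j (mem_index_enum _)) /=.
by rewrite mulf_eq0 gt_eqF ?mulr_gt0//= sqrf_eq0 subr_eq0 => /eqP.
Qed.

Lemma chain_harmonic_const f : (forall i j, 0 < P i j -> f i = f j) -> forall i j, f i = f j.
Proof.
move=> fe i; apply: (irr (A := fun j => f i = f j)); first by exists i.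
by move=> j k /= -> /fe.
Qed.

Lemma sum_pi_gt0 (i : 'I_t) : 0 < \sum_i pi i.
Proof.
rewrite (bigD1 i)//=; apply: ltr_pwDl => //; apply: sumr_ge0 => j _; exact: ltW.
Qed.

(** When averaging preserves the norm, f j is the average of f at i for every edge
from i to j. With the reversed edge this makes f + P f constant along edges,
hence constant by irreducibility, hence zero because its mean is zero. *)
Lemma chain_isometric_alternates f : \sum_i pi i * f i = 0 ->
  chain_nrm2 (chain_op f) = chain_nrm2 f ->
  (forall i, chain_op f i = - f i) /\ (forall i j, 0 < P i j -> f j = - f i).
Proof.
move=> f0 /chain_isometric e.
have h i j : 0 < P i j -> f i + chain_op f i = f j + chain_op f j.
  by move=> Pij; rewrite (e _ _ Pij) (e _ _ (chain_pos_sym Pij)) addrC.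
have c := chain_harmonic_const (f := fun i => f i + chain_op f i) h.
have N i : chain_op f i = - f i.
  apply/eqP; rewrite -addr_eq0 addrC.
  have : \sum_j pi j * (f j + chain_op f j) = 0.
    by under eq_bigr do rewrite mulrDr; rewrite big_split /= chain_stationary f0 addr0.
  under eq_bigr do rewrite -(c i) ; rewrite -mulr_suml => /eqP.
  by rewrite mulf_eq0 (gt_eqF (sum_pi_gt0 i)).
by split => // i j Pij; rewrite (e _ _ Pij) N.
Qed.

(** An eigenvector of a matrix is a row vector here; by reversibility, dividing it by
the stationary weights gives an eigenfunction of the averaging operator. *)
Lemma chain_eigenvalue a : eigenvalue P a <->
  exists2 f, (exists i, f i != 0) & forall i, chain_op f i = a * f i.
Proof.
split=> [/eigenvalueP[v vP v0]|[f [i fi0] fa]].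
  exists (fun i => v 0 i / pi i).
    have [i vi] : exists i, v 0 i != 0 by apply/rV0Pn.
    by exists i; rewrite mulf_neq0// invr_eq0 gt_eqF.
  move=> i; have := congr1 (fun u : 'rV[R]_t => u 0 i / pi i) vP; rewrite !mxE mulrA => <-.
  rewrite mulr_suml; apply: eq_bigr => j _.
  have pj := lt0r_neq0 (pi0 j); have pj' := lt0r_neq0 (pi0 i).
  have := rev i j => r.
  have -> : P i j = pi j * P j i / pi i by rewrite -r mulrC mulKf.
  by field; rewrite pj pj'.
apply/eigenvalueP; exists (\row_j (pi j * f j)).
  apply/rowP => j; rewrite !mxE mulrCA -fa /chain_op mulr_sumr; apply: eq_bigr => k _.
  by rewrite mxE [LHS]mulrAC [RHS]mulrA (rev j k).
by apply/rV0Pn; exists i; rewrite mxE mulf_neq0// gt_eqF.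
Qed.

Lemma chain_eigenvalue_ge a : eigenvalue P a -> -1 <= a.
Proof.
move=> /chain_eigenvalue[f [i fi] fa]; have := chain_contraction f.
have -> : chain_nrm2 (chain_op f) = a ^+ 2 * chain_nrm2 f.
  by rewrite /chain_nrm2 mulr_sumr; apply: eq_bigr => j _; rewrite fa; ring.
have n0 : 0 < chain_nrm2 f.
  rewrite /chain_nrm2 (bigD1 i)//=; apply: ltr_pwDl.
    by rewrite mulr_gt0// lt_neqAle sqr_ge0 andbT eq_sym sqrf_eq0.
  by apply: sumr_ge0 => j _; rewrite mulr_ge0 ?sqr_ge0// ltW.
rewrite -[leRHS]mul1r ler_pM2r// => a1.
by rewrite leNgt; apply/negP => a2; nra.
Qed.

Lemma nonbipartite_definite f : ~ bipartite_chain P -> \sum_i pi i * f i = 0 ->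
  chain_nrm2 (chain_op f) = chain_nrm2 f -> forall i, f i = 0.
Proof.
move=> nb f0 e i; have [N _] := chain_isometric_alternates f0 e.
apply/eqP; apply: contra_notT nb => fi; split; last exact: chain_eigenvalue_ge.
by apply/chain_eigenvalue; exists f; [exists i|move=> j; rewrite mulN1r].
Qed.

(** An eigenfunction for -1 changes sign along every edge and, by irreducibility,
vanishes nowhere. Its positive and negative sets form the bipartition. *)
Lemma bipartite_chain_bipartition : bipartite_chain P -> exists T1 T2, chain_bipartition P T1 T2.
Proof.
move=> [/chain_eigenvalue[f [i fi] fN] _].
have fN' j : chain_op f j = - f j by rewrite fN mulN1r.
have e : chain_nrm2 (chain_op f) = chain_nrm2 f.
  by rewrite /chain_nrm2; apply: eq_bigr => j _; rewrite fN' sqrrN.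
have alt j k : 0 < P j k -> f k = - f j by move=> /(chain_isometric e) ->.
have nz j : f j != 0.
  apply/negP => /eqP fj; move/eqP: fi; apply.
  apply: (irr (A := fun k => f k = 0)); first by exists j.
  by move=> k l /= fk /alt ->; rewrite fk oppr0.
exists [set j | 0 < f j]%SET, [set j | f j < 0]%SET; split.
- by apply/setP => j; rewrite !inE; case: ltgtP (nz j).
- by apply/setP => j; rewrite !inE; case: ltgtP.
- move=> j k; rewrite !inE => fj fk; apply/eqP; rewrite eq_le P0 andbT leNgt.
  by apply/negP => /alt; lra.
- move=> j k; rewrite !inE => fj fk; apply/eqP; rewrite eq_le P0 andbT leNgt.
  by apply/negP => /alt; lra.
Qed.

(** Since f and the sign of the parts both alternate, their product is constant along
edges, hence constant; it is zero because its mean is. *)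
Lemma bipartite_definite T1 T2 f : chain_bipartition P T1 T2 ->
  \sum_i pi i * f i = 0 ->
  \sum_i pi i * (part_sign R T1 T2 i * f i) = 0 ->
  chain_nrm2 (chain_op f) = chain_nrm2 f -> forall i, f i = 0.
Proof.
move=> T12 f0 ef e i; have [_ alt] := chain_isometric_alternates f0 e.
have c := chain_harmonic_const (f := fun j => part_sign R T1 T2 j * f j).
have {}c : forall j k, part_sign R T1 T2 j * f j = part_sign R T1 T2 k * f k.
  apply: c => j k Pjk.
  by rewrite (part_sign_alternates T12 Pjk) (alt _ _ Pjk) mulrNN.
move: ef; under eq_bigr do rewrite -(c i).
rewrite -mulr_suml => /eqP; rewrite mulf_eq0 (gt_eqF (sum_pi_gt0 i)) /= mulf_eq0.
by rewrite (negbTE (part_sign_neq0 T12 i)) => /eqP.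
Qed.

(** The unit sphere of the subspace is compact and the norm of the average is a
continuous function, less than 1 at every point of the sphere. *)
Lemma chain_gap (eps : 'I_t -> R) :
  (forall f, \sum_i pi i * f i = 0 -> \sum_i pi i * (eps i * f i) = 0 ->
     chain_nrm2 (chain_op f) = chain_nrm2 f -> forall i, f i = 0) ->
  exists2 r : R, 0 <= r < 1 & forall f,
    \sum_i pi i * f i = 0 -> \sum_i pi i * (eps i * f i) = 0 ->
    chain_nrm2 (chain_op f) <= r * chain_nrm2 f.
Proof.
move=> def.
pose l1 (v : 'rV[R]_t) : R := \sum_i pi i * v 0 i.
pose l2 (v : 'rV[R]_t) : R := \sum_i pi i * (eps i * v 0 i).
pose q (v : 'rV[R]_t) : R := chain_nrm2 (fun i => v 0 i).
pose h (v : 'rV[R]_t) : R := chain_nrm2 (chain_op (fun i => v 0 i)).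
have csum (I : finType) (F : I -> 'rV[R]_t -> R) : (forall i, continuous (F i)) ->
    continuous (fun v => \sum_i F i v).
  move=> cF v; apply: cvg_big => [||i _].
  - exact: add_continuous.
  - exact: (nbhs_filter v).
  - exact: cF.
have cM (c : R) (F : 'rV[R]_t -> R) : continuous F -> continuous (fun v => c * F v).
  by move=> cF v; exact: (cvgM (cvg_cst c) (cF v)).
have cX (F : 'rV[R]_t -> R) : continuous F -> continuous (fun v => F v ^+ 2).
  by move=> cF v; exact: (cvgM (cF v) (cF v)).
have cc i : continuous (fun v : 'rV[R]_t => v 0 i) by exact: coord_continuous.
have cl1 : continuous l1 by apply: (csum) => i; exact: cM.
have cl2 : continuous l2 by apply: (csum) => i; apply: (cM); exact: cM.
have cq : continuous q by apply: (csum) => i; apply: (cM); exact: cX.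
have ch : continuous h.
  by apply: (csum) => i; apply: (cM); apply: (cX); apply: (csum) => j; exact: cM.
pose b i : R := (pi i)^-1 + 1.
(* Each weighted square is at most 1 on the sphere, so the coordinates are bounded. *)
pose box : set 'rV[R]_t := [set v | forall i, `[- b i, b i]%classic (v 0 i)].
have cbox : compact box := (rV_compact (fun i => @segment_compact R (- b i) (b i))).
pose S := (l1 @^-1` [set 0]) `&` ((l2 @^-1` [set 0]) `&` (q @^-1` [set 1])).
have Sbox : S `<=` box.
  move=> v [_ [_ q1]] i /=; rewrite in_itv /=.
  have b1 : 1 <= b i by rewrite /b lerDr invr_ge0 ltW.
  have : pi i * v 0 i ^+ 2 <= 1.
    rewrite -q1 /q /chain_nrm2 (bigD1 i)//= lerDl sumr_ge0// => j _.
    by rewrite mulr_ge0 ?sqr_ge0// ltW.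
  rewrite mulrC -ler_pdivlMr// div1r => vb.
  have {}vb : v 0 i ^+ 2 <= b i by apply: le_trans vb _; rewrite /b lerDl.
  by apply/andP; split; nra.
have cS : compact S.
  apply: subclosed_compact Sbox => //.
  have clo (F : 'rV[R]_t -> R) a : continuous F -> closed (F @^-1` [set a]).
    by move=> cF; apply: closed_comp => // v _; exact: cF.
  by apply: closedI; [|apply: closedI]; exact: clo.
have qh v : h v <= q v by exact: chain_contraction.
pose sc (c : R) (f : 'I_t -> R) : 'rV[R]_t := \row_i (c * f i).
have n2sc c f : q (sc c f) = c ^+ 2 * chain_nrm2 f.
  by rewrite /q /chain_nrm2 mulr_sumr; apply: eq_bigr => i _; rewrite mxE; ring.
have hsc c f : h (sc c f) = c ^+ 2 * chain_nrm2 (chain_op f).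
  rewrite /h /chain_nrm2 mulr_sumr; apply: eq_bigr => i _.
  rewrite (_ : chain_op _ i = c * chain_op f i); first ring.
  by rewrite /chain_op mulr_sumr; apply: eq_bigr => j _; rewrite mxE; ring.
have red (r : R) : (forall v, S v -> h v <= r) -> forall f,
    \sum_i pi i * f i = 0 -> \sum_i pi i * (eps i * f i) = 0 ->
    chain_nrm2 (chain_op f) <= r * chain_nrm2 f.
  move=> hr f f1 f2; have [n0|n0] := eqVneq (chain_nrm2 f) 0.
    by have := chain_contraction f; rewrite n0 mulr0.
  have np : 0 < chain_nrm2 f by rewrite lt_neqAle eq_sym n0 chain_nrm2_ge0.
  pose c := (Num.sqrt (chain_nrm2 f))^-1.
  have c2 : c ^+ 2 = (chain_nrm2 f)^-1 by rewrite /c exprVn sqr_sqrtr// ltW.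
  have Sv : S (sc c f).
    have e1 : l1 (sc c f) = c * \sum_i pi i * f i.
      by rewrite /l1 mulr_sumr; apply: eq_bigr => i _; rewrite mxE; ring.
    have e2 : l2 (sc c f) = c * \sum_i pi i * (eps i * f i).
      by rewrite /l2 mulr_sumr; apply: eq_bigr => i _; rewrite mxE; ring.
    split; last split.
    - by rewrite /preimage /= e1 f1 mulr0.
    - by rewrite /preimage /= e2 f2 mulr0.
    - by rewrite /preimage /= n2sc c2 mulVf.
  by have := hr _ Sv; rewrite hsc c2 mulrC ler_pdivrMr.
have [S0|/set0P Sne] := eqVneq S set0.
  by exists 0; [rewrite lexx ltr01|apply: red => v; rewrite S0].
have [c cS' cmax] := EVT_max_rV Sne cS (continuous_subspaceT ch).
exists (h c); last by apply: red => v Sv; apply: cmax; exact: mem_set.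
rewrite chain_nrm2_ge0 /= lt_neqAle; have [Sc1 [Sc2 Sc3]] := set_mem cS'.
apply/andP; split; last by rewrite -Sc3; exact: qh.
apply/eqP => hc; have z := def (fun i => c 0 i) Sc1 Sc2.
have : chain_nrm2 (chain_op (fun i => c 0 i)) = chain_nrm2 (fun i => c 0 i).
  by rewrite -/(h c) -/(q c) hc Sc3.
move=> /z {}z; move: Sc3; rewrite /preimage /= /q /chain_nrm2 big1.
  by move/eqP; rewrite eq_sym oner_eq0.
by move=> i _; rewrite z expr0n mulr0.
Qed.

End reversible_chain.

(** * The orthogonal complement of the constants and one more function *)

Section complex_perp.
Context d (T : measurableType d) (R : realType).
Variable m : {measure set T -> \bar R}.
Hypothesis m_fin : (m setT < +oo)%E.
Variable e : T -> R.
Hypothesis se : sqint m e.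
Local Open Scope complex_scope.

Local Notation re f := (fun x => complex.Re (f x)).
Local Notation im f := (fun x => complex.Im (f x)).

Definition perp_one (u : T -> R) := [/\ sqint m u, dot m u (fun=> 1) = 0 & dot m u e = 0].

Definition span_one : set (T -> R[i]) :=
  [set h | exists a b : R[i], h = (fun x => a + b * (e x)%:C)].

Let sc a : sqint m (fun=> a).
Proof. by apply: (bounded_sqint (C := `|a|) m_fin) => //; exact: measurable_cst. Qed.

Let s1 : sqint m (fun=> 1) := sc 1.

Lemma perp_one_lin a u v : perp_one u -> perp_one v -> perp_one (fun x => a * u x + v x).
Proof.
move=> [su u1 ue] [sv v1 ve]; split; first exact: sqint_lin.
- by rewrite dot_linl// u1 v1 mulr0 addr0.
- by rewrite dot_linl// ue ve mulr0 addr0.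
Qed.

(** Inner products are continuous for the norm, by the Cauchy-Schwarz inequality. *)
Lemma perp_one_closed u : sqint m u ->
  (forall eta, 0 < eta -> exists2 h, perp_one h & nrm m (fun x => u x - h x) < eta) -> perp_one u.
Proof.
move=> su uc.
have orth (k : T -> R) : sqint m k -> (forall h, perp_one h -> dot m h k = 0) -> dot m u k = 0.
  move=> sk hk; have bnd eta : 0 < eta -> `|dot m u k| <= eta * nrm m k.
    move=> eta0; have [h ph uh] := uc _ eta0; have [sh _ _] := ph.
    have -> : dot m u k = dot m (fun x => u x - h x) k.
      rewrite (_ : (fun x => u x - h x) = (fun x => -1 * h x + u x)); last first.
        by apply/funext => x; ring.
      by rewrite dot_linl// (hk _ ph) mulr0 add0r.
    apply: (le_trans (dot_nrm (sqintB su sh) sk)).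
    by rewrite ler_wpM2r ?nrm_ge0// ltW.
  apply/eqP; rewrite -normr_le0; apply/ler_addgt0Pr => eta eta0; rewrite add0r.
  have k1 : 0 < nrm m k + 1 by rewrite ltr_wpDl ?nrm_ge0.
  apply: (le_trans (bnd (eta / (nrm m k + 1)) _)); first by rewrite divr_gt0.
  by rewrite mulrAC ler_pdivrMr// ler_pM2l// lerDl.
by split => //; apply: orth => // h [].
Qed.

Let Rint_lin4 (f : T -> R[i]) (p q u v : R) : sqint m (re f) -> sqint m (im f) ->
  \int[m]_x (re f x * (p + u * e x) + im f x * (q + v * e x)) =
  p * dot m (re f) (fun=> 1) + u * dot m (re f) e +
    (q * dot m (im f) (fun=> 1) + v * dot m (im f) e).
Proof.
move=> sr si.
have h (k : T -> R) (a b : R) : sqint m k ->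
    \int[m]_x (k x * (a + b * e x)) = a * dot m k (fun=> 1) + b * dot m k e.
  move=> sk; transitivity (dot m k (fun x => b * e x + a * 1)).
    by rewrite /dot; apply: eq_Rintegral => x _; rewrite mulr1 [a + _]addrC.
  rewrite (dot_linr b se (sc (a * 1)) sk).
  rewrite addrC; congr (_ + _); rewrite /dot -RintegralZl//; last exact: sqintM_integrable.
  by apply: eq_Rintegral => x _; ring.
have ab (k : T -> R) (a b : R) : sqint m k ->
    m.-integrable setT (EFin \o (fun x => k x * (a + b * e x))).
  move=> sk; apply: sqintM_integrable => //.
  rewrite (_ : (fun x => _) = (fun x => b * e x + a)); last by apply/funext => x; rewrite addrC.
  by apply: sqint_lin => //; exact: sc.
by rewrite RintegralD//; [rewrite !h|exact: ab|exact: ab].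
Qed.

Lemma L2perp_span_one f : L2perp m span_one f <-> perp_one (re f) /\ perp_one (im f).
Proof.
have innerE (a b : R[i]) : sqint m (re f) -> sqint m (im f) ->
    L2inner m f (fun x => a + b * (e x)%:C) =
    Complex (\int[m]_x (re f x * (complex.Re a + complex.Re b * e x) +
                        im f x * (complex.Im a + complex.Im b * e x)))
            (\int[m]_x (re f x * (- complex.Im a + - complex.Im b * e x) +
                        im f x * (complex.Re a + complex.Re b * e x))).
  move=> sr si; rewrite /L2inner; congr Complex; apply: eq_Rintegral => x _;
    case: a b (f x) => [p q] [u v] [y z] /=; ring.
split=> [[/L2_csqint[sr si] h]|[[sr r1 re_] [si i1 ie]]].
- have /eqP := h _ (ex_intro _ 1 (ex_intro _ 0 erefl)).
  have /eqP := h _ (ex_intro _ 0 (ex_intro _ 1 erefl)).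
  rewrite !innerE// !eq_complex /= !Rint_lin4// ?oppr0 !(mul0r, mul1r, add0r, addr0).
  by move=> /andP[/eqP ? /eqP ?] /andP[/eqP ? /eqP ?].
- split; first exact/L2_csqint.
  move=> _ [a [b ->]]; rewrite innerE// !Rint_lin4// r1 re_ i1 ie.
  by rewrite !mulr0 !addr0.
Qed.

End complex_perp.

Lemma constant_functions_span_one d (T : measurableType d) (R : realType) :
  constant_functions R T = span_one (fun _ : T => 0 : R).
Proof.
apply/seteqP; split=> h; first by move=> [a _ <-]; exists a, 0; apply/funext => x; rewrite mul0r addr0.
move=> [a [b ->]]; exists a => //; apply/funext => x.
by rewrite (_ : (0 : R)%:C%C = 0)// mulr0 addr0.
Qed.

Lemma markov_operator_complex (R : realType) (D : nat) (f : Omega R D -> R[i]) x :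
  markov_operator f x = Complex (real_markov (fun y => complex.Re (f y)) x)
                                (real_markov (fun y => complex.Im (f y)) x).
Proof.
rewrite /markov_operator /real_markov /nbr_sum.
have -> : \sum_(v <- fset_set (root_nbrs x)) f (move_root x v) =
    Complex (\sum_(v <- fset_set (root_nbrs x)) complex.Re (f (move_root x v)))
            (\sum_(v <- fset_set (root_nbrs x)) complex.Im (f (move_root x v))).
  elim: (enum_fset _) => [|v s IH]; first by rewrite !big_nil.
  by rewrite !big_cons IH; case: (f (move_root x v)).
have -> : ((root_deg x)%:R : R[i])^-1 = (((root_deg x)%:R : R)^-1)%:C%C.
  by rewrite fmorphV rmorph_nat.
by apply/eqP; rewrite eq_complex /= !mulr0 subr0 add0r !eqxx.
Qed.

(** * The chain on the orbits *)

Section orbit_chain_theory.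
Context (R : realType) (V : countType) (G : sgraph V) (D : nat).
Hypotheses (G_conn : connected_graph G) (G_deg : degrees_le G D).
Variables (t : nat) (o : 'I_t -> V) (mu : V -> {posnum R}).
Hypothesis o_reps : orbit_representatives G o.
Hypothesis mu_mod : modular_function G mu.
Hypothesis mu_orbit : forall x y, aut_orbit G x y -> mu x = mu y.
Hypothesis deg0 : forall x, deg G x != 0%N.

Local Notation P := (orbit_chain R G o).
Local Notation N x := (fset_set (nbrs G x)).
Local Notation st_weight := (st_weight G o mu).

Let N_fin := nbrs_finite G_deg.

Let memN := mem_nbrs G_deg.

Let degR0 x : 0 < (deg G x)%:R :> R.
Proof. by rewrite ltr0n lt0n. Qed.

Lemma orbit_chainE i j : P i j =
  (\sum_(v <- N (o i)) (`[< aut_orbit G (o j) v >])%:R) / (deg G (o i))%:R.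
Proof.
rewrite mxE; congr (_ / _).
transitivity (\sum_(v <- N (o i) | `[< aut_orbit G (o j) v >]) (1 : R)); last first.
  by rewrite [LHS]big_mkcond /=; apply: eq_bigr => v _; case: asboolP.
rewrite [RHS]big_fset_condE big_const_seq count_predT iter_addr_0 /set_size.
congr (#|` _|%:R); apply/fsetP => v; rewrite !inE /= (in_fset_set (N_fin _)).
rewrite in_fset_set; last exact: finite_setIr.
apply/idP/andP => [/set_mem[jv iv]|[/set_mem iv /asboolP jv]].
  by split; [exact: mem_set|exact/asboolP].
exact: mem_set.
Qed.

Lemma orbit_chain_avg (a : V -> R) (b : 'I_t -> R) i :
  (forall j v, aut_orbit G (o j) v -> a v = b j) ->
  (\sum_(v <- N (o i)) a v) / (deg G (o i))%:R = chain_op P b i.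
Proof.
move=> ab; rewrite /chain_op; under [RHS]eq_bigr do rewrite orbit_chainE mulrAC.
rewrite -mulr_suml; congr (_ / _); under [RHS]eq_bigr do rewrite mulr_suml.
rewrite exchange_big /=; apply: eq_bigr => v _.
have [j [jv juniq]] := o_reps v.
rewrite (bigD1 j)//= asboolT// mul1r (ab _ _ jv) big1 ?addr0// => k kj.
by case: asboolP => [kv|]; rewrite ?mul0r//; move/eqP: kj; case; apply/esym/juniq.
Qed.

Lemma orbit_chain_ge0 i j : 0 <= P i j.
Proof. by rewrite mxE divr_ge0. Qed.

Lemma orbit_chain_stoch i : \sum_j P i j = 1.
Proof.
have := orbit_chain_avg (a := fun=> 1) (b := fun=> 1) i (fun _ _ _ => erefl).
rewrite /chain_op; under [in X in _ = X -> _]eq_bigr do rewrite mulr1.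
move=> <-; rewrite big_const_seq count_predT iter_addr_0 /deg /set_size divff//.
by rewrite pnatr_eq0; exact: deg0.
Qed.

Lemma orbit_chain_gt0 i j : 0 < P i j <-> exists2 v, G (o i) v & aut_orbit G (o j) v.
Proof.
rewrite orbit_chainE pmulr_lgt0 ?invr_gt0//; split=> [s0|[v iv jv]].
  apply: contrapT => nv; move: s0; rewrite big1_seq ?ltxx// => v /= /[!memN] iv.
  by case: asboolP => // jv; exfalso; apply: nv; exists v.
by rewrite (big_fsetD1 v)/= ?memN// asboolT// ltr_pwDl// sumr_ge0.
Qed.

(** Mass transport for the indicator of the edges from the orbit of [o i] to the orbit
of [o j]. *)
Lemma orbit_chain_rev i j : st_weight i * P i j = st_weight j * P j i.
Proof.
pose b k x : R := (`[< aut_orbit G (o k) x >])%:R.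
have bo k u v : aut_orbit G u v -> b k u = b k v.
  move=> uv; congr (nat_of_bool _)%:R; apply: asbool_equiv_eq; split => h.
    exact: aut_orbit_trans h uv.
  exact: aut_orbit_trans h (aut_orbit_sym uv).
have bE k l : b k (o l) = (k == l)%:R.
  rewrite /b; congr (nat_of_bool _)%:R; apply/asboolP/eqP => [kl|->]; last exact: aut_orbit_refl.
  have [m [_ muniq]] := o_reps (o l).
  by rewrite -(muniq k kl) -(muniq l)//; exact: aut_orbit_refl.
have := mass_transport G_deg o_reps mu_mod mu_orbit (h := fun x y => b i x * b j y).
have -> : \sum_(k < t) (mu (o k))%:num^-1 * \sum_(v <- N (o k)) b i (o k) * b j v =
    (mu (o i))%:num^-1 * \sum_(v <- N (o i)) b j v.
  rewrite (bigD1 i)//= [X in _ + X]big1 ?addr0.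
    by congr (_ * _); apply: eq_bigr => v _; rewrite bE eqxx mul1r.
  move=> k ki; rewrite big1 ?mulr0// => v _; rewrite bE eq_sym (negbTE ki) mul0r//.
have -> : \sum_(k < t) (mu (o k))%:num^-1 * \sum_(v <- N (o k)) b i v * b j (o k) =
    (mu (o j))%:num^-1 * \sum_(v <- N (o j)) b i v.
  rewrite (bigD1 j)//= [X in _ + X]big1 ?addr0.
    by congr (_ * _); apply: eq_bigr => v _; rewrite bE eqxx mulr1.
  move=> k kj; rewrite big1 ?mulr0// => v _; rewrite bE eq_sym (negbTE kj) mulr0//.
have ag (g : V -> V) x : graph_aut G g -> aut_orbit G (g x) x.
  by move=> ga; apply: aut_orbit_sym; exists g.
move=> /(_ _) h; have {}h := h (fun g x y ga => congr2 *%R (bo i _ _ (ag g x ga)) (bo j _ _ (ag g y ga))).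
have E k l : st_weight k * P k l = ((\sum_(j < t) (mu (o j))%:num^-1)^-1 / deg_mass G o mu) *
    ((mu (o k))%:num^-1 * \sum_(v <- N (o k)) b l v).
  rewrite orbit_chainE /st_weight /orbit_weight.
  set S := \sum_(j < t) _; set dg := (deg G (o k))%:R.
  rewrite -/(b l); set Q := \sum_(v <- _) _.
  transitivity (S^-1 / deg_mass G o mu * ((mu (o k))%:num^-1 * Q) * (dg / dg)); first ring.
  by rewrite divff ?mulr1//; exact: (lt0r_neq0 (degR0 _)).
by rewrite !E h.
Qed.

(** In the connected graph G, the set of vertices whose orbit is in A is closed under
adjacency. *)
Lemma orbit_chain_irr (A : set 'I_t) : (exists i, A i) ->
  (forall i j, A i -> 0 < P i j -> A j) -> forall i, A i.
Proof.
move=> [i Ai] Ac j.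
pose B v := exists2 k, A k & aut_orbit G (o k) v.
have Bc u v : B u -> G u v -> B v.
  move=> [k Ak [g ag gu]] uv; have [g' ag' [gK g'K]] := graph_aut_inv ag.
  have [l [lv _]] := o_reps v; exists l => //; apply: Ac Ak _.
  apply/orbit_chain_gt0; exists (g' v).
    by have [_ <-] := ag; rewrite gu g'K.
  by apply: aut_orbit_trans lv _; exists g'.
have along q u : path G u q -> B u -> B (last u q).
  by elim: q u => //= v q IH u /andP[uv qP] Bu; apply: IH qP _; exact: Bc uv.
have [q qP qj] := G_conn (o i) (o j).
have Bi : B (o i) by exists i => //; exact: aut_orbit_refl.
have := along q (o i) qP Bi; rewrite qj => -[k Ak kj].
have [m [_ muniq]] := o_reps (o j).
by rewrite -(muniq j) ?(muniq k kj)//; exact: aut_orbit_refl.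
Qed.

End orbit_chain_theory.

(** * The spectral gap *)

Lemma variance_decomposition d (T : measurableType d) (R : realType)
    (m : probability T R) (u : T -> R) : sqint m u ->
  nrm2 m u = nrm2 m (fun x => u x - \int[m]_y u y) + (\int[m]_y u y) ^+ 2.
Proof.
move=> su; set c := \int[m]_y u y; have s1 := sqint_cst m (1 : R).
rewrite (_ : (fun x => u x - c) = (fun x => (- c) * 1 + u x)); last first.
  by apply/funext => x; rewrite mulr1 addrC.
rewrite nrm2_lin// {2}/nrm2 dotC.
have -> : dot m u (fun=> 1) = c by rewrite /dot; under eq_Rintegral do rewrite mulr1.
have -> : dot m (fun=> 1) (fun=> 1) = 1 by rewrite /dot Rintegral_prob_cst mulr1.
by ring.
Qed.

Section gap.
Context (R : realType) (V : countType) (G : sgraph V) (D : nat).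
Hypotheses (G_conn : connected_graph G) (G_deg : degrees_le G D).
Variables (t : nat) (o : 'I_t -> V) (mu : V -> {posnum R}).
Hypothesis o_reps : orbit_representatives G o.
Hypothesis mu_mod : modular_function G mu.
Hypothesis mu_orbit : forall x y, aut_orbit G x y -> mu x = mu y.
Hypothesis deg0 : forall x, deg G x != 0%N.
Variable v0 : V.
Variable L : probability (labeling R V) R.
Hypothesis L_unif : iid_uniform L.

Local Notation rc := (@rooted_class R V G D G_conn G_deg).
Local Notation nu := (bernoulli_measure G_conn G_deg o mu L).
Local Notation nu_st := (degree_biased nu).
Local Notation N x := (fset_set (nbrs G x)).
Local Notation Om := (Omega R D).
Local Notation F f v := (fun w : labeling R V => f (rc v w)).
Local Notation pi := (st_weight G o mu).
Local Notation M := (@real_markov R D).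
Local Notation P := (orbit_chain R G o).
Local Notation rmean f i := (root_mean G_conn G_deg L f (o i)).
Local Notation omean f := (orbit_mean G_conn G_deg o L f).
Implicit Types f g : Om -> R.

Let pi_gt0 i : 0 < pi i := st_weight_gt0 mu o_reps deg0 v0 i.
Let sqL f : sqint nu_st f -> forall v, sqint L (F f v).
Proof. exact: (sqint_lift o_reps deg0 v0 L_unif). Qed.
Let nrm2E f : sqint nu_st f -> nrm2 nu_st f = \sum_(i < t) pi i * nrm2 L (F f (o i)).
Proof. exact: (nrm2_nu_st o_reps deg0 v0 L_unif). Qed.
Let sM f : sqint nu_st f -> sqint nu_st (M f).
Proof. exact: (sqint_real_markov o_reps deg0 v0 L_unif). Qed.
Let sO f : sqint nu_st (omean f).
Proof. exact: sqint_orbit_mean. Qed.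
Let nu_st_fin : (nu_st setT < +oo)%E.
Proof. exact: (nu_st_fin G_conn G_deg mu o_reps deg0 v0 L). Qed.

Lemma root_mean_markov f i : sqint nu_st f ->
  rmean (M f) i = chain_op P (fun j => rmean f j) i.
Proof.
move=> sf; have [mf _] := sf.
have E g v : root_mean G_conn G_deg L g v = dot L (F g v) (fun=> 1).
  by rewrite /root_mean /dot; under [RHS]eq_Rintegral do rewrite mulr1.
rewrite E lift_real_markov// dot_walk_step//; [|exact: sqL|exact: sqint_cst].
under eq_bigr do rewrite -E.
by apply: (orbit_chain_avg G_deg o_reps) => j v jv; exact: root_mean_orbit.
Qed.

Lemma markov_orbit_fun f (a : 'I_t -> R) i w :
  (forall j v, aut_orbit G (o j) v -> f (rc v w) = a j) ->
  M f (rc (o i) w) = chain_op P a i.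
Proof.
move=> fa; rewrite real_markov_rc// /walk_step (negbTE (deg0 _)).
exact: (orbit_chain_avg G_deg o_reps).
Qed.

Lemma nrm2_orbit_decomposition f : sqint nu_st f ->
  nrm2 nu_st f = nrm2 nu_st (fun x => f x - omean f x) + chain_nrm2 pi (fun i => rmean f i).
Proof.
move=> sf; have [mf _] := sf.
rewrite (nrm2E sf) (nrm2E (sqintB sf (sO f))).
rewrite /chain_nrm2 -big_split /=; apply: eq_bigr => i _; rewrite -mulrDr; congr (_ * _).
rewrite (variance_decomposition (sqL sf (o i))); congr (nrm2 L _ + _).
by apply/funext => w; rewrite orbit_mean_rc.
Qed.

(** M sends the orbit mean of f to the orbit mean of M f, so it sends the centered part
of f to the centered part of M f. *)
Lemma nrm2_markov_decomposition f : sqint nu_st f ->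
  nrm2 nu_st (M f) = nrm2 nu_st (M (fun x => f x - omean f x)) +
    chain_nrm2 pi (chain_op P (fun i => rmean f i)).
Proof.
move=> sf; have [mf _] := sf; have sMf := sM sf; have [mMf _] := sMf.
have s0 := sqintB sf (sO f).
rewrite nrm2_orbit_decomposition//; congr (_ + _); last first.
  by apply: eq_bigr => i _; rewrite root_mean_markov.
rewrite (nrm2E (sM s0)) (nrm2E (sqintB sMf (sO (M f)))).
apply: eq_bigr => i _; congr (_ * nrm2 L _); apply/funext => w.
rewrite orbit_mean_rc// root_mean_markov//.
rewrite (_ : (fun x => f x - _) = (fun x => -1 * omean f x + f x)); last first.
  by apply/funext => x; rewrite mulN1r addrC.
rewrite real_markov_lin mulN1r addrC; congr (- _ + _).
apply/esym; apply: markov_orbit_fun => j v jv.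
by rewrite orbit_mean_rc//; exact: root_mean_orbit.
Qed.

Lemma dot_orbit_fun f e (eps : 'I_t -> R) : sqint nu_st f -> sqint nu_st e ->
  (forall i w, e (rc (o i) w) = eps i) ->
  dot nu_st f e = \sum_i pi i * (eps i * rmean f i).
Proof.
move=> sf se eE; rewrite (dot_nu_st o_reps deg0 v0 L_unif sf se).
apply: eq_bigr => i _; congr (_ * _); rewrite /root_mean -RintegralZl//; last first.
  exact: sqint_prob_integrable (sqL sf _).
by apply: eq_Rintegral => w _; rewrite eE mulrC.
Qed.

Hypothesis nonam : non_amenable R G.

(** Here e is an orbit function, given by an eigenfunction [eps] of the chain, so that M
preserves the orthogonal complement of 1 and e. In that space the centered part
of a function and its orbit mean are both contracted. The two cases of the
theorem are e = 0 and e = 1_X1 - 1_X2. *)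
Theorem markov_spectral_gap (e : Om -> R) (eps : 'I_t -> R) (c : R) :
  sqint nu_st e -> (forall i v w, aut_orbit G (o i) v -> e (rc v w) = eps i) ->
  (forall i, chain_op P eps i = c * eps i) ->
  (forall h : 'I_t -> R, \sum_i pi i * h i = 0 ->
     \sum_i pi i * (eps i * h i) = 0 ->
     chain_nrm2 pi (chain_op P h) = chain_nrm2 pi h -> forall i, h i = 0) ->
  (spectral_radius nu_st (L2perp nu_st (span_one e)) (@markov_operator R D) < 1)%E.
Proof.
move=> se eE eps_eig def.
have P0 := orbit_chain_ge0 R G o.
have P1 := orbit_chain_stoch R G_deg o_reps deg0.
have rev := orbit_chain_rev G_deg o_reps mu_mod mu_orbit deg0.
have [r /andP[r0 r1] gap] := chain_gap P0 P1 pi_gt0 rev def.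
have [s /andP[s0 s1] ctr] := centered_contraction G_conn G_deg o_reps mu_mod mu_orbit deg0 v0 L_unif nonam.
pose q := Num.max (s ^+ 2) r.
have q0 : 0 <= q by rewrite le_max sqr_ge0.
have q1 : q < 1 by rewrite gt_max r1 andbT expr_lt1// ltW.
have s1' : sqint nu_st (fun=> 1).
  by apply: (bounded_sqint (C := 1) nu_st_fin); [exact: measurable_cst|move=> x; rewrite normr1].
have ip1 f : sqint nu_st f -> dot nu_st f (fun=> 1) = \sum_i pi i * rmean f i.
  move=> sf; rewrite (dot_orbit_fun (eps := fun=> 1) sf s1')//.
  by apply: eq_bigr => i _; rewrite mul1r.
have ipe f : sqint nu_st f -> dot nu_st f e = \sum_i pi i * (eps i * rmean f i).
  by move=> sf; apply: dot_orbit_fun => // i w; exact/eE/aut_orbit_refl.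
apply: (@le_lt_trans _ _ (Num.sqrt q)%:E); last first.
  by rewrite lte_fin -[ltRHS]sqrtr1 ltr_sqrt.
apply: (spectral_radius_le (Mr := M) (W := perp_one nu_st e)).
- exact: markov_operator_complex.
- exact: sqrtr_ge0.
- by move=> f [].
- split; first exact: sqint0.
  + by rewrite /dot; under eq_Rintegral do rewrite mul0r; rewrite /Rintegral integral0.
  + by rewrite /dot; under eq_Rintegral do rewrite mul0r; rewrite /Rintegral integral0.
- by move=> a u v; exact: perp_one_lin.
- by move=> u; exact: perp_one_closed.
- exact: real_markov_lin.
- move=> f [sf f1 fe]; split; first exact: sM.
  + rewrite (ip1 _ (sM sf)); under eq_bigr do rewrite root_mean_markov//.
    by rewrite (chain_stationary P1 rev) -ip1.
  + rewrite (real_markov_self_adjoint o_reps mu_mod mu_orbit deg0 v0 L_unif sf se).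
    rewrite (dot_orbit_fun (eps := fun i => c * eps i) sf (sM se)); last first.
      by move=> i w; rewrite (markov_orbit_fun (a := eps)) ?eps_eig// => j v; exact: eE.
    under eq_bigr do rewrite -mulrA mulrCA.
    by rewrite -mulr_sumr -ipe// fe mulr0.
- move=> f [sf f1 fe].
  apply: nrm_le; first by rewrite mulr_ge0 ?nrm_ge0 ?sqrtr_ge0.
  rewrite exprMn nrm_sqr sqr_sqrtr//.
  rewrite nrm2_markov_decomposition// (nrm2_orbit_decomposition sf) mulrDr.
  have s0f := sqintB sf (sO f).
  apply: lerD.
    have := nrm2_le (ctr _ s0f (centered_sub_orbit_mean o_reps deg0 v0 L_unif sf)).
    rewrite exprMn nrm_sqr => /le_trans; apply.
    by rewrite ler_wpM2r ?nrm2_ge0// le_max lexx.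
  apply: (@le_trans _ _ (r * chain_nrm2 pi (fun i => rmean f i))).
    by apply: gap; [rewrite -ip1|rewrite -ipe].
  by rewrite ler_wpM2r ?(chain_nrm2_ge0 pi_gt0)// le_max lexx orbT.
- exact: L2perp_span_one.
Qed.

End gap.

(** * The bipartition of the graphing *)

Section bipartite_graphing.
Context (R : realType) (V : countType) (G : sgraph V) (D : nat).
Hypotheses (G_conn : connected_graph G) (G_deg : degrees_le G D).
Variables (t : nat) (o : 'I_t -> V) (mu : V -> {posnum R}).
Hypothesis o_reps : orbit_representatives G o.
Hypothesis deg0 : forall x, deg G x != 0%N.
Variable L : probability (labeling R V) R.

Local Notation rc := (@rooted_class R V G D G_conn G_deg).
Local Notation nu := (bernoulli_measure G_conn G_deg o mu L).
Local Notation P := (orbit_chain R G o).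
Variables T1 T2 : {set 'I_t}.
Hypothesis T12 : chain_bipartition P T1 T2.
Local Notation X T := (orbit_classes G_conn G_deg o T).

Lemma orbit_classes_rc (T : {set 'I_t}) i v w : aut_orbit G (o i) v ->
  X T (rc v w) <-> i \in T.
Proof.
move=> iv; split=> [[j [u [w' [jT ju /rc_orbit vu]]]]|iT]; last by exists i, v, w.
have [k [_ kuniq]] := o_reps v.
suff -> : i = j by [].
rewrite -(kuniq i iv); apply: kuniq.
exact: aut_orbit_trans ju (aut_orbit_sym vu).
Qed.

Lemma graphing_adj_rc v w y : graphing_adj (rc v w) y ->
  exists2 u, G v u & y = rc u w.
Proof.
move=> [a va ->]; have := @reprK _ (rl_class R D) (rc v w).
move=> /rc_piP[f [[g fK gK] fG fv fw]].
exists (g a); first by rewrite -fG gK fv.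
by apply/rc_piP; exists f; split => //; exists g.
Qed.

Definition realized : set (Omega R D) := [set x | exists v w, x = rc v w].

Lemma realized_bigcup : realized = \bigcup_(i in [set: 'I_t]) root_classes G_conn G_deg (o i).
Proof.
apply/seteqP; split=> [x [v [w ->]]|x [i _ [w ->]]]; last by exists (o i), w.
by have [i [iv _]] := o_reps v; exists i => //; exact: root_classes_orbit.
Qed.

(** Each component of the mixture that defines the measure is the law of a class of G. *)
Lemma unrealized_negligible : nu.-negligible (~` realized).
Proof.
exists (~` realized); split => //.
  apply: measurableC; rewrite realized_bigcup.
  apply: fin_bigcup_measurable => [|i _]; first exact: finite_finset.
  exact: measurable_root_classes.
rewrite /= /bernoulli_measure big1// => i _.
rewrite (_ : _ @^-1` _ = set0) ?measure0 ?mule0//.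
by rewrite -subset0 => w /=; apply; exists (o i), w.
Qed.

(** An edge of the graphing that starts at a class of G is given by an edge of G, and
the orbits of its ends are joined by an edge of the chain. *)
Lemma orbit_classes_bipartite : measurably_bipartite nu (X T1) (X T2).
Proof.
split; [exact: measurable_orbit_classes|exact: measurable_orbit_classes|].
exists (~` realized); first exact: unrealized_negligible.
split=> [x /contrapT[v [w ->]]|_ y /contrapT[v [w ->]] _ /graphing_adj_rc[u vu ->]].
  have [i [iv _]] := o_reps v; rewrite !(orbit_classes_rc _ w iv).
  by case: (chain_bipartition_cases T12 i) => -[i1 /negP i2]; [left|right].
have [i [iv _]] := o_reps v; have [j [ju _]] := o_reps u.
rewrite !(orbit_classes_rc _ w iv) !(orbit_classes_rc _ w ju).
apply: (chain_bipartition_alternates T12); apply/(orbit_chain_gt0 R G_deg o deg0).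
have [g [gb gG] gv] := aut_orbit_sym iv.
exists (g u); first by rewrite -gv gG.
by apply: aut_orbit_trans ju _; exists g.
Qed.

End bipartite_graphing.

Theorem theorem2 (R : realType) (V : countType) (G : sgraph V)
    (G_conn : connected_graph G) (G_lf : locally_finite G)
    (G_unimod : unimodular R G) (G_qt : quasi_transitive G)
    (G_nonam : non_amenable R G)
    (t : nat) (o : 'I_t -> V) (o_reps : orbit_representatives G o)
    (mu : V -> {posnum R}) (mu_mod : modular_function G mu)
    (D : nat) (G_deg : degrees_le G D)
    (L : probability (labeling R V) R) (L_unif : iid_uniform L) :
  let P := orbit_chain R G o in
  let nu := bernoulli_measure G_conn G_deg o mu L in
  let nu_st := degree_biased nu in
  (~ bipartite_chain P ->
     (spectral_radius nu_st (L2perp nu_st (constant_functions R (Omega R D)))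
        (@markov_operator R D) < 1)%E) /\
  (bipartite_chain P ->
     (exists T1 T2, chain_bipartition P T1 T2) /\
     forall T1 T2, chain_bipartition P T1 T2 ->
       let X1 := orbit_classes G_conn G_deg o T1 in
       let X2 := orbit_classes G_conn G_deg o T2 in
       measurably_bipartite nu X1 X2 /\
       (spectral_radius nu_st (L2perp nu_st (span_one_diff R X1 X2))
          (@markov_operator R D) < 1)%E).
Proof.
move=> P nu nu_st.
have mu_orbit x y : aut_orbit G x y -> mu x = mu y.
  have [mu' mu'_mod mu'_orbit] := G_unimod => xy.
  have := mu_mod x y; rewrite -(mu'_mod x y) (mu'_orbit _ _ xy) divff// => e.
  apply/val_inj; rewrite /= -[LHS](@divfK _ (mu y)%:num) ?e ?mul1r//.
have deg0 := non_amenable_deg G_conn G_deg G_nonam.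
have [v0 _] := G_nonam.
have P0 := orbit_chain_ge0 R G o.
have Psum := orbit_chain_stoch R G_deg o_reps deg0.
have pi0 := st_weight_gt0 mu o_reps deg0 v0.
have rev := orbit_chain_rev G_deg o_reps mu_mod mu_orbit deg0.
have irr := orbit_chain_irr (R := R) G_conn G_deg o_reps deg0.
have gap := @markov_spectral_gap R V G D G_conn G_deg t o mu o_reps mu_mod mu_orbit deg0 v0 L L_unif G_nonam.
have nu_st_fin : (nu_st setT < +oo)%E by exact: (nu_st_fin G_conn G_deg mu o_reps deg0 v0 L).
split=> [nb|bip].
  rewrite constant_functions_span_one.
  (* With e = 0 the eigenvalue condition is void and any c serves. *)
  apply: (gap _ (fun=> 0) 0) => //.
  - exact: sqint0.
  - by move=> i; rewrite /chain_op big1 ?mul0r// => j _; rewrite mulr0.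
  - by move=> h h1 _ he; exact: (nonbipartite_definite P0 Psum pi0 rev irr nb h1 he).
split; first exact: (bipartite_chain_bipartition P0 Psum pi0 rev irr bip).
move=> T1 T2 T12 X1 X2; split; first exact: orbit_classes_bipartite.
apply: (gap _ (part_sign R T1 T2) (-1)).
- apply: (bounded_sqint (C := 2) nu_st_fin).
    by apply: measurable_funB; apply: measurable_indic; exact: measurable_orbit_classes.
  move=> x; rewrite !indicE; case: (x \in X1); case: (x \in X2) => /=;
    rewrite ?subrr ?subr0 ?sub0r ?normrN ?normr1 ?normr0//; lra.
- move=> i v w iv; rewrite !indicE /part_sign.
  have XE T : (rooted_class G_conn G_deg v w \in orbit_classes G_conn G_deg o T) = (i \in T).
    by apply/idP/idP => [/set_mem/(orbit_classes_rc G_conn G_deg o_reps T w iv)|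
      /(orbit_classes_rc G_conn G_deg o_reps T w iv)/mem_set].
  by rewrite !XE.
- by move=> i; rewrite mulN1r; exact: chain_op_part_sign.
- by move=> h h1 h2; exact: (bipartite_definite P0 Psum pi0 rev irr T12 h1 h2).
Qed.
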